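(* Let $k$ be an algebraically closed field, $X$ a smooth $k$-scheme of pure dimension $n$, $E$ a locally free sheaf on $X$ of rank $e\le n$, and $\nabla:E\to\Omega_X\otimes E$ a connection such that $E$ is generated as an $\mathcal O_X$-module by its horizontal sections $\ker(\nabla)$. Let $s\in\Gamma(X,E)$, let $j\ge0$ be an integer, and let $x\in\Sigma^{1,j}(s)\setminus\Sigma^{1,j+1}(s)$ be a closed point. Let $U$ be an open neighborhood of $x$, $v_1,\dots,v_e\in\Gamma(U,E)$ a basis of $E$ over $U$ with $\nabla v_l=0$ for all $l$, and $s|_U=\sum_{l=1}^e f_lv_l$ with $f_l\in\Gamma(U,\mathcal O_X)$. Let $x_1,\dots,x_n\in\Gamma(U,\mathcal O_X)$ be étale coordinates on $U$ with $x_a(x)=0$ for all $a$ and $$(f_1,\dots,f_e)=(f_1(x)+x_1,\dots,f_{e-1}(x)+x_{e-1},f_e),$$ so that $\widehat{\mathcal O}_{X,x}=k[[x_1,\dots,x_n]]$. Then the nonnegative integer $n-e+1-j$ is even if $k$ has characteristic $2$. Let $$q:=\begin{cases}x_e^2+\dots+x_{n-j}^2&\text{if }\operatorname{char}(k)\ne2,\\ x_ex_{e+1}+\dots+x_{n-j-1}x_{n-j}&\text{if }\operatorname{char}(k)=2.\end{cases}$$ Then there exist a power series $h\in k[[x_1,\dots,x_n]]$ which is contained in the ideal $$\langle x_1,\dots,x_{e-1}\rangle+\langle x_{n-j+1},\dots,x_n\rangle^2$$ and which does not depend on the variables $x_e,\dots,x_{n-j}$, and an automorphism $\phi$ of $\widehat{\mathcal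 O}_{X,x}=k[[x_1,\dots,x_n]]$ as a local $k[[x_1,\dots,x_{e-1}]]$-algebra, such that $\phi(f_e)=f_e(x)+q+h$.
   Context: A connection is a $k$-linear map $\nabla:E\to\Omega_X\otimes E$ with $\nabla(fs)=df\otimes s+f\nabla s$; $s$ is horizontal if $\nabla s=0$. Sections $x_1,\dots,x_n$ are étale coordinates on $U$ if $dx_1,\dots,dx_n$ is a basis of $\Omega_U$. Degeneracy loci: for a map $\alpha:A\to B$ of locally free sheaves of finite ranks $a,b$ on a scheme $Y$, with $m=\min(a,b)$, $\Sigma^i(\alpha)\subseteq Y$ is the closed subscheme defined by $\wedge^{m-i+1}\alpha=0$ if $0\le i\le m+1$, and empty for $i>m+1$. Critical loci: regard $\nabla s$ as a map $T_X\to E$, where $T_X=\Omega_X^\vee$, and put $\Sigma^i(s):=\Sigma^i(\nabla s)$. Intrinsic differential: for a map $\alpha:A\to B$ of locally free sheaves on $X$, on $\Sigma:=\Sigma^i(\alpha)\setminus\Sigma^{i+1}(\alpha)$ the sheaves $\ker(\alpha_\Sigma)$ and $\operatorname{coker}(\alpha_\Sigma)$ are locally free. The intrinsic differential $\mathbf d_\Sigma\alpha:(T_X)_\Sigma\to\mathcal{H}om(\ker\alpha_\Sigma,\operatorname{coker}\alpha_\Sigma)$ is given, in local bases of $A,B$, by sending a vector field $\partial$ to the homomorphism induced by the matrix obtained by applying $\partial$ to the entries of the matrix of $\alpha$ (independent of the bases). Second-order loci: let $\Sigma=\Sigma^i(s)\setminus\Sigma^{i+1}(s)$, $K=\ker((\nabla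 s)_\Sigma)\subseteq(T_X)_\Sigma$, $C=\operatorname{coker}((\nabla s)_\Sigma)$. The second intrinsic differential $\mathbf d^2_\Sigma s:K\to\mathcal{H}om(K,C)$ is the restriction of $\mathbf d_\Sigma(\nabla s)$ to $K$, and $\Sigma^{i,j}(s):=\Sigma^j(\mathbf d^2_\Sigma s)\subseteq\Sigma$. *)

(* Defs.v *)
From HB Require Import structures.
From mathcomp Require Import all_boot all_order all_algebra.
From mathcomp Require Import generic_quotient.
From mathcomp Require Import mathcomp_extra boolp classical_sets topology.
(* The notations of multinomials clash with those of MathComp-Analysis. *)
From mathcomp Require Import -(notations) mpoly.

Set Implicit Arguments.
Unset Strict Implicit.
Unset Printing Implicit Defensive.

Import GRing.Theory.
Local Open Scope ring_scope.
Local Open Scope classical_set_scope.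
Local Open Scope quotient_scope.

Section Ideals.
Variable A : comPzRingType.

Definition is_unit (a : A) : Prop := exists b, a * b = 1.

Definition ideal_gen (S : set A) : set A :=
  [set a | exists (N : nat) (b g : 'I_N -> A),
     (forall i, S (g i)) /\ a = \sum_i b i * g i].

Definition ideal_pow (I : set A) (d : nat) : set A :=
  ideal_gen [set a | exists f : 'I_d -> A, (forall i, I (f i)) /\ a = \prod_i f i].

Definition ideal_add (I J : set A) : set A :=
  [set a | exists b c, [/\ I b, J c & a = b + c]].

Definition is_ideal (I : set A) : Prop :=
  [/\ I 0, forall a b, I a -> I b -> I (a + b) & forall a b, I b -> I (a * b)].

Definition is_prime_ideal (P : set A) : Prop :=
  [/\ is_ideal P, ~ P 1 & forall a b, P (a * b) -> P a \/ P b].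

(* In a local ring, this is the maximal ideal. *)
Definition nonunits : set A := [set a | ~ is_unit a].

End Ideals.
Arguments nonunits A : clear implicits.

(* [c] exhibits [B] as the projective limit of the rings [A / I ^ d]: with
   [J d] the ideal [I ^ d B], the map [c] induces isomorphisms
   [A / I ^ d = B / J d], and [B] is complete and separated. *)
Definition is_adic_completion (A B : comPzRingType) (I : set A) (c : A -> B) : Prop :=
  let J d := ideal_gen (c @` ideal_pow I d) in
  [/\ forall d b, exists a, J d (b - c a),
      forall d a, J d (c a) -> ideal_pow I d a
    & forall b : nat -> B, (forall d, J d (b d.+1 - b d)) ->
        exists! l, forall d, J d (l - b d)].

Record fps (n : nat) (R : comNzRingType) := Fps { fcoef : multinom n -> R }.

HB.instance Definition _ n R := gen_eqMixin (fps n R).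
HB.instance Definition _ n R := gen_choiceMixin (fps n R).

Section FpsRing.
Variables (n : nat) (R : comNzRingType).
Implicit Types f g h : fps n R.

Lemma fpsP f g : (forall m, fcoef f m = fcoef g m) -> f = g.
Proof. by case: f g => [f] [g] /= e; congr Fps; apply/funext. Qed.

Definition fps_zero : fps n R := Fps (fun=> 0).
Definition fps_opp f : fps n R := Fps (fun m => - fcoef f m).
Definition fps_add f g : fps n R := Fps (fun m => fcoef f m + fcoef g m).
Definition fps_const (c : R) : fps n R := Fps (fun m => if m == mnm0 then c else 0).
Definition fps_mul f g : fps n R := Fps (fun m =>
  \sum_(k : bmultinom n (mdeg m).+1 * bmultinom n (mdeg m).+1
          | m == mnm_add (k.1 : multinom n) (k.2 : multinom n))
     fcoef f k.1 * fcoef g k.2).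

Fact fps_addA : associative fps_add.
Proof. by move=> f g h; apply: fpsP => m /=; rewrite addrA. Qed.
Fact fps_addC : commutative fps_add.
Proof. by move=> f g; apply: fpsP => m /=; rewrite addrC. Qed.
Fact fps_add0 : left_id fps_zero fps_add.
Proof. by move=> f; apply: fpsP => m /=; rewrite add0r. Qed.
Fact fps_addN : left_inverse fps_zero fps_opp fps_add.
Proof. by move=> f; apply: fpsP => m /=; rewrite addNr. Qed.

HB.instance Definition _ :=
  GRing.isZmodule.Build (fps n R) fps_addA fps_addC fps_add0 fps_addN.

Definition fps_trunc (d : nat) f : mpoly n R :=
  \sum_(m : bmultinom n d) fcoef f m *: mpolyX R m.

Lemma fps_truncE d f (m : multinom n) :
  (mdeg m < d)%N -> mcoeff m (fps_trunc d f) = fcoef f m.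
Proof.
move=> md; rewrite /fps_trunc raddf_sum /= (bigD1 (BMultinom md)) //=.
rewrite mcoeffZ mcoeffX eqxx mulr1 big1 ?addr0 // => i ne.
rewrite mcoeffZ mcoeffX; case: eqP => [e|_]; last by rewrite mulr0.
by case/eqP: ne; apply: val_inj; rewrite /= -e.
Qed.

Lemma fps_mulE f g (p q : mpoly n R) (m : multinom n) :
  (forall k, (mdeg k <= mdeg m)%N -> mcoeff k p = fcoef f k) ->
  (forall k, (mdeg k <= mdeg m)%N -> mcoeff k q = fcoef g k) ->
  fcoef (fps_mul f g) m = mcoeff m (p * q).
Proof.
move=> pf qg; rewrite mcoeffM /=; apply: eq_bigr => -[[k hk] [l hl]] /= _.
by rewrite pf // qg.
Qed.

Let tr d f (m : multinom n) : (mdeg m <= d)%N ->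
  mcoeff m (fps_trunc d.+1 f) = fcoef f m.
Proof. by move=> ?; apply: fps_truncE. Qed.

Let trM d f g (m : multinom n) : (mdeg m <= d)%N ->
  fcoef (fps_mul f g) m = mcoeff m (fps_trunc d.+1 f * fps_trunc d.+1 g).
Proof.
by move=> md; apply: fps_mulE => k km; apply: tr; apply: leq_trans km md.
Qed.

Fact fps_mulA : associative fps_mul.
Proof.
move=> f g h; apply: fpsP => m; set d := mdeg m.
rewrite (@fps_mulE _ _ (fps_trunc d.+1 f) (fps_trunc d.+1 g * fps_trunc d.+1 h)).
- rewrite (@fps_mulE _ _ (fps_trunc d.+1 f * fps_trunc d.+1 g) (fps_trunc d.+1 h)).
  + by rewrite mulrA.
  + by move=> k kd; rewrite -trM.
  + by move=> k kd; rewrite tr.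
- by move=> k kd; rewrite tr.
- by move=> k kd; rewrite -trM.
Qed.

Fact fps_mulC : commutative fps_mul.
Proof.
by move=> f g; apply: fpsP => m; rewrite !(@trM (mdeg m)) // mulrC.
Qed.

Fact fps_mul1 : left_id (fps_const 1) fps_mul.
Proof.
move=> f; apply: fpsP => m.
rewrite (@fps_mulE _ _ 1 (fps_trunc (mdeg m).+1 f)) => [|k _|k].
- by rewrite mul1r tr.
- by rewrite mcoeff1 /=; case: eqP.
- exact: tr.
Qed.

Fact fps_mulD : left_distributive fps_mul fps_add.
Proof.
move=> f g h; apply: fpsP => m /=; rewrite -big_split /=.
by apply: eq_bigr => k _; rewrite mulrDl.
Qed.

Fact fps_1neq0 : fps_const 1 != 0.
Proof.
by apply/eqP => /(congr1 (fun f => fcoef f mnm0)) /= /eqP; rewrite eqxx oner_eq0.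
Qed.

HB.instance Definition _ := GRing.Zmodule_isComNzRing.Build (fps n R)
  fps_mulA fps_mulC fps_mul1 fps_mulD fps_1neq0.

Definition fps_var (i : 'I_n) : fps n R :=
  Fps (fun m => if m == mnm1 i then 1 else 0).

Definition fps_indep (f : fps n R) (P : pred 'I_n) : Prop :=
  forall (m : multinom n) (i : 'I_n), P i -> m i != 0%N -> fcoef f m = 0.

End FpsRing.

Record opens (X : topologicalType) := Opens { oset :> set X; oopen : open oset }.
Definition opens_mem (X : topologicalType) (U : opens X) (x : X) : Prop := oset U x.
Coercion opens_mem : opens >-> Funclass.

Definition opensT (X : topologicalType) : opens X := Opens openT.
Definition opensI (X : topologicalType) (U V : opens X) : opens X :=
  Opens (openI (oopen U) (oopen V)).

Definition is_sheaf (X : topologicalType) (F : opens X -> Type)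
    (r : forall U V : opens X, V `<=` U -> F U -> F V) : Prop :=
  [/\ forall (U : opens X) (h : U `<=` U) (s : F U), r U U h s = s,
      forall (U V W : opens X) (hUV : V `<=` U) (hVW : W `<=` V) (hUW : W `<=` U)
        (s : F U), r V W hVW (r U V hUV s) = r U W hUW s
    & forall (U : opens X) (J : Type) (V : J -> opens X)
        (hV : forall j, V j `<=` U), U `<=` \bigcup_j V j ->
      forall t : (forall j, F (V j)),
        (forall i j (W : opens X) (hi : W `<=` V i) (hj : W `<=` V j),
           r (V i) W hi (t i) = r (V j) W hj (t j)) ->
        exists! s : F U, forall j, r U (V j) (hV j) s = t j].

Record ringed_space (k : fieldType) := RingedSpace {
  rspace :> topologicalType;
  sec : opens rspace -> comPzRingType;
  res : forall U V : opens rspace, V `<=` U -> {rmorphism sec U -> sec V};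
  res_sheaf : @is_sheaf rspace sec (fun U V h => res h);
  base : {rmorphism k -> sec (opensT rspace)} }.

Section Stalk.
Variables (k : fieldType) (X : ringed_space k).

Definition const (U : opens X) (c : k) : sec U :=
  res (@subsetT X U : U `<=` opensT X) (base X c).

Lemma res_id (U : opens X) (h : U `<=` U) (s : sec U) : res h s = s.
Proof. by have [+ _ _] := res_sheaf X; apply. Qed.

Lemma res_res (U V W : opens X) (h1 : V `<=` U) (h2 : W `<=` V) (h3 : W `<=` U)
  (s : sec U) : res h2 (res h1 s) = res h3 s.
Proof. by have [_ + _] := res_sheaf X; apply. Qed.

Variable x : X.

Record pregerm_ := Pregerm { pnbh : opens X; pmem : pnbh x; psec : sec pnbh }.
Definition pregerm := {classic pregerm_}.

Definition pequiv_prop (s t : pregerm) : Prop :=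
  exists (W : opens X) (h1 : W `<=` pnbh s) (h2 : W `<=` pnbh t),
    W x /\ res h1 (psec s) = res h2 (psec t).
Definition pequiv (s t : pregerm) : bool := `[< pequiv_prop s t >].

Fact pequiv_refl : reflexive pequiv.
Proof. by move=> s; apply/asboolP; exists (pnbh s), (fun _ => id), (fun _ => id); split=> //; exact: pmem. Qed.

Fact pequiv_sym : ssrbool.symmetric pequiv.
Proof.
by move=> s t; apply/asboolP/asboolP => -[W [h1 [h2 [Wx e]]]]; exists W, h2, h1.
Qed.

Fact pequiv_trans : transitive pequiv.
Proof.
move=> t s u /asboolP[W [h1 [h2 [Wx e]]]] /asboolP[W' [h1' [h2' [Wx' e']]]].
have i1 : opensI W W' `<=` W by move=> y [].
have i2 : opensI W W' `<=` W' by move=> y [].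
apply/asboolP; exists (opensI W W'), (subset_trans i1 h1), (subset_trans i2 h2').
split; first by split.
rewrite -(res_res h1 i1) e (res_res _ _ (subset_trans i2 h1')).
by rewrite -(res_res h1' i2) e' (res_res _ _ (subset_trans i2 h2')).
Qed.

Canonical pequiv_equiv := EquivRel pequiv pequiv_refl pequiv_sym pequiv_trans.

Definition stalk := {eq_quot pequiv}%qT.
HB.instance Definition _ := Choice.on stalk.

Definition germ_def (U : opens X) (Ux : U x) (s : sec U) : stalk :=
  \pi_stalk (Pregerm Ux s : pregerm).

Lemma germP (U V : opens X) (Ux : U x) (Vx : V x) (s : sec U) (t : sec V) :
  germ_def Ux s = germ_def Vx t <->
  exists (W : opens X) (h1 : W `<=` U) (h2 : W `<=` V), W x /\ res h1 s = res h2 t.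
Proof.
split=> [/eqquotP/asboolP //|H].
by apply/eqquotP/asboolP.
Qed.

Lemma germ_surj (a : stalk) : exists (U : opens X) (Ux : U x) (s : sec U), a = germ_def Ux s.
Proof.
elim/quotW: a => -[U Ux s]; exists U, Ux, s; by [].
Qed.

Lemma germ_res (U V : opens X) (Ux : U x) (Vx : V x) (h : V `<=` U) (s : sec U) :
  germ_def Vx (res h s) = germ_def Ux s.
Proof.
by apply/germP; exists V, (fun _ => id), h; split=> //; rewrite res_id.
Qed.

Let lift2 (op : forall U : opens X, sec U -> sec U -> sec U) (a b : stalk) : stalk :=
  let s := repr a in let t := repr b in
  @germ_def (opensI (pnbh s) (pnbh t)) (conj (pmem s) (pmem t))
    (op _ (res (@subIsetl _ _ _ : opensI (pnbh s) (pnbh t) `<=` pnbh s) (psec s))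
          (res (@subIsetr _ _ _ : opensI (pnbh s) (pnbh t) `<=` pnbh t) (psec t))).

Let lift2E op (U : opens X) (Ux : U x) (s t : sec U) :
  (forall (U V : opens X) (h : V `<=` U) (s t : sec U),
     res h (op U s t) = op V (res h s) (res h t)) ->
  lift2 op (germ_def Ux s) (germ_def Ux t) = germ_def Ux (op U s t).
Proof.
move=> opres; rewrite /lift2.
have rep (u : sec U) : exists (W : opens X) (h1 : W `<=` pnbh (repr (germ_def Ux u)))
    (h2 : W `<=` U), W x /\ res h1 (psec (repr (germ_def Ux u))) = res h2 u.
  apply/(germP (pmem (repr (germ_def Ux u))) Ux).
  rewrite -[RHS]reprK /germ_def; by case: (repr _).
have [W [h1 [h2 [Wx e]]]] := rep s; have [W' [h1' [h2' [Wx' e']]]] := rep t.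
have i1 : opensI W W' `<=` W by move=> y [].
have i2 : opensI W W' `<=` W' by move=> y [].
apply/germP; exists (opensI W W').
have j1 : opensI W W' `<=` opensI (pnbh (repr (germ_def Ux s))) (pnbh (repr (germ_def Ux t))).
  by move=> y [? ?]; split; [exact: (h1 y) | exact: (h1' y)].
have j2 := subset_trans i1 h2; exists j1, j2; split; first by split.
rewrite !opres (res_res _ _ (subset_trans i1 h1)) (res_res _ _ (subset_trans i2 h1')).
rewrite -(res_res h1 i1) e -(res_res h1' i2) e' (res_res _ _ j2).
by rewrite (res_res _ _ j2).
Qed.

Let common (a b : stalk) : exists (U : opens X) (Ux : U x) (s t : sec U),
  a = germ_def Ux s /\ b = germ_def Ux t.
Proof.
have [U [Ux [s ->]]] := germ_surj a; have [V [Vx [t ->]]] := germ_surj b.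
have i1 : opensI U V `<=` U by move=> y [].
have i2 : opensI U V `<=` V by move=> y [].
have UVx : opensI U V x by split.
by exists (opensI U V), UVx, (res i1 s), (res i2 t); rewrite !germ_res.
Qed.

Let common3 (a b c : stalk) : exists (U : opens X) (Ux : U x) (s t u : sec U),
  [/\ a = germ_def Ux s, b = germ_def Ux t & c = germ_def Ux u].
Proof.
have [U [Ux [s [t [-> ->]]]]] := common a b; have [V [Vx [u ->]]] := germ_surj c.
have i1 : opensI U V `<=` U by move=> y [].
have i2 : opensI U V `<=` V by move=> y [].
have UVx : opensI U V x by split.
by exists (opensI U V), UVx, (res i1 s), (res i1 t), (res i2 u); rewrite !germ_res.
Qed.

Let Tx : opensT X x. Proof. by []. Qed.

Definition stalk_zero : stalk := germ_def Tx 0.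
Definition stalk_one : stalk := germ_def Tx 1.
Definition stalk_add : stalk -> stalk -> stalk := lift2 (fun U s t => s + t).
Definition stalk_mul : stalk -> stalk -> stalk := lift2 (fun U s t => s * t).
Definition stalk_opp (a : stalk) : stalk := 
  germ_def (pmem (repr a)) (- psec (repr a)).

Let addE (U : opens X) (Ux : U x) (s t : sec U) :
  stalk_add (germ_def Ux s) (germ_def Ux t) = germ_def Ux (s + t).
Proof. by apply: lift2E => *; rewrite rmorphD. Qed.

Let mulE (U : opens X) (Ux : U x) (s t : sec U) :
  stalk_mul (germ_def Ux s) (germ_def Ux t) = germ_def Ux (s * t).
Proof. by apply: lift2E => *; rewrite rmorphM. Qed.

Let oppE (U : opens X) (Ux : U x) (s : sec U) :
  stalk_opp (germ_def Ux s) = germ_def Ux (- s).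
Proof.
have /germP[W [h1 [h2 [Wx e]]]] :
    germ_def (pmem (repr (germ_def Ux s))) (psec (repr (germ_def Ux s))) = germ_def Ux s.
  by rewrite -[RHS]reprK /germ_def; case: (repr _).
by apply/germP; exists W, h1, h2; split=> //; rewrite !rmorphN e.
Qed.

Let zeroE (U : opens X) (Ux : U x) : stalk_zero = germ_def Ux 0.
Proof. by rewrite /stalk_zero /stalk_one -(germ_res Tx Ux (@subsetT _ _)) rmorph0. Qed.

Let oneE (U : opens X) (Ux : U x) : stalk_one = germ_def Ux 1.
Proof. by rewrite /stalk_zero /stalk_one -(germ_res Tx Ux (@subsetT _ _)) rmorph1. Qed.

Fact stalk_addA : associative stalk_add.
Proof.
by move=> a b c; have [U [Ux [s [t [u [-> -> ->]]]]]] := common3 a b c; rewrite !addE addrA.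
Qed.
Fact stalk_addC : commutative stalk_add.
Proof. by move=> a b; have [U [Ux [s [t [-> ->]]]]] := common a b; rewrite !addE addrC. Qed.
Fact stalk_add0 : left_id stalk_zero stalk_add.
Proof. by move=> a; have [U [Ux [s ->]]] := germ_surj a; rewrite (zeroE Ux) addE add0r. Qed.
Fact stalk_addN : left_inverse stalk_zero stalk_opp stalk_add.
Proof. by move=> a; have [U [Ux [s ->]]] := germ_surj a; rewrite (zeroE Ux) oppE addE addNr. Qed.
Fact stalk_mulA : associative stalk_mul.
Proof.
by move=> a b c; have [U [Ux [s [t [u [-> -> ->]]]]]] := common3 a b c; rewrite !mulE mulrA.
Qed.
Fact stalk_mulC : commutative stalk_mul.
Proof. by move=> a b; have [U [Ux [s [t [-> ->]]]]] := common a b; rewrite !mulE mulrC. Qed.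
Fact stalk_mul1 : left_id stalk_one stalk_mul.
Proof. by move=> a; have [U [Ux [s ->]]] := germ_surj a; rewrite (oneE Ux) mulE mul1r. Qed.
Fact stalk_mulD : left_distributive stalk_mul stalk_add.
Proof.
move=> a b c; have [U [Ux [s [t [u [-> -> ->]]]]]] := common3 a b c.
by rewrite !(addE, mulE) mulrDl.
Qed.

HB.instance Definition _ :=
  GRing.isZmodule.Build stalk stalk_addA stalk_addC stalk_add0 stalk_addN.
HB.instance Definition _ := GRing.Zmodule_isComPzRing.Build stalk
  stalk_mulA stalk_mulC stalk_mul1 stalk_mulD.

Section Germ.
Variables (U : opens X) (Ux : U x).
Definition germ : sec U -> stalk := germ_def Ux.

Fact germ_is_zmod : zmod_morphism germ.
Proof.
move=> s t; rewrite /germ.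
have -> : germ_def Ux s - germ_def Ux t =
  stalk_add (germ_def Ux s) (stalk_opp (germ_def Ux t)) by [].
by rewrite oppE addE.
Qed.
Fact germ_is_monoid : monoid_morphism germ.
Proof.
split; first by rewrite /germ -oneE.
by move=> s t; rewrite /germ -mulE.
Qed.
HB.instance Definition _ := GRing.isZmodMorphism.Build _ _ germ germ_is_zmod.
HB.instance Definition _ := GRing.isMonoidMorphism.Build _ _ germ germ_is_monoid.
End Germ.

End Stalk.

Section Schemes.
Variables (k : fieldType) (X : ringed_space k).

(* The value [f(x)] of [f] at [x], when it lies in the base field (as it does
   for closed points of schemes locally of finite type over an algebraically
   closed field). *)
Definition value (x : X) (U : opens X) (Ux : U x) (f : sec U) : k :=
  xget 0 [set a | nonunits _ (germ Ux (f - const U a))].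

Definition principal_open (U : opens X) (f : sec U) : set X :=
  [set y | exists Uy : U y, is_unit (germ Uy f)].

(* [U] is an affine scheme: mapping [y] to the ideal of the sections whose
   germ at [y] is not invertible is a homeomorphism from [U] onto the prime
   spectrum of [sec U], and the sections over the principal open set of [f] are
   the localization of [sec U] at the powers of [f]. *)
Definition is_affine_open (U : opens X) : Prop :=
  let P (y : X) (Uy : U y) : set (sec U) := [set f | nonunits _ (germ Uy f)] in
  [/\ forall y (Uy : U y), is_prime_ideal (P y Uy),
      forall Q : set (sec U), is_prime_ideal Q ->
        exists! y, exists Uy : U y, P y Uy = Q,
      forall (V : opens X) y, V `<=` U -> V y ->
        exists f : sec U, principal_open f y /\ principal_open f `<=` V
    & forall (f : sec U) (W : opens X) (h : W `<=` U),
        oset W = principal_open f ->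
        [/\ is_unit (res h f),
            forall t : sec W, exists (N : nat) (a : sec U), res h (f ^+ N) * t = res h a
          & forall a : sec U, res h a = 0 -> exists N : nat, f ^+ N * a = 0]].

Definition is_scheme : Prop :=
  forall x : X, exists U : opens X, U x /\ is_affine_open U.

(* [sec U = k[y_1, ..., y_(n+r)] / (g_1, ..., g_r)], where the Jacobian
   determinant of the [g_i] in the last [r] variables is invertible. *)
Definition is_standard_smooth (n : nat) (U : opens X) : Prop :=
  exists (r : nat) (g : 'I_r -> mpoly (n + r) k)
    (ev : {rmorphism mpoly (n + r) k -> sec U}),
    [/\ forall a : k, ev (mpolyC (n + r) a) = const U a,
        forall f : sec U, exists p, ev p = f,
        forall p, ev p = 0 <-> ideal_gen (range g) p
      & is_unit (ev (\det (\matrix_(i < r, l < r) mderiv (rshift n l) (g i))))].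

Definition is_smooth (n : nat) : Prop :=
  forall x : X, exists U : opens X,
    [/\ U x, is_affine_open U & is_standard_smooth n U].

End Schemes.

Record scheme (k : fieldType) := Scheme {
  scheme_space :> ringed_space k;
  scheme_affine : is_scheme scheme_space }.

Record modsheaf (k : fieldType) (X : ringed_space k) := Modsheaf {
  msec : forall U : opens X, lmodType (sec U);
  mres : forall U V : opens X, V `<=` U -> msec U -> msec V;
  mresD : forall (U V : opens X) (h : V `<=` U) (s t : msec U),
    mres h (s + t) = mres h s + mres h t;
  mresZ : forall (U V : opens X) (h : V `<=` U) (f : sec U) (s : msec U),
    mres h (f *: s) = res h f *: mres h s;
  mres_sheaf : @is_sheaf X msec mres }.

Section Modules.
Variables (k : fieldType) (X : ringed_space k).
Implicit Types M N P : modsheaf X.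

Definition restrict M (U : opens X) (s : msec M (opensT X)) : msec M U :=
  mres (@subsetT X U : U `<=` opensT X) s.

Definition is_mod_hom M N (h : forall U : opens X, msec M U -> msec N U) : Prop :=
  [/\ forall U s t, h U (s + t) = h U s + h U t,
      forall U f s, h U (f *: s) = f *: h U s
    & forall (U V : opens X) (i : V `<=` U) s, h V (mres i s) = mres i (h U s)].

Definition is_basis M (U : opens X) (r : nat) (v : 'I_r -> msec M U) : Prop :=
  forall (V : opens X) (h : V `<=` U) (t : msec M V),
    exists! c : 'I_r -> sec V, t = \sum_i c i *: mres h (v i).

Definition is_locally_free M (r : nat) : Prop :=
  forall x : X, exists (U : opens X) (v : 'I_r -> msec M U), U x /\ is_basis v.

Definition is_derivation M (D : forall U : opens X, sec U -> msec M U) : Prop :=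
  [/\ forall U f g, D U (f + g) = D U f + D U g,
      forall U f g, D U (f * g) = f *: D U g + g *: D U f,
      forall U (a : k), D U (const U a) = 0
    & forall (U V : opens X) (i : V `<=` U) f, D V (res i f) = mres i (D U f)].

Definition is_bilinear M N P
    (b : forall U : opens X, msec M U -> msec N U -> msec P U) : Prop :=
  [/\ forall U s s' t, b U (s + s') t = b U s t + b U s' t,
      forall U s t t', b U s (t + t') = b U s t + b U s t',
      forall U f s t, b U (f *: s) t = f *: b U s t,
      forall U f s t, b U s (f *: t) = f *: b U s t
    & forall (U V : opens X) (i : V `<=` U) s t,
        b V (mres i s) (mres i t) = mres i (b U s t)].

Record differentials := Differentials {
  Omega :> modsheaf X;
  diff : forall U : opens X, sec U -> msec Omega U;
  diff_derivation : is_derivation diff;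
  diff_universal : forall M (D : forall U : opens X, sec U -> msec M U),
    is_derivation D ->
    exists h : forall U : opens X, msec Omega U -> msec M U,
      [/\ is_mod_hom h, forall U f, h U (diff f) = D U f
        & forall h' : forall U : opens X, msec Omega U -> msec M U,
            is_mod_hom h' -> (forall U f, h' U (diff f) = D U f) ->
            forall U w, h' U w = h U w] }.

Record tensor_product M N := TensorProduct {
  tensor :> modsheaf X;
  tens : forall U : opens X, msec M U -> msec N U -> msec tensor U;
  tens_bilinear : is_bilinear tens;
  tens_universal : forall P (b : forall U : opens X, msec M U -> msec N U -> msec P U),
    is_bilinear b ->
    exists h : forall U : opens X, msec tensor U -> msec P U,
      [/\ is_mod_hom h, forall U s t, h U (tens s t) = b U s t
        & forall h' : forall U : opens X, msec tensor U -> msec P U,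
            is_mod_hom h' -> (forall U s t, h' U (tens s t) = b U s t) ->
            forall U w, h' U w = h U w] }.

Variables (Om : differentials) (E : modsheaf X) (T : tensor_product Om E).

Definition is_connection (nabla : forall U : opens X, msec E U -> msec T U) : Prop :=
  [/\ forall U s t, nabla U (s + t) = nabla U s + nabla U t,
      forall U (a : k) s, nabla U (const U a *: s) = const U a *: nabla U s,
      forall (U V : opens X) (i : V `<=` U) s, nabla V (mres i s) = mres i (nabla U s)
    & forall U f s, nabla U (f *: s) = tens T (diff Om f) s + f *: nabla U s].

(* The subsheaf of horizontal sections generates [E] as a module: locally,
   every section is a combination of horizontal sections. *)
Definition horizontally_generated
    (nabla : forall U : opens X, msec E U -> msec T U) : Prop :=
  forall (U : opens X) (s : msec E U) (x : X), U x ->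
    exists (V : opens X) (h : V `<=` U) (N : nat) (c : 'I_N -> sec V)
      (t : 'I_N -> msec E V),
      [/\ V x, forall i, nabla V (t i) = 0 & mres h s = \sum_i c i *: t i].

End Modules.

Section Degeneracy.
Variable A : comPzRingType.

(* These are, up to sign and repetition, the matrix entries of the [p]-th
   exterior power of [al], so that they generate the ideal defining the
   vanishing locus of that exterior power. The rows and columns are indexed by
   finite types in order to cover matrices of maps to [Hom (K, C)]. *)
Definition minors (I J : finType) (al : I -> J -> A) (p : nat) : set A :=
  [set a | exists (g : 'I_p -> I) (h : 'I_p -> J),
     a = \det (\matrix_(c < p, d < p) al (g c) (h d))].

Definition degeneracy_size (I J : finType) (i : nat) : nat :=
  ((minn #|I| #|J|).+1 - i)%N.

(* For [A] the local ring of [Y] at [y] and [al] the matrix of the stalk at [y]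
   of a map of locally free sheaves, this says that [y] is a point of the
   [i]-th degeneracy locus. *)
Definition in_degeneracy (I J : finType) (al : I -> J -> A) (i : nat) : Prop :=
  (i <= (minn #|I| #|J|).+1)%N /\
  minors al (degeneracy_size I J i) `<=` nonunits A.

End Degeneracy.

(* Here [A] is the local ring of [X] at [x], [M] the matrix of a map from
   [T_X] to [E] in local bases [del_c] and [v_l], [dM c] the result of applying
   [del_c] to the entries of [M], and [pi : A -> B] the projection onto the
   local ring at [x] of the locus [Sigma]. Over [B], the columns of [kap] are
   a basis of the kernel [K] of [M] and the columns of [gam] induce a basis of
   its cokernel [C]. Then [Dm] is the matrix of the second intrinsic
   differential [K -> Hom (K, C)]: the derivative of [M] along the [p]-th basis
   vector of [K] maps the [q]-th basis vector of [K] to the class of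
   [\sum_u Dm (q, u) p *: gam_u] modulo the image of [M]. *)
Definition second_intrinsic_degeneracy (A B : comPzRingType) (pi : {rmorphism A -> B})
    (a b : nat) (M : 'M[A]_(b, a)) (dM : 'I_a -> 'M[A]_(b, a)) (j : nat) : Prop :=
  let MB := map_mx pi M in
  let derive (u : 'cV[B]_a) : 'M[B]_(b, a) := \sum_c u c 0 *: map_mx pi (dM c) in
  exists (r t : nat) (kap : 'M[B]_(a, r)) (gam : 'M[B]_(b, t))
    (Dm : 'I_r * 'I_t -> 'I_r -> B),
  [/\ forall u : 'cV[B]_a, MB *m u = 0 <-> exists w : 'cV[B]_r, u = kap *m w,
      forall w : 'cV[B]_r, kap *m w = 0 -> w = 0,
      forall y : 'cV[B]_b, exists! w : 'cV[B]_t,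
        exists u : 'cV[B]_a, y = gam *m w + MB *m u,
      forall p q : 'I_r, exists u : 'cV[B]_a,
        derive (col p kap) *m col q kap =
        gam *m (\col_l Dm (q, l) p) + MB *m u
    & in_degeneracy Dm j].

(* The set of points of the second-order locus [Sigma^(i,j)(s)]. The family
   [om] is a local basis of the differentials; [M] is the matrix of [nabla s],
   seen as a map from [T_X] to [E], in the basis of [T_X] dual to [om] and the
   basis [v] of [E]. *)
Definition second_locus (k : fieldType) (X : scheme k) (Om : differentials X)
    (E : modsheaf X) (T : tensor_product Om E)
    (nabla : forall U : opens X, msec E U -> msec T U)
    (s : msec E (opensT X)) (i j : nat) : set X :=
  [set x | exists (U : opens X) (Ux : U x) (a b : nat)
    (om : 'I_a -> msec Om U) (v : 'I_b -> msec E U)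
    (M : 'M[sec U]_(b, a)) (dM : 'I_a -> 'M[sec U]_(b, a)),
    [/\ is_basis om, is_basis v,
        nabla U (restrict U s) = \sum_l \sum_c M l c *: tens T (om c) (v l)
      & forall l c, diff Om (M l c) = \sum_c' dM c' l c *: om c'] /\
    let Mx := map_mx (germ Ux) M in
    let dMx c := map_mx (germ Ux) (dM c) in
    [/\ in_degeneracy Mx i, ~ in_degeneracy Mx i.+1
      & exists (B : comPzRingType) (pi : {rmorphism stalk x -> B}),
        [/\ forall b', exists a', pi a' = b',
            forall a', pi a' = 0 <->
              ideal_gen (minors Mx (degeneracy_size 'I_b 'I_a i)) a'
          & second_intrinsic_degeneracy pi Mx dMx j]]].

(* The variables are numbered from [0]: the coordinate x_i has
   index [i - 1], and the following are the indices of x_e, ..., x_(n-j). *)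
Definition middle (n e j : nat) : pred 'I_n := fun i => (e.-1 <= i < n - j)%N.

Definition normal_quadric (k : fieldType) (n e j : nat) : fps n k :=
  if 2%N \in [pchar k] then
    \sum_(i < n | middle e j i && ~~ odd (i - e.-1))
      \sum_(l < n | middle e j l && (l == i.+1 :> nat)) fps_var k i * fps_var k l
  else \sum_(i < n | middle e j i) fps_var k i ^+ 2.

(* Main.v *)
Require Import Defs.
From HB Require Import structures.
From mathcomp Require Import all_boot all_order all_algebra.
From mathcomp Require Import mathcomp_extra boolp classical_sets topology.
From mathcomp Require Import zify ring.
From mathcomp Require Import -(notations) mpoly.

Set Implicit Arguments.
Unset Strict Implicit.
Unset Printing Implicit Defensive.

Import GRing.Theory.
Local Open Scope ring_scope.
Local Open Scope classical_set_scope.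

(* Near a closed point x, the smoothness of X and the Nullstellensatz present
   the local ring as a localization of k[y, z]/(g) at a k-point where dg/dz is
   invertible; solving g = 0 formally for z embeds it into k[[y]], and the
   formal inverse function theorem replaces y by the given coordinates.
   Derivations of k[[x_1, ..., x_n]] and coordinates in a basis extend to the
   sheaves Omega_X, E and their tensor product by the universal properties,
   applied to a skyscraper sheaf at x. This turns the second intrinsic
   differential at x into the Hessian of f_e in the variables x_e, ..., x_n,
   which therefore has rank n - e + 1 - j, while f_e has no linear term in
   these variables. A linear change of x_e, ..., x_n puts the quadratic part of
   f_e on a complement of the radical in the normal form q. The splitting lemma
   concludes: an automorphism fixing the other variables absorbs every term of
   f_e divisible by one of x_e, ..., x_{n-j}. In characteristic 2 the argument
   is unchanged, the polar form of q being alternating and nondegenerate. *)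

(** * Power series *)

(** Inverses of series, implicit functions, inverses of substitutions and the splitting lemma are
    all obtained from one principle: a map on tuples of series that gains one unit of weighted order
    has a fixed point. The weight depends on the use. With 1 on the variables of the quadric and 2
    on the others, a mixed term such as [x_1 x_e] has weight 3 and counts as a perturbation of the
    quadric, although it is quadratic. The second-order locus is given through an arbitrary frame
    and an arbitrary presentation of the local ring of [Sigma]. Bases of kernel and cokernel are
    therefore recorded as matrix identities ([splits]): these survive every ring morphism and every
    change of frame, so that all data can be moved to the residue field [k], where only ranks of
    matrices remain. In characteristic 2 the Hessian does not determine a quadratic form. The
    quadratic part is carried by a triangular matrix [A] of Taylor coefficients, with Hessian
    [A + A^T]; values on the diagonal and the polar form are normalized separately, and nothing is
    divided by 2. *)

Section Weight.
Variables (n : nat) (w : 'I_n -> nat).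

Definition wdeg (m : multinom n) : nat := (\sum_i w i * m i)%N.

Lemma wdeg0 : wdeg mnm0 = 0%N.
Proof. by rewrite /wdeg big1 // => i _; rewrite mnm0E muln0. Qed.

Lemma wdegD m1 m2 : wdeg (mnm_add m1 m2) = (wdeg m1 + wdeg m2)%N.
Proof. by rewrite /wdeg -big_split; apply: eq_bigr => i _; rewrite mnmDE mulnDr. Qed.

Lemma wdeg1 i : wdeg (mnm1 i) = w i.
Proof.
rewrite /wdeg (bigD1 i) //= mnm1E eqxx muln1 big1 ?addn0 // => l li.
by rewrite mnm1E eq_sym (negPf li) muln0.
Qed.

Lemma leq_wdeg (m : multinom n) i : (w i * m i <= wdeg m)%N.
Proof. by rewrite /wdeg (bigD1 i) //= leq_addr. Qed.

End Weight.

Definition unit_weight (n : nat) : 'I_n -> nat := fun=> 1%N.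

Lemma wdeg_unit n (m : multinom n) : wdeg (@unit_weight n) m = mdeg m.
Proof. by rewrite /wdeg mdegE; apply: eq_bigr => i _; rewrite mul1n. Qed.

Lemma mnm_addBK n (m : multinom n) i : m i != 0%N ->
  mnm_add (mnm_sub m (mnm1 i)) (mnm1 i) = m.
Proof.
move=> mi; apply: submK; apply/mnm_lepP => l; rewrite mnm1E.
by case: eqP => [<-|]; rewrite ?lt0n.
Qed.

Section Order.
Variables (n : nat) (R : comNzRingType) (w : 'I_n -> nat).
Implicit Types f g : fps n R.

Lemma fcoefM f g m : fcoef (f * g) m =
  \sum_(k : bmultinom n (mdeg m).+1 * bmultinom n (mdeg m).+1
          | m == mnm_add (k.1 : multinom n) (k.2 : multinom n))
     fcoef f k.1 * fcoef g k.2.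
Proof. by []. Qed.

Lemma fcoefD f g m : fcoef (f + g) m = fcoef f m + fcoef g m. Proof. by []. Qed.
Lemma fcoefN f m : fcoef (- f) m = - fcoef f m. Proof. by []. Qed.
Lemma fcoefB f g m : fcoef (f - g) m = fcoef f m - fcoef g m. Proof. by []. Qed.
Lemma fcoef0 m : fcoef (0 : fps n R) m = 0. Proof. by []. Qed.
Lemma fcoef1 m : fcoef (1 : fps n R) m = (m == mnm0)%:R.
Proof. by rewrite /=; case: eqP. Qed.

Lemma fcoef_sum (I : Type) (r : seq I) (P : pred I) (F : I -> fps n R) m :
  fcoef (\sum_(i <- r | P i) F i) m = \sum_(i <- r | P i) fcoef (F i) m.
Proof. by elim/big_rec2: _ => // i y1 y2 _ <-. Qed.

Definition ord_ge (d : nat) : set (fps n R) :=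
  [set f | forall m, (wdeg w m < d)%N -> fcoef f m = 0].

Lemma ord_ge0 d : ord_ge d 0. Proof. by []. Qed.

Lemma ord_geT f : ord_ge 0 f. Proof. by []. Qed.

Lemma ord_geD d f g : ord_ge d f -> ord_ge d g -> ord_ge d (f + g).
Proof. by move=> hf hg m md; rewrite fcoefD hf ?hg ?addr0. Qed.

Lemma ord_geN d f : ord_ge d f -> ord_ge d (- f).
Proof. by move=> hf m md; rewrite fcoefN hf ?oppr0. Qed.

Lemma ord_geB d f g : ord_ge d f -> ord_ge d g -> ord_ge d (f - g).
Proof. by move=> hf hg; apply: ord_geD => //; apply: ord_geN. Qed.

Lemma ord_ge_sum d (I : Type) (r : seq I) (P : pred I) (F : I -> fps n R) :
  (forall i, P i -> ord_ge d (F i)) -> ord_ge d (\sum_(i <- r | P i) F i).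
Proof. by move=> h; elim/big_ind: _ => //; apply: ord_geD. Qed.

Lemma ord_geW d e f : (e <= d)%N -> ord_ge d f -> ord_ge e f.
Proof. by move=> ed h m me; apply: h; apply: leq_trans me ed. Qed.

Lemma ord_geM a b f g : ord_ge a f -> ord_ge b g -> ord_ge (a + b) (f * g).
Proof.
move=> hf hg m md; rewrite fcoefM big1 // => -[k l] /= /eqP mkl.
have := congr1 (wdeg w) mkl; rewrite wdegD => e.
case: (ltnP (wdeg w k) a) => [ka|ak]; first by rewrite hf ?mul0r.
by rewrite hg ?mulr0 //; lia.
Qed.

Lemma ord_geMr d f g : ord_ge d f -> ord_ge d (f * g).
Proof. by move=> hf; rewrite -[d]addn0; apply: ord_geM. Qed.

Lemma ord_geMl d f g : ord_ge d g -> ord_ge d (f * g).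
Proof. by rewrite mulrC; apply: ord_geMr. Qed.

Lemma ord_geX d f a : ord_ge d f -> ord_ge (d * a) (f ^+ a).
Proof.
move=> h; elim: a => [|a IH]; first by rewrite muln0.
by rewrite exprS mulnS; apply: ord_geM.
Qed.

Lemma ord_ge_prod (I : Type) (r : seq I) (F : I -> fps n R) (d : I -> nat) :
  (forall i, ord_ge (d i) (F i)) ->
  ord_ge (\sum_(i <- r) d i)%N (\prod_(i <- r) F i).
Proof. by move=> h; elim/big_ind2: _ => // a f b g; apply: ord_geM. Qed.

Lemma ord_ge_var i : ord_ge (w i) (fps_var R i).
Proof. by move=> m /=; case: eqP => // ->; rewrite wdeg1 ltnn. Qed.

Lemma fps_constE c m : fcoef (fps_const n c) m = c * (m == mnm0)%:R :> R.
Proof. by rewrite /=; case: eqP; rewrite ?mulr1 ?mulr0. Qed.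

Lemma fcoefC c f m : fcoef (fps_const n c * f) m = c * fcoef f m.
Proof.
rewrite fcoefM (bigD1 (bm0, BMultinom (ltnSn (mdeg m)))) /=; last by rewrite add0m.
rewrite eqxx big1 ?addr0 // => -[k l] /= /andP[/eqP mkl ne].
case: eqP => [k0|]; last by rewrite mul0r.
case/eqP: ne; congr pair; apply: val_inj => //=.
by move: mkl; rewrite k0 add0m.
Qed.

Fact fps_const_is_zmod : zmod_morphism (@fps_const n R).
Proof. by move=> a b; apply: fpsP => m; rewrite fcoefB !fps_constE mulrBl. Qed.
Fact fps_const_is_monoid : monoid_morphism (@fps_const n R).
Proof. by split=> // a b; apply: fpsP => m; rewrite fcoefC !fps_constE mulrA. Qed.
HB.instance Definition _ :=
  GRing.isZmodMorphism.Build _ _ (@fps_const n R) fps_const_is_zmod.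
HB.instance Definition _ :=
  GRing.isMonoidMorphism.Build _ _ (@fps_const n R) fps_const_is_monoid.

Lemma fcoefXm f i m : fcoef (fps_var R i * f) (mnm_add m (mnm1 i)) = fcoef f m.
Proof.
set m' := mnm_add m (mnm1 i).
have lt1 : (mdeg (mnm1 i) < (mdeg m').+1)%N by rewrite mdegD mdeg1 addn1.
have lt2 : (mdeg m < (mdeg m').+1)%N by rewrite mdegD mdeg1 addn1 ltnW.
rewrite fcoefM (bigD1 (BMultinom lt1, BMultinom lt2)) /=; last by rewrite addmC.
rewrite eqxx mul1r big1 ?addr0 // => -[k l] /= /andP[/eqP mkl ne].
case: eqP => [k0|]; last by rewrite mul0r.
case/eqP: ne; congr pair; apply: val_inj => //=.
by have := mkl; rewrite k0 {1}/m' addmC => /addmI ->.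
Qed.

Lemma fcoefX0 f i (m : multinom n) : m i = 0%N -> fcoef (fps_var R i * f) m = 0.
Proof.
move=> mi; rewrite fcoefM big1 // => -[k l] /= /eqP mkl.
case: eqP => [ki|]; last by rewrite mul0r.
by move: mi; have /(congr1 (fun m => fun_of_multinom m i)) := mkl; rewrite mnmDE ki mnm1E eqxx => -> .
Qed.

Lemma fcoef_const0 f g :
  fcoef (f * g) mnm0 = fcoef f mnm0 * fcoef g mnm0.
Proof.
have lt : (mdeg (@mnm0 n) < (mdeg (@mnm0 n)).+1)%N by [].
rewrite fcoefM (bigD1 (BMultinom lt, BMultinom lt)) /=; last by rewrite add0m.
rewrite big1 ?addr0 // => -[k l] /= /andP[/eqP mkl ne].
have z (i : bmultinom n (mdeg (@mnm0 n)).+1) : i = BMultinom lt.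
  by apply: val_inj; apply/eqP; rewrite /= -mdeg_eq0 -leqn0 -ltnS -[X in (_ < X.+1)%N](@mdeg0 n) bmdeg.
by case/eqP: ne; rewrite (z k) (z l).
Qed.

End Order.

Arguments fcoefM {n R}.
Arguments fcoef_const0 {n R}.

Section ConstantTerm.
Variables (n : nat) (R : comNzRingType).

Definition fps0 (f : fps n R) : R := fcoef f mnm0.

Fact fps0_is_zmod : zmod_morphism fps0. Proof. by []. Qed.
Fact fps0_is_monoid : monoid_morphism fps0.
Proof. by split; [rewrite /fps0 /= eqxx | move=> f g; apply: fcoef_const0]. Qed.
HB.instance Definition _ := GRing.isZmodMorphism.Build _ _ fps0 fps0_is_zmod.
HB.instance Definition _ := GRing.isMonoidMorphism.Build _ _ fps0 fps0_is_monoid.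

Lemma fps0D f g : fps0 (f + g) = fps0 f + fps0 g. Proof. exact: rmorphD. Qed.
Lemma fps0B f g : fps0 (f - g) = fps0 f - fps0 g. Proof. exact: rmorphB. Qed.
Lemma fps0M f g : fps0 (f * g) = fps0 f * fps0 g. Proof. exact: rmorphM. Qed.
Lemma fps01 : fps0 1 = 1. Proof. exact: rmorph1. Qed.
Lemma fps0_sum (I : Type) (r : seq I) (P : pred I) (F : I -> fps n R) :
  fps0 (\sum_(i <- r | P i) F i) = \sum_(i <- r | P i) fps0 (F i).
Proof. exact: rmorph_sum. Qed.

Lemma fps0_const c : fps0 (fps_const n c) = c.
Proof. by rewrite /fps0 /= eqxx. Qed.

Lemma fps0_var i : fps0 (fps_var R i) = 0.
Proof. by rewrite /fps0 /=; case: eqP => // /(congr1 (@mdeg n)); rewrite mdeg0 mdeg1. Qed.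

Lemma ord_ge1 w (w_gt0 : forall i, (0 < w i)%N) (f : fps n R) :
  ord_ge w 1 f <-> fps0 f = 0.
Proof.
split=> [h|h m]; first by apply: h; rewrite wdeg0.
rewrite ltnS leqn0 => /eqP m0; have -> // : m = mnm0.
apply/mnmP => i; rewrite mnm0E; apply/eqP; rewrite -leqn0.
apply: leq_trans (leq_pmull _ (w_gt0 i)) _.
by rewrite -m0 leq_wdeg.
Qed.

End ConstantTerm.

Arguments fps0 : simpl never.

Section Quotients.
Variables (n : nat) (R : comNzRingType) (P : pred 'I_n).
Implicit Types f g : fps n R.

Definition fps_rem f : fps n R :=
  Fps (fun m : multinom n => if [forall l, P l ==> (m l == 0%N)] then fcoef f m else 0).

(* The monomials of [f] whose first variable in [P] is [x_i], divided by [x_i]. *)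
Definition fps_quo (i : 'I_n) f : fps n R :=
  Fps (fun m : multinom n => if [forall l : 'I_n, P l && (l < i)%N ==> (m l == 0%N)]
                then fcoef f (mnm_add m (mnm1 i)) else 0).

Lemma fcoef_rem f m :
  fcoef (fps_rem f) m = if [forall l, P l ==> (m l == 0%N)] then fcoef f m else 0.
Proof. by []. Qed.

Lemma fcoef_quo i f m :
  fcoef (fps_quo i f) m = if [forall l : 'I_n, P l && (l < i)%N ==> (m l == 0%N)]
                then fcoef f (mnm_add m (mnm1 i)) else 0.
Proof. by []. Qed.

Lemma fps_quo_rem f : f = fps_rem f + \sum_(i | P i) fps_var R i * fps_quo i f.
Proof.
apply: fpsP => m; rewrite fcoefD fcoef_sum fcoef_rem.
case: ifPn => [/forallP m0|].
  rewrite big1 ?addr0 // => i Pi; apply: fcoefX0.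
  by apply/eqP; have := m0 i; rewrite Pi.
rewrite add0r negb_forall => /existsP[l0]; rewrite negb_imply => /andP[Pl0 ml0].
have ex0 : P l0 && (m l0 != 0%N) by rewrite Pl0.
(* [i] is the least variable of [P] occurring in the monomial; the summand of [i] is the only one
   that contributes. *)
case: (@arg_minnP _ l0 (fun l => P l && (m l != 0%N)) (fun l => val l) ex0) => i.
move=> /andP[Pi mi] min.
rewrite (bigD1 i) // big1 ?addr0 => [|l /andP[Pl li]].
  rewrite -{2}(mnm_addBK mi) fcoefXm fcoef_quo (mnm_addBK mi).
  rewrite [RHS]addr0; case: ifPn => // /negP[]; apply/forallP => l; apply/implyP => /andP[Pl li].
  rewrite mnmBE; apply/eqP; suff -> : m l = 0%N by [].
  apply/eqP; apply: contraLR li => ml; rewrite -leqNgt.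
  by apply: min; rewrite Pl.
have [ml|ml] := eqVneq (m l) 0%N; first exact: fcoefX0.
rewrite -(mnm_addBK ml) fcoefXm fcoef_quo.
case: ifPn => // /forallP /(_ i); rewrite Pi /=.
have il : (i < l)%N.
  by rewrite ltn_neqAle min ?Pl // andbT -val_eqE /= eq_sym in li *.
rewrite il mnmBE mnm1E (negPf li) subn0 /= => /eqP mi0.
by rewrite mi0 in mi.
Qed.

Lemma fps_rem_indep f : fps_indep (fps_rem f) P.
Proof.
move=> m i Pi mi /=; case: ifP => // /forallP /(_ i).
by rewrite Pi /= (negPf mi).
Qed.

Lemma fps_quo_ord w d i f : ord_ge w (d + w i) f -> ord_ge w d (fps_quo i f).
Proof.
move=> h m md /=; case: ifP => // _; apply: h.
by rewrite wdegD wdeg1 ltn_add2r.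
Qed.

Lemma fps_rem_ord w d f : ord_ge w d f -> ord_ge w d (fps_rem f).
Proof. by move=> h m md /=; case: ifP => // _; apply: h. Qed.

Lemma fps_quoB i f g : fps_quo i (f - g) = fps_quo i f - fps_quo i g.
Proof. by apply: fpsP => m /=; case: ifP; rewrite ?subr0. Qed.

End Quotients.

(** * Fixed points of contractions for a weighted order *)

Section Contraction.
Variables (n : nat) (R : comNzRingType) (w : 'I_n -> nat).
Implicit Types f g : fps n R.

Lemma ord_ge_eq f g : (forall d, ord_ge w d (f - g)) -> f = g.
Proof.
move=> h; apply: fpsP => m; apply/eqP; rewrite -subr_eq0 -fcoefB.
by apply/eqP; apply: h (ltnSn _).
Qed.

Variables (I : Type) (a : nat) (Phi : (I -> fps n R) -> I -> fps n R).
Hypothesis Phi_ord : forall T, (forall i, ord_ge w a (T i)) ->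
  forall i, ord_ge w a (Phi T i).
Hypothesis Phi_contr : forall d T T',
  (forall i, ord_ge w a (T i)) -> (forall i, ord_ge w a (T' i)) ->
  (forall i, ord_ge w d (T i - T' i)) ->
  forall i, ord_ge w d.+1 (Phi T i - Phi T' i).

Lemma contraction_unique T T' :
  (forall i, ord_ge w a (T i)) -> (forall i, ord_ge w a (T' i)) ->
  (forall i, Phi T i = T i) -> (forall i, Phi T' i = T' i) -> forall i, T i = T' i.
Proof.
move=> hT hT' fT fT' i; apply: ord_ge_eq => d; elim: d i => [//|d IH] i.
by rewrite -fT -fT'; apply: Phi_contr.
Qed.

(** The iterates of [Phi] from 0 agree to higher and higher order. The bound [a] fixes a domain: the
    maps behind the implicit function theorem and the splitting lemma contract only on families of
    order at least 1 and 2, respectively. *)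
Lemma contraction_fixpoint :
  exists T, (forall i, ord_ge w a (T i)) /\ forall i, Phi T i = T i.
Proof.
pose T d := iter d Phi (fun=> 0).
have T_ord d i : ord_ge w a (T d i) by elim: d i => [//|d IH] i; apply: Phi_ord.
have T_step d i : ord_ge w d (T d.+1 i - T d i).
  by elim: d i => [//|d IH] i; apply: (@Phi_contr d (T d.+1) (T d)) => // l; apply: T_ord.
have T_cauchy d e i : ord_ge w d (T (d + e)%N i - T d i).
  elim: e => [|e IH]; first by rewrite addn0 subrr; exact: ord_ge0.
  rewrite addnS -(subrK (T (d + e)%N i) (T (d + e).+1 i)) -addrA.
  by apply: ord_geD IH; apply: (ord_geW _ (T_step _ _)); rewrite leq_addr.
(* The coefficient of [m] no longer changes from the iterate [(wdeg w m).+1] on. *)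
pose L i := Fps (fun m => fcoef (T (wdeg w m).+1 i) m).
have L_lim d i : ord_ge w d (L i - T d i).
  move=> m md; rewrite fcoefB /=; apply/eqP; rewrite subr_eq0 eq_sym -subr_eq0 -fcoefB.
  by apply/eqP; rewrite -(subnKC md); apply: T_cauchy.
have L_ord i : ord_ge w a (L i) by move=> m ma; exact: (T_ord (wdeg w m).+1 i m ma).
exists L; split=> // i; apply: ord_ge_eq => d.
rewrite -(subrK (T d.+1 i) (Phi L i)) -addrA; apply: ord_geD.
  exact: ord_geW (leqnSn d) (@Phi_contr _ _ _ (L_ord) (T_ord d) (L_lim d) i).
by rewrite -opprB; apply: ord_geN; apply: ord_geW (leqnSn d) (L_lim _ _).
Qed.

End Contraction.

(** With [c] the inverse of the constant term, [1 - c * f] has positive order, so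
    [T |-> c + (1 - c * f) * T] contracts; a fixed point satisfies [c * f * T = c], and [c]
    cancels. *)
Lemma fps_unit n (k : fieldType) (f : fps n k) : fps0 f != 0 -> is_unit f.
Proof.
move=> f0; pose c := fps_const n (fps0 f)^-1; pose w := @unit_weight n.
have cf : ord_ge w 1 (1 - c * f).
  by apply/ord_ge1 => //; rewrite fps0B fps0M fps01 fps0_const mulVf // subrr.
have [|d T T' _ _ h i|T [_ fT]] :=
    @contraction_fixpoint n k w unit 0 (fun T i => c + (1 - c * f) * T i).
- by [].
- by rewrite opprD addrACA subrr add0r -mulrBr -add1n; apply: ord_geM.
exists (T tt); have := fT tt; have cc : fps_const n (fps0 f) * c = 1.
  by rewrite -rmorphM mulfV // rmorph1.
move/(congr1 (fun t => fps_const n (fps0 f) * (t - T tt))); rewrite subrr mulr0.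
set C := fps_const n (fps0 f) in cc *; set t := T tt.
have -> : C * (c + (1 - c * f) * t - t) = C * c - C * c * (f * t) by ring.
by rewrite cc mul1r => /eqP; rewrite subr_eq0 => /eqP.
Qed.

Section PolySeries.
Variables (n : nat) (R : comNzRingType).
Local Notation mpol := (mpoly n R).

Definition fps_poly (p : mpol) : fps n R := Fps (fun m => mcoeff m p).

Lemma fcoef_poly p m : fcoef (fps_poly p) m = mcoeff m p. Proof. by []. Qed.

Fact fps_poly_is_zmod : zmod_morphism fps_poly.
Proof. by move=> p q; apply: fpsP => m; rewrite fcoefB !fcoef_poly mcoeffB. Qed.
Fact fps_poly_is_monoid : monoid_morphism fps_poly.
Proof.
split=> [|p q]; apply: fpsP => m; first by rewrite fcoef_poly mcoeff1 fcoef1.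
by rewrite fcoef_poly; symmetry; apply: fps_mulE.
Qed.
HB.instance Definition _ := GRing.isZmodMorphism.Build _ _ fps_poly fps_poly_is_zmod.
HB.instance Definition _ := GRing.isMonoidMorphism.Build _ _ fps_poly fps_poly_is_monoid.

Lemma fps_polyC c : fps_poly (mpolyC n c) = fps_const n c.
Proof. by apply: fpsP => m; rewrite fcoef_poly mcoeffC fps_constE. Qed.

Lemma fps_polyX i : fps_poly (mpolyX R (mnm1 i)) = fps_var R i.
Proof. by apply: fpsP => m; rewrite fcoef_poly mcoeffX /= eq_sym; case: eqP. Qed.

Lemma mpoly_rmorph_ext (S : pzRingType) (F G : {rmorphism mpol -> S}) :
  (forall c, F (mpolyC n c) = G (mpolyC n c)) ->
  (forall i, F (mpolyX R (mnm1 i)) = G (mpolyX R (mnm1 i))) -> F =1 G.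
Proof.
move=> FC FX p; rewrite [p]mpolyE !rmorph_sum; apply: eq_bigr => m _ /=.
rewrite -mul_mpolyC !rmorphM FC; congr (_ * _).
rewrite mpolyXE_id !rmorph_prod; apply: eq_bigr => i _.
by rewrite !rmorphXn FX.
Qed.

Lemma fps_trunc_ord d (f : fps n R) :
  ord_ge (@unit_weight n) d (f - fps_poly (fps_trunc d f)).
Proof.
move=> m md; rewrite wdeg_unit in md.
by rewrite fcoefB fcoef_poly fps_truncE ?subrr.
Qed.

(* The last two hypotheses give continuity, and polynomials are dense. *)
Lemma fps_rmorph_ext (F G : {rmorphism fps n R -> fps n R}) :
  (forall c, F (fps_const n c) = G (fps_const n c)) ->
  (forall i, F (fps_var R i) = G (fps_var R i)) ->
  (forall d f, ord_ge (@unit_weight n) d f -> ord_ge (@unit_weight n) d (F f)) ->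
  (forall d f, ord_ge (@unit_weight n) d f -> ord_ge (@unit_weight n) d (G f)) ->
  F =1 G.
Proof.
move=> FC FX FO GO f; apply: (@ord_ge_eq n R (@unit_weight n)) => d.
have E : F (fps_poly (fps_trunc d f)) = G (fps_poly (fps_trunc d f)).
  pose F' : {rmorphism mpol -> fps n R} := F \o fps_poly.
  pose G' : {rmorphism mpol -> fps n R} := G \o fps_poly.
  apply: (@mpoly_rmorph_ext _ F' G') => [c|i] /=; rewrite ?fps_polyC ?fps_polyX //.
have -> : F f - G f = F (f - fps_poly (fps_trunc d f))
                    - G (f - fps_poly (fps_trunc d f)).
  by rewrite !rmorphB E; ring.
by apply: ord_geB; [apply: FO|apply: GO]; apply: fps_trunc_ord.
Qed.

End PolySeries.

(** * Substitution of power series and its inversion *)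

Section Substitution.
Variables (n : nat) (R : comNzRingType) (Psi : 'I_n -> fps n R).
Local Notation ev := (mmap (@fps_const n R) Psi).
Local Notation w1 := (@unit_weight n).

(** When the [Psi i] have no constant term, monomials of degree above [mdeg m] do not reach the
    coefficient of [m], so the truncation is harmless. The definition is total; that hypothesis
    enters only with the ring laws. *)
Definition fps_subst (f : fps n R) : fps n R :=
  Fps (fun m => fcoef (ev (fps_trunc (mdeg m).+1 f)) m).

Lemma mmap1_ord w d (m : multinom n) (Phi : 'I_n -> fps n R) :
  (forall i, ord_ge w (d i) (Phi i)) -> ord_ge w (wdeg d m) (mmap1 Phi m).
Proof.
by move=> h; rewrite /mmap1 /wdeg; apply: ord_ge_prod => i; apply: ord_geX.
Qed.

Hypothesis Psi0 : forall i, fps0 (Psi i) = 0.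

Lemma Psi_ord1 i : ord_ge w1 (w1 i) (Psi i).
Proof. by apply/ord_ge1. Qed.

Lemma mmap_ord (p : mpoly n R) d :
  (forall m, (mdeg m < d)%N -> mcoeff m p = 0) -> ord_ge w1 d (ev p).
Proof.
move=> h; rewrite /mmap; apply: ord_ge_sum => m _.
have [md|dm] := ltnP (mdeg m) d; first by rewrite h // rmorph0 mul0r; apply: ord_ge0.
apply: ord_geMl; apply: ord_geW dm _; rewrite -wdeg_unit.
by apply: mmap1_ord => i; apply: Psi_ord1.
Qed.

Lemma fcoef_subst (p : mpoly n R) f m :
  (forall l, (mdeg l <= mdeg m)%N -> mcoeff l p = fcoef f l) ->
  fcoef (fps_subst f) m = fcoef (ev p) m.
Proof.
move=> h; rewrite /fps_subst /=; apply/eqP; rewrite -subr_eq0 -fcoefB -rmorphB.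
apply/eqP; apply: (@mmap_ord _ (mdeg m).+1); last by rewrite wdeg_unit.
by move=> l lm; rewrite mcoeffB fps_truncE // h // subrr.
Qed.

Lemma fcoef_subst_trunc d f m : (mdeg m <= d)%N ->
  fcoef (fps_subst f) m = fcoef (ev (fps_trunc d.+1 f)) m.
Proof.
by move=> md; apply: fcoef_subst => l lm; rewrite fps_truncE // ltnS (leq_trans lm).
Qed.

Fact fps_subst_is_zmod : zmod_morphism fps_subst.
Proof.
move=> f g; apply: fpsP => m; pose t (h : fps n R) := fps_trunc (mdeg m).+1 h.
rewrite fcoefB (@fcoef_subst (t f - t g)) => [|l lm]; last by rewrite mcoeffB !fps_truncE.
by rewrite rmorphB fcoefB !(fcoef_subst_trunc _ (leqnn _)).
Qed.

Fact fps_subst_is_monoid : monoid_morphism fps_subst.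
Proof.
split=> [|f g]; apply: fpsP => m.
  by rewrite (@fcoef_subst 1) ?rmorph1 // => l _; rewrite mcoeff1 fcoef1.
pose t (h : fps n R) := fps_trunc (mdeg m).+1 h.
rewrite (@fcoef_subst (t f * t g)) => [|l lm]; last first.
  by symmetry; apply: fps_mulE => i il; rewrite fps_truncE // ltnS (leq_trans il).
rewrite rmorphM !fcoefM; apply: eq_bigr => -[[l hl] [l' hl']] _.
by congr (_ * _); symmetry; apply: fcoef_subst_trunc.
Qed.

Definition subst_rmorphism : {rmorphism fps n R -> fps n R} :=
  HB.pack fps_subst (GRing.isZmodMorphism.Build _ _ fps_subst fps_subst_is_zmod)
    (GRing.isMonoidMorphism.Build _ _ fps_subst fps_subst_is_monoid).

Lemma fps_subst_poly p : fps_subst (fps_poly p) = ev p.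
Proof. by apply: fpsP => m; rewrite (@fcoef_subst p). Qed.

Lemma fps_substC c : fps_subst (fps_const n c) = fps_const n c.
Proof. by rewrite -[in LHS]fps_polyC fps_subst_poly mmapC. Qed.

Lemma fps_substX i : fps_subst (fps_var R i) = Psi i.
Proof. by rewrite -fps_polyX fps_subst_poly mmapX mmap1U. Qed.

Lemma fps_subst_trunc d f :
  ord_ge w1 d (fps_subst f - ev (fps_trunc d f)).
Proof.
move=> m; rewrite wdeg_unit fcoefB => md; apply/eqP; rewrite subr_eq0; apply/eqP.
by apply: fcoef_subst => l lm; rewrite fps_truncE //; apply: leq_ltn_trans lm md.
Qed.

Lemma fps_subst_ord1 d f : ord_ge w1 d f -> ord_ge w1 d (fps_subst f).
Proof.
move=> h; rewrite -(subrK (ev (fps_trunc d f)) (fps_subst f)).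
apply: ord_geD; first exact: fps_subst_trunc.
by apply: mmap_ord => m md; rewrite fps_truncE // h ?wdeg_unit.
Qed.

Lemma mmap1_var (m : multinom n) : mmap1 (@fps_var n R) m = fps_poly (mpolyX R m).
Proof.
rewrite mpolyXE_id rmorph_prod; apply: eq_bigr => i _.
by rewrite rmorphXn /= fps_polyX.
Qed.

Lemma mmap_var (p : mpoly n R) : mmap (@fps_const n R) (@fps_var n R) p = fps_poly p.
Proof.
rewrite [p in RHS]mpolyE rmorph_sum; apply: eq_bigr => m _.
by rewrite mmap1_var -mul_mpolyC rmorphM /= fps_polyC.
Qed.

(** Reduces the comparison of [f] with its image to single monomials of the support of [f]. This
    covers both series free of the moved variables and unipotent substitutions. *)
Lemma fcoef_subst_eq f m :
  (forall l, fcoef f l != 0 ->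
     fcoef (mmap1 Psi l) m = fcoef (mmap1 (@fps_var n R) l) m) ->
  fcoef (fps_subst f) m = fcoef f m.
Proof.
move=> h; pose p := fps_trunc (mdeg m).+1 f.
have pf l : (mdeg l <= mdeg m)%N -> mcoeff l p = fcoef f l by move=> lm; apply: fps_truncE.
apply/eqP; rewrite -subr_eq0 (fcoef_subst pf) -(pf m) // -fcoef_poly -mmap_var -fcoefB.
rewrite /mmap -sumrB fcoef_sum big1 // => l _; rewrite -mulrBr fcoefC.
have [lm|ml] := leqP (mdeg l) (mdeg m); last first.
  rewrite fcoefB !(@mmap1_ord w1 w1) ?subrr ?mulr0 ?wdeg_unit // => i.
    exact: ord_ge_var.
  exact: Psi_ord1.
rewrite pf //; have [->|fl] := eqVneq (fcoef f l) 0; first by rewrite mul0r.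
by rewrite fcoefB h // subrr mulr0.
Qed.

Lemma fps_subst_indep f (P : pred 'I_n) :
  (forall i, ~~ P i -> Psi i = fps_var R i) -> fps_indep f P -> fps_subst f = f.
Proof.
move=> PsiP fP; apply: fpsP => m; apply: fcoef_subst_eq => l fl.
congr (fcoef _ m); apply: eq_bigr => i _.
have [Pi|/PsiP -> //] := boolP (P i).
have [->|li] := eqVneq (l i) 0%N; first by rewrite !expr0.
by rewrite (fP l i) ?eqxx in fl.
Qed.

Lemma fps_subst_unipotent w d f :
  (forall i, ord_ge w (w i).+1 (Psi i - fps_var R i)) ->
  ord_ge w d f -> ord_ge w d.+1 (fps_subst f - f).
Proof.
move=> Psi_x hf m md; apply/eqP; rewrite fcoefB subr_eq0; apply/eqP.
apply: fcoef_subst_eq => l fl.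
have dl : (d <= wdeg w l)%N by rewrite leqNgt; apply: contraNN fl => ld; rewrite hf.
apply/eqP; rewrite -subr_eq0 -fcoefB; apply/eqP.
suff h : ord_ge w (wdeg w l).+1 (mmap1 Psi l - mmap1 (@fps_var n R) l).
  by apply: h; apply: leq_trans md _.
(* [C a x y] says that [x] and [y] have order [a] and the same leading part. It is stable under
   products, so the claim for monomials follows from the one for variables. *)
pose C a (x y : fps n R) := [/\ ord_ge w a x, ord_ge w a y & ord_ge w a.+1 (x - y)].
have CM a b x y x' y' : C a x y -> C b x' y' -> C (a + b)%N (x * x') (y * y').
  move=> [x1 y1 z1] [x2 y2 z2]; split; try exact: ord_geM.
  have -> : x * x' - y * y' = (x - y) * x' + y * (x' - y') by ring.
  apply: ord_geD; first by rewrite -addSn; apply: ord_geM.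
  by rewrite -addnS; apply: ord_geM.
have C1 : C 0%N 1 1 by split=> //; rewrite subrr; apply: ord_ge0.
have CX a b x y : C a x y -> C (a * b)%N (x ^+ b) (y ^+ b).
  by move=> c; elim: b => [|b IH]; rewrite ?muln0 // mulnS !exprS; apply: CM.
have : C (wdeg w l) (mmap1 Psi l) (mmap1 (@fps_var n R) l); last by case.
rewrite /wdeg /mmap1; elim/big_ind3: _ => // [*|i _]; first exact: CM.
apply: CX; split; last exact: Psi_x.
  by rewrite -(subrK (fps_var R i) (Psi i)); apply: ord_geD;
     [apply: ord_geW (Psi_x i) | apply: ord_ge_var].
exact: ord_ge_var.
Qed.

End Substitution.

Lemma inj_surj_bijective (A B : Type) (f : A -> B) :
  injective f -> (forall b, exists a, f a = b) -> bijective f.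
Proof.
move=> inj /choice[g fg]; exists g => // a.
by apply: inj; rewrite fg.
Qed.

Section Bijectivity.
Variables (n : nat) (k : fieldType).
Local Notation w1 := (@unit_weight n).

(** [s f = g] reads [f = g + f - s f]. The difference [f - s f] gains an order by unipotence, so the
    right-hand side contracts in [f]: its fixed points are the preimages of [g]. *)
Lemma fps_subst_unipotent_bij (w : 'I_n -> nat) (Psi : 'I_n -> fps n k) :
  (forall i, fps0 (Psi i) = 0) ->
  (forall i, ord_ge w (w i).+1 (Psi i - fps_var k i)) -> bijective (fps_subst Psi).
Proof.
move=> Psi0 Psi_x; pose s := subst_rmorphism Psi0.
pose Phi g (T : unit -> fps n k) (i : unit) := g + T i - s (T i).
have Phi_ord g T : (forall i, ord_ge w 0 (T i)) -> forall i, ord_ge w 0 (Phi g T i).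
  by move=> *; apply: ord_geT.
have Phi_contr g d T T' :
    (forall i, ord_ge w 0 (T i)) -> (forall i, ord_ge w 0 (T' i)) ->
    (forall i, ord_ge w d (T i - T' i)) ->
    forall i, ord_ge w d.+1 (Phi g T i - Phi g T' i).
  move=> _ _ h i; rewrite /Phi.
  have -> : g + T i - s (T i) - (g + T' i - s (T' i)) =
            - (s (T i - T' i) - (T i - T' i)) by rewrite rmorphB; ring.
  by apply: ord_geN; apply: fps_subst_unipotent.
have fixE g T : Phi g (fun=> T) tt = T <-> s T = g.
  rewrite /Phi; split=> [/eqP|->]; last by rewrite addrAC subrr add0r.
  by rewrite -subr_eq0 addrAC addrK subr_eq0 => /eqP ->.
apply: inj_surj_bijective => [f g fg|g].
  apply: (@contraction_unique _ _ w _ 0 (Phi (s g)) (@Phi_contr _)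
    (fun=> f) (fun=> g) _ _ _ _ tt) => // -[]; exact/fixE.
have [T [_ fT]] := contraction_fixpoint (@Phi_ord g) (@Phi_contr g).
exists (T tt); apply/fixE; rewrite /Phi; exact: fT.
Qed.

Definition fps_lin (A : 'M[k]_n) (i : 'I_n) : fps n k :=
  \sum_l fps_const n (A i l) * fps_var k l.

Lemma fps_lin0 A i : fps0 (fps_lin A i) = 0.
Proof. by rewrite fps0_sum big1 // => l _; rewrite fps0M fps0_var mulr0. Qed.

Lemma fps_linM A B i :
  fps_subst (fps_lin A) (fps_lin B i) = fps_lin (B *m A) i.
Proof.
pose s := subst_rmorphism (@fps_lin0 A).
rewrite -[fps_subst _]/(s : _ -> _) /fps_lin rmorph_sum.
under eq_bigr => l _.
  rewrite rmorphM /= fps_substC ?fps_substX; try exact: fps_lin0.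
  rewrite /fps_lin mulr_sumr; over.
rewrite exchange_big; apply: eq_bigr => l _ /=.
rewrite mxE rmorph_sum mulr_suml; apply: eq_bigr => p _.
by rewrite rmorphM mulrA.
Qed.

Lemma fps_lin1 i : fps_lin 1%:M i = fps_var k i.
Proof.
rewrite /fps_lin (bigD1 i) //= mxE eqxx rmorph1 mul1r big1 ?addr0 // => l li.
by rewrite mxE eq_sym (negPf li) rmorph0 mul0r.
Qed.

Lemma fps_subst_linK A : A \in unitmx ->
  cancel (fps_subst (fps_lin A)) (fps_subst (fps_lin (invmx A))).
Proof.
move=> uA f; pose s := subst_rmorphism (@fps_lin0 A).
pose s' := subst_rmorphism (@fps_lin0 (invmx A)).
pose G : {rmorphism fps n k -> fps n k} := s' \o s.
apply: (@fps_rmorph_ext n k G idfun) => [c|i|d g|d g] //=.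
- by rewrite !fps_substC //; apply: fps_lin0.
- by rewrite fps_substX ?fps_linM ?mulmxV ?fps_lin1 //; apply: fps_lin0.
- by move=> h; do !apply: fps_subst_ord1 => //; apply: fps_lin0.
Qed.

Lemma fps_subst_lin_bij A : A \in unitmx -> bijective (fps_subst (fps_lin A)).
Proof.
move=> uA; exists (fps_subst (fps_lin (invmx A))); first exact: fps_subst_linK.
by move=> f; rewrite -{1}[A]invmxK fps_subst_linK // unitmx_inv.
Qed.

Definition fps_jacobian (Psi : 'I_n -> fps n k) : 'M[k]_n :=
  \matrix_(i, l) fcoef (Psi i) (mnm1 l).

Lemma mdeg_lt2 (m : multinom n) :
  (mdeg m < 2)%N -> m = mnm0 \/ exists i, m = mnm1 i.
Proof.
rewrite ltnS leq_eqVlt => /orP[/mdeg1P[i /eqP]|]; first by right; exists i.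
by rewrite ltnS leqn0 mdeg_eq0 => /eqP; left.
Qed.

Lemma eq_mnm1 (i l : 'I_n) : (mnm1 i == mnm1 l) = (i == l).
Proof.
apply/eqP/eqP => [/(congr1 (fun m => fun_of_multinom m i))|-> //].
by rewrite !mnm1E eqxx; case: eqP.
Qed.

Lemma fcoef_var (R : comNzRingType) i m : fcoef (fps_var R i) m = (m == mnm1 i :> multinom n)%:R.
Proof. by rewrite /=; case: eqP. Qed.

Lemma fcoef_lin A i l : fcoef (fps_lin A i) (mnm1 l) = A i l.
Proof.
rewrite /fps_lin fcoef_sum (bigD1 l) // big1 => [|p pl]; rewrite fcoefC fcoef_var eq_mnm1.
  by rewrite [LHS]addr0 eqxx mulr1.
by rewrite eq_sym (negPf pl) mulr0.
Qed.

Lemma fps_lin_approx (f : fps n k) : fps0 f = 0 ->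
  ord_ge w1 2 (f - \sum_l fps_const n (fcoef f (mnm1 l)) * fps_var k l).
Proof.
move=> f0 m; rewrite wdeg_unit => /mdeg_lt2[->|[i ->]].
  rewrite -/(fps0 _) fps0B f0 fps0_sum big1 ?subrr // => l _.
  by rewrite fps0M fps0_var mulr0.
rewrite fcoefB.
have := @fcoef_lin (\matrix_(_, l) fcoef f (mnm1 l)) i i; rewrite mxE /fps_lin.
under eq_bigr do rewrite mxE.
by move=> ->; rewrite subrr.
Qed.

(** The formal inverse function theorem. Composing with the substitution by the inverse Jacobian
    makes the linear part the identity, and the result is unipotent for the standard weight. *)
Theorem fps_subst_bij (Psi : 'I_n -> fps n k) : (forall i, fps0 (Psi i) = 0) ->
  fps_jacobian Psi \in unitmx -> bijective (fps_subst Psi).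
Proof.
set J := fps_jacobian Psi => Psi0 uJ; have uJ' : invmx J \in unitmx by rewrite unitmx_inv.
pose s := subst_rmorphism Psi0; pose t := subst_rmorphism (@fps_lin0 (invmx J)).
pose Th i := t (Psi i).
have t_ord d f : ord_ge w1 d f -> ord_ge w1 d (t f).
  by apply: fps_subst_ord1; apply: fps_lin0.
have Th0 i : fps0 (Th i) = 0 by apply/(@ord_ge1 _ _ w1) => //; apply/t_ord/ord_ge1.
pose G : {rmorphism fps n k -> fps n k} := t \o s.
have GE : G =1 subst_rmorphism Th0.
  apply: fps_rmorph_ext => [c|i|d f h|d f h] /=.
  - by rewrite !fps_substC //; apply: fps_lin0.
  - by rewrite !fps_substX.
  - by apply: t_ord; apply: fps_subst_ord1.
  - exact: fps_subst_ord1.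
have [u ut tu] : bijective t by apply: fps_subst_lin_bij.
have bG : bijective G.
  apply: (eq_bij _ (fsym GE)); apply: (@fps_subst_unipotent_bij w1) => // i.
  have -> : Th i - fps_var k i = t (Psi i - fps_lin J i).
    by rewrite rmorphB [t (fps_lin _ _)]fps_linM mulmxV // fps_lin1.
  apply: t_ord; rewrite /fps_lin.
  by under eq_bigr do rewrite mxE; apply: fps_lin_approx.
have [v vG Gv] := bG.
by exists (v \o t) => f /=; [apply: vG | apply: (can_inj ut); apply: Gv].
Qed.

End Bijectivity.

Lemma fps0_subst n (R : comNzRingType) (Psi : 'I_n -> fps n R) f :
  (forall i, fps0 (Psi i) = 0) -> fps0 (fps_subst Psi f) = fps0 f.
Proof.
move=> Psi0; pose s := subst_rmorphism Psi0; pose w1 := @unit_weight n.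
have : fps0 (s (f - fps_const n (fps0 f))) = 0.
  apply/(@ord_ge1 _ _ w1) => //; apply: fps_subst_ord1 => //; apply/ord_ge1 => //.
  by rewrite fps0B fps0_const subrr.
rewrite rmorphB fps0B [s (fps_const _ _)]fps_substC // fps0_const => /eqP.
by rewrite subr_eq0 => /eqP.
Qed.

Section Derivative.
Variables (n : nat) (R : comNzRingType) (i : 'I_n).
Implicit Types f g : fps n R.

Definition fps_deriv f : fps n R :=
  Fps (fun m : multinom n => fcoef f (mnm_add m (mnm1 i)) *+ (m i).+1).

Lemma fcoef_deriv f m :
  fcoef (fps_deriv f) m = fcoef f (mnm_add m (mnm1 i)) *+ (m i).+1.
Proof. by []. Qed.

Lemma fps_derivD f g : fps_deriv (f + g) = fps_deriv f + fps_deriv g.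
Proof. by apply: fpsP => m; rewrite fcoefD !fcoef_deriv fcoefD mulrnDl. Qed.

Lemma fps_derivM f g : fps_deriv (f * g) = f * fps_deriv g + g * fps_deriv f.
Proof.
apply: fpsP => m; rewrite fcoef_deriv.
set m' := mnm_add m (mnm1 i); pose t (h : fps n R) := fps_trunc (mdeg m').+1 h.
have tE (h : fps n R) l : (mdeg l <= mdeg m')%N -> mcoeff l (t h) = fcoef h l.
  by move=> lm; apply: fps_truncE.
have lt l : (mdeg l <= mdeg m)%N -> (mdeg (mnm_add l (mnm1 i)) <= mdeg m')%N.
  by move=> h; rewrite !mdegD !mdeg1 leq_add2r.
have lt' l : (mdeg l <= mdeg m)%N -> (mdeg l <= mdeg m')%N.
  by move=> h; rewrite mdegD; apply: leq_trans h (leq_addr _ _).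
have dtE (h : fps n R) l : (mdeg l <= mdeg m)%N ->
    mcoeff l (mderiv i (t h)) = fcoef (fps_deriv h) l.
  by move=> h'; rewrite mcoeff_deriv fcoef_deriv tE // lt.
have -> : fcoef (f * g) m' = mcoeff m' (t f * t g) by apply: fps_mulE => l; apply: tE.
rewrite -mcoeff_deriv mderivM addrC mcoeffD fcoefD; congr (_ + _); symmetry.
  by apply: fps_mulE => l h; rewrite ?tE ?lt' // dtE.
by rewrite mulrC; apply: fps_mulE => l h; rewrite ?tE ?lt' // dtE.
Qed.

Lemma fps_derivC c : fps_deriv (fps_const n c) = 0.
Proof.
apply: fpsP => m; rewrite fcoef_deriv fps_constE fcoef0 -mdeg_eq0 mdegD mdeg1 addn1.
by rewrite mulr0 mul0rn.
Qed.

Lemma fps_derivX l : fps_deriv (fps_var R l) = (l == i)%:R.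
Proof.
apply: fpsP => m; rewrite fcoef_deriv fcoef_var.
have -> : fcoef ((l == i)%:R : fps n R) m = (l == i)%:R * (m == mnm0)%:R.
  by case: eqP => _; rewrite ?mul0r // mul1r fcoef1.
have [->|m0] := eqVneq m mnm0.
  by rewrite add0m eq_mnm1 eq_sym mulr1 mnm0E.
rewrite mulr0; case: eqP => [e|]; last by rewrite mul0rn.
have := congr1 (@mdeg n) e; rewrite mdegD !mdeg1 => d.
by case/eqP: m0; apply/eqP; rewrite -mdeg_eq0; apply/eqP; lia.
Qed.

Lemma fps0_deriv f : fps0 (fps_deriv f) = fcoef f (mnm1 i).
Proof. by rewrite /fps0 fcoef_deriv mnm0E add0m. Qed.

End Derivative.

(** The factor is 2 on the diagonal: in characteristic 2 the Hessian does not see squares. *)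
Lemma fcoef_deriv2 n (R : comNzRingType) (i l : 'I_n) (f : fps n R) :
  fps0 (fps_deriv i (fps_deriv l f)) =
  fcoef f (mnm_add (mnm1 i) (mnm1 l)) *+ (i == l).+1.
Proof. by rewrite fps0_deriv fcoef_deriv mnm1E. Qed.

(** * Splitting off a nondegenerate quadratic form *)

Section Morse.
Variables (n m : nat) (k : fieldType) (iota : 'I_m -> 'I_n) (N : 'M[k]_m).

(** [N] is not assumed symmetric, so that forms such as [y_1 y_2] are covered in characteristic 2.
    Nondegeneracy is asked of the polar form [B = N + N^T]. *)
Definition fps_quad (v : 'I_m -> fps n k) : fps n k :=
  \sum_i \sum_l fps_const n (N i l) * (v i * v l).

Let y i := fps_var k (iota i).
Let P : pred 'I_n := [pred i | i \in codom iota].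
Let w (i : 'I_n) := if P i then 1%N else 2%N.
Let B := N + N^T.

Lemma fps_quad_ord d v : (forall i, ord_ge w d (v i)) -> ord_ge w (d + d) (fps_quad v).
Proof.
move=> h; apply: ord_ge_sum => i _; apply: ord_ge_sum => l _.
by apply: ord_geMl; apply: ord_geM.
Qed.

Lemma fps_quadB d v v' : (forall i, ord_ge w 2 (v i)) -> (forall i, ord_ge w 2 (v' i)) ->
  (forall i, ord_ge w d (v i - v' i)) -> ord_ge w d.+2 (fps_quad v - fps_quad v').
Proof.
move=> h h' hd; rewrite /fps_quad -sumrB; apply: ord_ge_sum => i _.
rewrite -sumrB; apply: ord_ge_sum => l _; rewrite -mulrBr; apply: ord_geMl.
have -> : v i * v l - v' i * v' l = (v i - v' i) * v l + (v l - v' l) * v' i by ring.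
by rewrite -[d.+2]addn2; apply: ord_geD; apply: ord_geM.
Qed.

Lemma fps_quadD v v' : fps_quad (fun i => v i + v' i) =
  fps_quad v + \sum_i v i * \sum_l fps_const n (B i l) * v' l + fps_quad v'.
Proof.
have -> : \sum_i v i * (\sum_l fps_const n (B i l) * v' l) =
    \sum_i \sum_l fps_const n (N i l) * (v i * v' l) +
    \sum_i \sum_l fps_const n (N i l) * (v' i * v l).
  rewrite [X in _ + X]exchange_big -big_split; apply: eq_bigr => i _ /=.
  rewrite mulr_sumr -big_split; apply: eq_bigr => l _ /=.
  by rewrite !mxE rmorphD /=; ring.
rewrite /fps_quad -!big_split; apply: eq_bigr => i _ /=.
by rewrite -!big_split; apply: eq_bigr => l _ /=; ring.
Qed.

Hypothesis iota_inj : injective iota.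
Hypothesis B_unit : B \in unitmx.

Lemma wdeg_lt2 (u : multinom n) :
  (wdeg w u < 2)%N -> u = mnm0 \/ exists i, u = mnm1 (iota i).
Proof.
have w1 i : (1 <= w i)%N by rewrite /w; case: ifP.
move=> u2; have : (mdeg u < 2)%N.
  apply: leq_ltn_trans u2; rewrite -wdeg_unit; apply: leq_sum => i _.
  by rewrite leq_mul2r w1 orbT.
move=> /mdeg_lt2[|[i ui]]; [by left | right].
move: u2; rewrite ui wdeg1 /w; case: ifP => // /codomP[l ->] _.
by exists l.
Qed.

(* We look for a substitution [y i |-> y i + T i] such that [F] minus
   [fps_quad (y + T)] does not involve the [y i]. With weight 1 on these variables
   and 2 on the others, this is a fixed point equation for a contraction. *)
Theorem morse_splitting (F : fps n k) (G := F - fps_quad y) :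
  (forall i, fcoef G (mnm1 (iota i)) = 0) ->
  (forall i l, fcoef G (mnm_add (mnm1 (iota i)) (mnm1 (iota l))) = 0) ->
  exists (phi : {rmorphism fps n k -> fps n k}) (h : fps n k),
    [/\ bijective phi, forall g, fps_indep g P -> phi g = g,
        fps_indep h P, ord_ge w 4 (h - fps_rem P G) & phi F = fps_quad y + h].
Proof.
move=> G1 G2; pose S i (f : fps n k) := fps_quo P (iota i) f.
(* By [fps_quadD], the terms of [F - fps_quad (y + T)] divisible by some [y i] cancel once [B T] is
   the vector of quotients of [G - fps_quad T] by the [y i]. [Phi] solves this equation for the
   linear occurrence of [T]. *)
pose Phi T i := \sum_l fps_const n (invmx B i l) * (S l G - S l (fps_quad T)).
have Piota i : P (iota i) by exact: codom_f.
have wi i : w (iota i) = 1%N by rewrite /w Piota.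
have S_ord d i f : ord_ge w d.+1 f -> ord_ge w d (S i f).
  by move=> h; apply: fps_quo_ord; rewrite wi addn1.
have [|d T T' hT hT' hd i|T [T2 fT]] := @contraction_fixpoint n k w 'I_m 2 Phi.
- move=> T hT i; apply: ord_ge_sum => l _; apply: ord_geMl; apply: ord_geB.
    (* A coefficient of weight below 2 in a quotient of [G] is a coefficient of [G] at some [y l] or
       at a product [y p y l]; these vanish by [G1] and [G2]. *)
    move=> u /wdeg_lt2 h; rewrite fcoef_quo; case: ifP => // _.
    by case: h => [->|[p ->]]; rewrite ?add0m.
  by apply: S_ord; apply: (ord_geW _ (fps_quad_ord hT)).
- rewrite /Phi -sumrB; apply: ord_ge_sum => l _; rewrite -mulrBr; apply: ord_geMl.
  have -> : S l G - S l (fps_quad T) - (S l G - S l (fps_quad T')) =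
            - (S l (fps_quad T - fps_quad T')) by rewrite /S fps_quoB; ring.
  by apply: ord_geN; apply: S_ord; apply: fps_quadB.
pose D := G - fps_quad T; pose h := fps_rem P D.
have BT i : \sum_l fps_const n (B i l) * T l = S i D.
  have TE l : T l = \sum_p fps_const n (invmx B l p) * S p D.
    by rewrite -[LHS]fT /Phi; apply: eq_bigr => p _; rewrite /S /D fps_quoB.
  have BV p : \sum_l fps_const n (B i l) * fps_const n (invmx B l p) =
              fps_const n (1%:M i p) :> fps n k.
    by rewrite -(mulmxV B_unit) mxE rmorph_sum; apply: eq_bigr => l _; rewrite rmorphM.
  transitivity (\sum_l \sum_p fps_const n (B i l) * (fps_const n (invmx B l p) * S p D)).
    by apply: eq_bigr => l _; rewrite TE mulr_sumr.
  rewrite exchange_big; transitivity (\sum_p fps_const n (1%:M i p) * S p D).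
    apply: eq_bigr => p _; rewrite -BV mulr_suml.
    by apply: eq_bigr => l _; rewrite mulrA.
  rewrite (bigD1 i) // big1 => [|p pi]; rewrite mxE; last first.
    by rewrite eq_sym (negPf pi) rmorph0 mul0r.
  by rewrite eqxx rmorph1 mul1r [LHS]addr0.
have FE : F = fps_quad (fun i => y i + T i) + h.
  rewrite fps_quadD; under eq_bigr do rewrite BT.
  have : D = h + \sum_i y i * S i D.
    rewrite {1}(fps_quo_rem P D); congr (_ + _).
    rewrite -[LHS]/(\sum_(i in codom iota) fps_var k i * fps_quo P i D).
    rewrite -big_uniq; last exact/injectiveP.
    by rewrite big_map big_enum.
  rewrite /D => DE; have -> : \sum_i y i * S i (G - fps_quad T) = G - fps_quad T - h.
    by apply/esym/eqP; rewrite subr_eq [X in _ == X]addrC; apply/eqP.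
  by rewrite /G; ring.
pose Psi i := fps_var k i + \sum_(l | iota l == i) T l.
have Psi_iota i : Psi (iota i) = y i + T i.
  by rewrite /Psi (big_pred1 i) // => l; rewrite (inj_eq iota_inj).
have PsiN i : ~~ P i -> Psi i = fps_var k i.
  move=> Pi; rewrite /Psi big_pred0 ?addr0 // => l.
  by apply: contraNF Pi => /eqP <-; apply: codom_f.
have Psi_w i : ord_ge w (w i).+1 (Psi i - fps_var k i).
  have [/codomP[l ->]|Pi] := boolP (P i); last by rewrite PsiN // subrr; apply: ord_ge0.
  by rewrite wi Psi_iota addrC addKr.
have w_gt0 i : (0 < w i)%N by rewrite /w; case: ifP.
have Psi0 i : fps0 (Psi i) = 0.
  apply/(ord_ge1 w_gt0); rewrite -(subrK (fps_var k i) (Psi i)); apply: ord_geD.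
    exact: (ord_geW _ (Psi_w i)).
  exact: (ord_geW (w_gt0 i) (@ord_ge_var _ k w i)).
pose s := subst_rmorphism Psi0.
have [t st ts] : bijective s by apply: (fps_subst_unipotent_bij Psi0 Psi_w).
have tB : zmod_morphism t by move=> a b; apply: (can_inj st); rewrite rmorphB !ts.
have tM : monoid_morphism t.
  by split=> [|a b]; apply: (can_inj st); rewrite ?rmorph1 ?rmorphM ?ts.
(* [s] sends [fps_quad y + h] to [F], so the automorphism asked for is its inverse [t]. *)
pose phi : {rmorphism fps n k -> fps n k} := HB.pack t
  (GRing.isZmodMorphism.Build _ _ t tB) (GRing.isMonoidMorphism.Build _ _ t tM).
have sP g : fps_indep g P -> s g = g by apply: fps_subst_indep.
have hP : fps_indep h P by apply: fps_rem_indep.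
exists phi, h; split=> //; first by exists s.
- by move=> g gP; rewrite -{1}(sP g gP) /= st.
(* [T] has weight at least 2, hence [fps_quad T] weight at least 4. This estimate later gives the
   constant and linear terms of [h] from those of [G]. *)
- have -> : h - fps_rem P G = - fps_rem P (fps_quad T).
    by apply: fpsP => u; rewrite fcoefB fcoefN !fcoef_rem fcoefB; case: ifP; rewrite ?subrr ?oppr0 // addrAC subrr add0r.
  by apply: ord_geN; apply: fps_rem_ord; exact: (@fps_quad_ord 2 T T2).
apply: (can_inj st); rewrite [LHS]ts rmorphD (sP _ hP) {1}FE; congr (_ + h).
rewrite /fps_quad rmorph_sum; apply: eq_bigr => i _.
rewrite rmorph_sum; apply: eq_bigr => l _.
by rewrite !rmorphM /= fps_substC // /y !fps_substX // !Psi_iota.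
Qed.

End Morse.

(** * The Nullstellensatz *)

Section PrimeIdeals.
Variables (A : comPzRingType) (P : set A).
Hypothesis P_prime : is_prime_ideal P.

Lemma prime0 : P 0. Proof. by case: P_prime => -[]. Qed.
Lemma prime1 : ~ P 1. Proof. by case: P_prime. Qed.
Lemma primeD a b : P a -> P b -> P (a + b). Proof. by case: P_prime => -[_ h _] _ _; apply: h. Qed.
Lemma primeMl a b : P b -> P (a * b). Proof. by case: P_prime => -[_ _ h] _ _; apply: h. Qed.
Lemma primeMr a b : P a -> P (a * b). Proof. by rewrite mulrC; apply: primeMl. Qed.
Lemma primeN a : P a -> P (- a). Proof. by rewrite -mulN1r; apply: primeMl. Qed.
Lemma primeB a b : P a -> P b -> P (a - b).
Proof. by move=> ? ?; apply: primeD => //; apply: primeN. Qed.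
Lemma primeM a b : P (a * b) -> P a \/ P b. Proof. by case: P_prime => _ _ h; apply: h. Qed.
Lemma primeX a d : P (a ^+ d) -> P a.
Proof.
by elim: d => [|d IH]; [rewrite expr0 => /prime1 | rewrite exprS => /primeM[]].
Qed.
Lemma prime_sum (I : Type) (r : seq I) (Q : pred I) (F : I -> A) :
  (forall i, Q i -> P (F i)) -> P (\sum_(i <- r | Q i) F i).
Proof. by move=> h; elim/big_ind: _ => //; [exact: prime0|move=> *; apply: primeD]. Qed.
End PrimeIdeals.

Section Extension.
Variables (R : comNzRingType) (P : set {poly R}).
Hypothesis P_prime : is_prime_ideal P.
Implicit Types (f g p q r : {poly R}) (a b c : R).

Let P0 a := P a%:P.

(** The extension of the contracted ideal [P0] to polynomials. Computing modulo [Z] stands for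
    computing over the domain [R / P0], without forming the quotient. *)
Let Z g := forall i, P0 g`_i.

Let P00 : P0 0. Proof. by rewrite /P0 polyC0; apply: prime0. Qed.

Let Z0 : Z 0. Proof. by move=> i; rewrite coef0. Qed.

Let ZP g : Z g -> P g.
Proof.
move=> zg; rewrite -[g]coefK poly_def; apply: prime_sum => // i _.
by rewrite -mul_polyC; apply: primeMr => //; apply: zg.
Qed.

Let P0M a b : P0 (a * b) -> P0 a \/ P0 b.
Proof. by rewrite /P0 polyCM; apply: primeM. Qed.

Let P0X a d : P0 (a ^+ d) -> P0 a.
Proof. by rewrite /P0 polyC_exp; apply: primeX. Qed.

Let ZM g h : Z g -> Z (h * g).
Proof.
move=> zg i; rewrite coefM /P0 rmorph_sum /=; apply: prime_sum => // l _.
by rewrite polyCM; apply: primeMl => //; apply: zg.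
Qed.

Let ZD g h : Z g -> Z h -> Z (g + h).
Proof. by move=> zg zh i; rewrite coefD /P0 polyCD; apply: primeD; [|apply: zg|apply: zh]. Qed.

(** Dropping top terms with coefficient in [P0] gives a representative modulo [Z] whose degree is
    the degree over [R / P0]. *)
Let strip g : exists g', [/\ Z (g - g'), (size g' <= size g)%N
  & g' = 0 \/ ~ P0 (lead_coef g')].
Proof.
have [s] := ubnP (size g); elim: s g => // s IH g gs.
have [g0|g0] := eqVneq g 0.
  by exists 0; rewrite g0; split=> //; [rewrite subrr | left].
have [lg|lg] := pselect (P0 (lead_coef g)); last first.
  by exists g; split=> //; [rewrite subrr | right].
have sg : (0 < size g)%N by rewrite lt0n size_poly_eq0.
pose h := take_poly (size g).-1 g.
have sh : (size h <= (size g).-1)%N by apply: size_take_poly.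
have zh : Z (g - h).
  move=> i; rewrite coefB coef_take_poly; case: ifP => [_|/negbT].
    by rewrite subrr.
  rewrite subr0 -leqNgt leq_eqVlt => /orP[/eqP <- //|lt].
  by rewrite nth_default // -(prednK sg).
have [|g' [z' s' l']] := IH h; first by apply: leq_ltn_trans sh _; rewrite -ltnS prednK.
exists g'; split=> //; last by rewrite (leq_trans s') // (leq_trans sh) // leq_pred.
by rewrite -(subrK h g) -addrA; apply: ZD.
Qed.

(** Over the fraction field of [R / P0] the ideal [P] is generated by [p], irreducible of minimal
    degree, so [f] is coprime to [p]. The conclusion is the Bezout identity with denominators
    cleared, found by pseudo-division with induction on the size of [f]. *)
Let coprime_to p :
  P p -> ~ P0 (lead_coef p) ->
  (forall g, P g -> ~ P0 (lead_coef g) -> (size p <= size g)%N) ->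
  forall f, ~ P f -> exists c u v, ~ P0 c /\ Z (u * f + v * p - c%:P).
Proof.
move=> Pp lp minp.
have small g : P g -> (size g < size p)%N -> Z g.
  move=> Pg gp; have [g' [zg' sg' [g'0|lg']]] := strip g.
    by move: zg'; rewrite g'0 subr0.
  have Pg' : P g' by rewrite -(subKr g g'); apply: primeB => //; apply: ZP.
  by have := leq_trans (minp _ Pg' lg') sg'; rewrite leqNgt gp.
move=> f; have [s] := ubnP (size f); elim: s f => // s IH f fs Pf.
suff [r [zr sr lr [c [u [v [hc zc]]]]]] : exists r, [/\ Z (f - r), (size r <= size f)%N,
    ~ P0 (lead_coef r) & exists c u v, ~ P0 c /\ Z (u * r + v * p - c%:P)].
  exists c, u, v; split=> //.
  have -> : u * f + v * p - c%:P = u * (f - r) + (u * r + v * p - c%:P) by ring.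
  by apply: ZD => //; apply: ZM.
have [r [zr sr [r0|lr]]] := strip f.
  by case: Pf; apply: ZP; rewrite r0 subr0 in zr.
exists r; split=> //.
have Pr : ~ P r by move=> Pr; apply: Pf; rewrite -(subrK r f); apply: primeD => //; apply: ZP.
have r0 : r != 0 by apply: contra_not_neq lr => ->; rewrite lead_coef0.
have p0 : p != 0 by apply: contra_not_neq lp => ->; rewrite lead_coef0.
have sr0 : (0 < size r)%N by rewrite lt0n size_poly_eq0.
have [sr1|sr1] := leqP (size r) 1.
  exists (lead_coef r), 1, 0; split=> //.
  by rewrite mul1r mul0r addr0 (size1_polyC sr1) lead_coefC subrr.
have [spr|srp] := leqP (size p) (size r).
  have := Pdiv.ComRing.rdivp_eq p r; set q := Pdiv.Ring.rdivp r p; set t := Pdiv.Ring.rmodp r p.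
  set N := Pdiv.Ring.rscalp r p => E.
  have tE : t = (lead_coef p ^+ N) *: r - q * p by rewrite E addrC addKr.
  have Pt : ~ P t.
    move=> Pt; have : P ((lead_coef p ^+ N)%:P * r).
      by rewrite mul_polyC E; apply: primeD => //; apply: primeMl.
    by move=> /primeM[//|/P0X|].
  have st : (size t < size p)%N by rewrite Pdiv.Ring.ltn_rmodp.
  have [|c [u [v [hc zc]]]] := IH t _ Pt.
    by rewrite -ltnS (leq_trans _ fs) // ltnS (leq_trans st) // (leq_trans spr).
  exists c, (u * (lead_coef p ^+ N)%:P), (v - u * q); split=> //.
  move: zc; rewrite tE -mul_polyC; congr (Z _); ring.
have := Pdiv.ComRing.rdivp_eq r p; set q := Pdiv.Ring.rdivp p r; set t := Pdiv.Ring.rmodp p r.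
set N := Pdiv.Ring.rscalp p r => E; set b := lead_coef r in lr E *.
have st : (size t < size r)%N by rewrite Pdiv.Ring.ltn_rmodp.
have tE : t = (b ^+ N) *: p - q * r by rewrite E addrC addKr.
have [Pt|Pt] := pselect (P t); last first.
  have [|c [u [v [hc zc]]]] := IH t _ Pt.
    by rewrite -ltnS (leq_trans _ fs) // ltnS (leq_trans st).
  exists c, (- u * q), (v + u * (b ^+ N)%:P); split=> //.
  move: zc; rewrite tE -mul_polyC; congr (Z _); ring.
(* This case is impossible. By minimality of [p] the remainder vanishes modulo [Z], so [b ^+ N]
   times [p] is [q * r] modulo [Z]; as [r] is not in [P], [q] is. Minimality bounds the degree of
   [q] below by that of [p], while [r] is not constant. *)
have zt : Z t by apply: small => //; apply: ltn_trans st srp.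
have Pq : P q.
  have : P (q * r) by rewrite -(addrK t (q * r)) -E -mul_polyC; apply: primeB => //; apply: primeMl.
  by move=> /primeM[].
have [q' [zq' sq' cq']] := strip q.
have z : Z ((b ^+ N) *: p - q' * r).
  have -> : (b ^+ N) *: p - q' * r = r * (q - q') + t by rewrite tE; ring.
  by apply: ZD => //; apply: ZM.
have Pbp : ~ P0 (b ^+ N * lead_coef p) by move=> /P0M[/P0X|].
case: cq' => [q'0|lq'].
  by case: Pbp; have := z (size p).-1; rewrite q'0 mul0r subr0 coefZ.
have Pq' : P q' by rewrite -(subKr q q'); apply: primeB => //; apply: ZP.
have := minp _ Pq' lq' => spq.
have := z (size q' + size r).-2; rewrite coefB coefZ.
rewrite (@nth_default _ _ p); last first.
  by apply: leq_trans spq _; case: (size r) sr1 => [|[|z']] // _; rewrite !addnS /= leq_addr.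
rewrite mulr0 sub0r /P0 polyCN => /(primeN P_prime); rewrite opprK.
have -> : (q' * r)`_(size q' + size r).-2 = lead_coef q' * b.
  by rewrite -mul_lead_coef.
by move=> /P0M[].
Qed.

(* Inductive step of the Nullstellensatz: a minimal [p] as in [coprime_to] generates
   [P] once its leading coefficient is inverted. *)
Lemma prime_extension (k : closedFieldType) f : ~ P f ->
  exists a, ~ P0 a /\ forall phi : {rmorphism R -> k},
    (forall b, P0 b -> phi b = 0) -> phi a != 0 ->
    exists xi, (forall g, P g -> (map_poly phi g).[xi] = 0) /\ (map_poly phi f).[xi] != 0.
Proof.
move=> Pf.
have phiZ (phi : {rmorphism R -> k}) g : (forall b, P0 b -> phi b = 0) -> Z g -> map_poly phi g = 0.
  by move=> phi0 zg; apply/polyP => i; rewrite coef_map coef0; apply: phi0; apply: zg.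
have [ex|nex] := pselect (exists p, P p /\ ~ P0 (lead_coef p)); last first.
  (* Here [P] is the extension of [P0]. The element [a] is a coefficient of [f] outside [P0], and
     [xi] can be any non-root of the image of [f]. *)
  have PZ g : P g -> Z g.
    move=> Pg; have [g' [zg' _ [g'0|lg']]] := strip g; first by rewrite g'0 subr0 in zg'.
    case: nex; exists g'; split=> //.
    by rewrite -(subKr g g'); apply: primeB => //; apply: ZP.
  have [i fi] : exists i, ~ P0 f`_i.
    by apply: contrapT => h; apply: Pf; apply: ZP => i; apply: contrapT => fi; apply: h; exists i.
  exists f`_i; split=> // phi phi0 fi0.
  have /closed_nonrootP[xi xif] : map_poly phi f != 0.
    by apply: contraNneq fi0 => /polyP /(_ i); rewrite coef_map coef0 => ->.
  exists xi; split=> [g Pg|]; last by [].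
  by rewrite phiZ ?horner0 //; apply: PZ.
have ex' : exists s, `[< exists p, [/\ P p, ~ P0 (lead_coef p) & size p = s] >].
  by case: ex => p [? ?]; exists (size p); apply/asboolP; exists p.
case: (ex_minnP ex') => s /asboolP[p [Pp lp sp]] mins.
have minp g : P g -> ~ P0 (lead_coef g) -> (size p <= size g)%N.
  by move=> Pg lg; rewrite sp; apply: mins; apply/asboolP; exists g.
have [c [u [v [hc zc]]]] := coprime_to Pp lp minp Pf.
(* Where the first factor is nonzero, the image of [p] keeps its degree and has a root [xi], and
   pseudo-division by [p] shows that all of [P] vanishes there. The second factor is the Bezout
   constant, which keeps [f] from vanishing at [xi]. *)
exists (lead_coef p * c); split=> [/P0M[]//|phi phi0].
rewrite rmorphM mulf_eq0 negb_or => /andP[pa pc].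
have sp' : size (map_poly phi p) = size p by rewrite size_map_poly_id0.
have p0 : p != 0 by apply: contraNneq pa => ->; rewrite lead_coef0 rmorph0.
have sp1 : size (map_poly phi p) != 1.
  rewrite sp'; apply: contra_notN lp => /eqP sp1; rewrite /P0.
  by move: Pp; rewrite (size1_polyC (eq_leq sp1)) lead_coefC.
have /closed_rootP[xi /eqP pxi] := sp1.
exists xi; split=> [g Pg|].
  have := Pdiv.ComRing.rdivp_eq p g; set q := Pdiv.Ring.rdivp g p.
  set t := Pdiv.Ring.rmodp g p; set d := Pdiv.Ring.rscalp g p => E.
  have Pt : P t.
    have -> : t = (lead_coef p ^+ d)%:P * g - q * p by rewrite mul_polyC E addrC addKr.
    by apply: primeB => //; apply: primeMl.
  have st : (size t < size p)%N by rewrite Pdiv.Ring.ltn_rmodp.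
  have zt : Z t.
    have [t' [zt' st' [t'0|lt']]] := strip t; first by rewrite t'0 subr0 in zt'.
    have Pt' : P t' by rewrite -(subKr t t'); apply: primeB => //; apply: ZP.
    by have := leq_trans (minp _ Pt' lt') st'; rewrite leqNgt st.
  have := congr1 (fun h => (map_poly phi h).[xi]) E.
  rewrite -mul_polyC !rmorphD !rmorphM /= map_polyC /= (phiZ phi t) // addr0 !hornerM pxi mulr0.
  rewrite hornerC rmorphXn /= => /eqP; rewrite mulf_eq0 expf_eq0 (negPf pa) andbF /=.
  by move=> /eqP.
apply: contraNneq pc => fxi.
have := congr1 (fun h => h.[xi]) (phiZ phi _ phi0 zc).
rewrite rmorphB rmorphD !rmorphM /= map_polyC !hornerE pxi fxi !mulr0 !add0r.
by move/eqP; rewrite oppr_eq0.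
Qed.

End Extension.

(** The element [f] makes the induction close: [prime_extension] returns an [a] outside the
    contracted ideal, and the zero found with one variable less has to avoid the zeros of [a]. *)
Theorem prime_zero (k : closedFieldType) N (P : set (mpoly N k)) (f : mpoly N k) :
  is_prime_ideal P -> ~ P f ->
  exists xi : 'I_N -> k, (forall g, P g -> meval xi g = 0) /\ meval xi f != 0.
Proof.
elim: N P f => [|N IH] P f P_prime Pf.
  exists (fun=> 0); split=> [g Pg|]; rewrite [X in meval _ X]nvar0_mpolyC mevalC.
    apply: contra_notP (prime1 P_prime) => /eqP g0.
    have -> : 1 = mpolyC 0 (mcoeff mnm0 g)^-1 * g.
      by have := nvar0_mpolyC g; set c := mcoeff _ g in g0 *; move=> ->; rewrite -mpolyCM mulVf.
    exact: primeMl.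
  apply: contra_not_neq Pf => f0; rewrite [f]nvar0_mpolyC f0 mpolyC0; exact: prime0.
(* [uni] treats the last variable as the polynomial variable over the others; its left inverse
   [multi] transports [P] to the prime ideal [Q]. *)
pose X (i : 'I_N.+1) : {poly mpoly N k} :=
  if unlift ord_max i is Some l then (mpolyX k (mnm1 l))%:P else 'X.
pose C : {rmorphism k -> {poly mpoly N k}} := polyC \o @mpolyC N k.
pose uni : {rmorphism mpoly N.+1 k -> {poly mpoly N k}} := mmap C X.
pose wid : {rmorphism mpoly N k -> mpoly N.+1 k} :=
  mmap (@mpolyC N.+1 k) (fun l => mpolyX k (mnm1 (lift ord_max l))).
pose multi : {rmorphism {poly mpoly N k} -> mpoly N.+1 k} :=
  horner_eval (mpolyX k (mnm1 ord_max)) \o map_poly wid.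
have XE l : X (lift ord_max l) = (mpolyX k (mnm1 l))%:P by rewrite /X liftK.
have XE' : X ord_max = 'X by rewrite /X unlift_none.
have uniC c : uni (mpolyC N.+1 c) = (mpolyC N c)%:P by rewrite /= mmapC.
have uniX i : uni (mpolyX k (mnm1 i)) = X i by rewrite /= mmapX mmap1U.
have uniK : cancel uni multi.
  pose U : {rmorphism mpoly N.+1 k -> mpoly N.+1 k} := multi \o uni.
  apply: (@mpoly_rmorph_ext _ _ _ U idfun) => [c|i].
    by rewrite /U [LHS]/= -[mmap _ _ _]/(uni _) uniC /horner_eval map_polyC hornerC /= mmapC.
  rewrite /U [LHS]/= -[mmap _ _ _]/(uni _) uniX /horner_eval.
  have [l ->|->] := unliftP ord_max i.
    by rewrite XE map_polyC hornerC /= mmapX mmap1U.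
  by rewrite XE' map_polyX hornerX.
pose Q G := P (multi G).
have Q_prime : is_prime_ideal Q.
  split; first split.
  - by rewrite /Q rmorph0; apply: prime0.
  - by move=> a b Qa Qb; rewrite /Q rmorphD; apply: primeD.
  - by move=> a b Qb; rewrite /Q rmorphM; apply: primeMl.
  - by rewrite /Q rmorph1; apply: prime1.
  - by move=> a b; rewrite /Q rmorphM; apply: primeM.
have Quni g : Q (uni g) <-> P g by rewrite /Q uniK.
have [|a [Qa ext]] := @prime_extension _ Q Q_prime k (uni f); first by rewrite Quni.
pose Q0 b := Q b%:P.
have [|eta [Q0eta eta_a]] := IH Q0 a _ Qa.
  split; first split.
  - by rewrite /Q0 polyC0; exact: (prime0 Q_prime).
  - by move=> b c hb hc; rewrite /Q0 polyCD; exact: (primeD Q_prime hb hc).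
  - by move=> b c hc; rewrite /Q0 polyCM; exact: (primeMl Q_prime _ hc).
  - by rewrite /Q0 polyC1; exact: (prime1 Q_prime).
  - by move=> b c; rewrite /Q0 polyCM; exact: (primeM Q_prime).
have [t [Qt ft]] := ext (meval eta) Q0eta eta_a.
pose xi i := if unlift ord_max i is Some l then eta l else t.
have E g : meval xi g = (map_poly (meval eta) (uni g)).[t].
  pose V : {rmorphism mpoly N.+1 k -> k} := horner_eval t \o (map_poly (meval eta) \o uni).
  apply: (@mpoly_rmorph_ext _ _ _ (meval xi) V) => [c|i].
    by rewrite [LHS]mevalC /V [RHS]/= -[mmap _ _ _]/(uni _) uniC /horner_eval map_polyC hornerC /= mevalC.
  rewrite [LHS]mevalXU /V [RHS]/= -[mmap _ _ _]/(uni _) uniX /horner_eval /xi.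
  have [l ->|->] := unliftP ord_max i.
    by rewrite XE map_polyC hornerC /= mevalXU.
  by rewrite XE' map_polyX hornerX.
exists xi; split=> [g Pg|]; rewrite E //.
by apply: Qt; apply/Quni.
Qed.

(** * Minors and quadratic forms *)

Section Minors.
Variable k : fieldType.

Lemma minor_rank a b p (A : 'M[k]_(a, b)) (g : 'I_p -> 'I_a) (h : 'I_p -> 'I_b) :
  \det (mxsub g h A) != 0 -> (p <= \rank A)%N.
Proof.
move=> d; have u : mxsub g h A \in unitmx by rewrite unitmxE unitfE.
rewrite -(mxrank_unit u) mxsubrc; apply: leq_trans (mxrankS (rowsub_sub _ _)) _.
have -> : colsub h A = A *m colsub h 1%:M by rewrite mulmx_colsub mulmx1.
exact: mxrankM_maxl.
Qed.

Lemma rank_minor a b p (A : 'M[k]_(a, b)) : (p <= \rank A)%N ->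
  exists (g : 'I_p -> 'I_a) (h : 'I_p -> 'I_b), \det (mxsub g h A) != 0.
Proof.
move=> pr; pose g := maxrankfun A \o widen_ord pr.
have rX : \rank (rowsub g A) = p.
  rewrite rowsub_comp rowsubE mxrankMfree ?maxrowsub_free //.
  have -> : rowsub (widen_ord pr) 1%:M = pid_mx p :> 'M[k]_(p, _).
    by apply/matrixP => i l; rewrite !mxE -val_eqE /= ltn_ord andbT.
  by rewrite rank_pid_mx.
have full : row_full (rowsub g A)^T by rewrite /row_full mxrank_tr rX.
exists g, (fullrankfun full).
have := fullrowsub_full full; rewrite row_full_unit -unitmx_tr unitmxE unitfE.
congr (\det _ != 0); apply/matrixP => i l; by rewrite !mxE.
Qed.

End Minors.

(** * Normal forms of quadratic forms in all characteristics *)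

Section QuadraticForms.
Variables (k : closedFieldType) (r : nat) (A : 'M[k]_r).
Let S := A + A^T.
Let char2 := 2%N \in [pchar k].

(** The rows of [P] span a subspace on which the polar form [S] is nondegenerate. They are
    orthogonal with value 1 outside characteristic 2, and consecutive hyperbolic pairs with value 0
    in characteristic 2. Entries above the diagonal suffice, [S] being symmetric. *)
Definition quad_normal p (P : 'M[k]_(p, r)) : Prop :=
  [/\ P *m S *m P^T \in unitmx,
      forall i, (P *m A *m P^T) i i = (~~ char2)%:R
    & forall i l : 'I_p, (i < l)%N ->
        (P *m S *m P^T) i l = [&& char2, ~~ odd i & l == i.+1 :> nat]%:R].

Let bil (X : 'M[k]_r) (u v : 'rV[k]_r) := (u *m X *m v^T) 0 0.

Let bilDl X u u' v : bil X (u + u') v = bil X u v + bil X u' v.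
Proof. by rewrite /bil !mulmxDl mxE. Qed.
Let bilDr X u v v' : bil X u (v + v') = bil X u v + bil X u v'.
Proof. by rewrite /bil linearD /= mulmxDr mxE. Qed.
Let bilZl X c u v : bil X (c *: u) v = c * bil X u v.
Proof. by rewrite /bil -!scalemxAl mxE. Qed.
Let bilZr X c u v : bil X u (c *: v) = c * bil X u v.
Proof. by rewrite /bil linearZ /= -scalemxAr mxE. Qed.

Let bilS u v : bil S u v = bil A u v + bil A v u.
Proof.
rewrite /bil /S mulmxDr mulmxDl mxE; congr (_ + _).
by rewrite -[u *m _ *m _]trmxK mxE !trmx_mul !trmxK mulmxA.
Qed.

Let bilSC u v : bil S u v = bil S v u.
Proof. by rewrite !bilS addrC. Qed.

Let S_sym : S^T = S. Proof. by rewrite /S linearD /= trmxK addrC. Qed.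

Let mx11E (X : 'M[k]_1) : X = (X 0 0)%:M. Proof. exact: mx11_scalar. Qed.

(** The hyperbolic pairs start at even indices, so stacking [V] below [P] respects them only when
    [p] is even. *)
Let col_normal p q (P : 'M[k]_(p, r)) (V : 'M[k]_(q, r)) :
  quad_normal P -> quad_normal V -> (char2 -> ~~ odd p) ->
  V *m S *m P^T = 0 -> quad_normal (col_mx P V).
Proof.
move=> [uP dP oP] [uV dV oV] ep VP.
have PV : P *m S *m V^T = 0.
  by apply: trmx_inj; rewrite !trmx_mul trmxK S_sym mulmxA VP trmx0.
have E X : col_mx P V *m X *m (col_mx P V)^T =
    block_mx (P *m X *m P^T) (P *m X *m V^T) (V *m X *m P^T) (V *m X *m V^T).
  by rewrite tr_col_mx mul_col_mx mul_col_row.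
split=> [|i|i l il].
- by rewrite E PV VP unitmxE det_ublock unitrM -!unitmxE uP uV.
- by rewrite E; case: (split_ordP i) => c ->; rewrite ?block_mxEul ?block_mxEdr.
rewrite E PV VP; case: (split_ordP i) il => c ->; case: (split_ordP l) => d -> il.
- by rewrite block_mxEul oP.
- rewrite block_mxEur mxE; case: (boolP char2) => //= c2.
  case: (boolP (odd c)) => //= oc; case: eqP => //= e.
  have := ep c2; have cp := ltn_ord c.
  have -> : p = c.+1 by lia.
  by rewrite /= oc.
- by move: il => /=; have := ltn_ord d; lia.
- rewrite block_mxEdr oV //; last by move: il => /=; lia.
  rewrite /= -addnS eqn_add2l oddD.
  by case: (boolP char2) => //= c2; rewrite (negPf (ep c2)).
Qed.

(** [E] projects onto the orthogonal complement of the rows of [P]. If [S] vanished on that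
    complement, it would factor through [P] and have rank at most [p]. *)
Let project p (P : 'M[k]_(p, r)) : P *m S *m P^T \in unitmx -> (p < \rank S)%N ->
  exists E : 'M[k]_r, E *m S *m P^T = 0 /\ E *m S *m E^T != 0.
Proof.
set G := P *m S *m P^T => uG pS.
pose E := 1%:M - S *m P^T *m invmx G *m P; exists E.
have ESP : E *m S *m P^T = 0.
  rewrite /E !mulmxBl !mul1mx -!mulmxA [P *m _]mulmxA -/G.
  by rewrite mulVmx // mulmx1 subrr.
split=> //; have -> : E *m S *m E^T = E *m S.
  rewrite {2}/E linearB /= trmx1 mulmxBr mulmx1 !trmx_mul trmxK.
  by rewrite !mulmxA ESP !mul0mx subr0.
apply/negP => /eqP; rewrite /E mulmxBl mul1mx => /eqP; rewrite subr_eq0 => /eqP SE.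
move: pS; rewrite SE -!mulmxA ltnNge; apply/negP/negPn.
by rewrite !mulmxA -mulmxA; apply: leq_trans (mxrankM_maxl _ _) (rank_leq_col _).
Qed.

(** The complement of [P] contains [a], [b] with nonzero pairing. Outside characteristic 2, one of
    [a], [b], [a + b] has nonzero value by polarization and is scaled by a square root. In
    characteristic 2, [S] is alternating and a hyperbolic plane is split off instead. *)
Let extend p (P : 'M[k]_(p, r)) : quad_normal P -> (char2 -> ~~ odd p) ->
  (p < \rank S)%N ->
  exists q (V : 'M[k]_(q, r)), [/\ (0 < q)%N, char2 -> ~~ odd q, quad_normal V & V *m S *m P^T = 0].
Proof.
move=> nP ep pS; have [uP _ _] := nP.
have [E [ESP ESE]] := project uP pS.
have [i [l il]] : exists i l, (E *m S *m E^T) i l != 0.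
  apply: contrapT => h; case/eqP: ESE; apply/matrixP => i l; rewrite [RHS]mxE.
  by apply/eqP; apply: contrapT => /negP il; apply: h; exists i, l.
pose a := row i E; pose b := row l E.
have ab : bil S a b = (E *m S *m E^T) i l.
  rewrite /bil /a /b -row_mul [LHS]mxE [RHS]mxE; apply: eq_bigr => j _.
  by rewrite [row i _ _ _]mxE [(row l E)^T _ _]mxE [row l E _ _]mxE [E^T _ _]mxE.
have rowP' (u : 'rV_r) : u *m E *m S *m P^T = 0 by rewrite -!mulmxA [E *m _]mulmxA ESP mulmx0.
have aE : a = row i 1%:M *m E by rewrite -row_mul mul1mx.
have bE : b = row l 1%:M *m E by rewrite -row_mul mul1mx.
have [c2|c2] := boolP char2; last first.
  have two0 : 2%:R != 0 :> k by apply: contraNneq c2 => e; rewrite /char2 inE /= e eqxx.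
  have [u [uE Qu]] : exists u, u *m S *m P^T = 0 /\ bil A u u != 0.
    have [Qa|Qa] := eqVneq (bil A a a) 0; last by exists a; rewrite aE rowP'; split=> //; rewrite -aE.
    have [Qb|Qb] := eqVneq (bil A b b) 0; last by exists b; rewrite bE rowP'; split=> //; rewrite -bE.
    exists (a + b); rewrite !mulmxDl aE bE !rowP' addr0; split=> //.
    by rewrite -aE -bE !bilDl !bilDr Qa Qb add0r addr0 -bilS ab.
  have [c hc] : exists c : k, c ^+ 2 = (bil A u u)^-1.
    have [c] := @solve_monicpoly k 2 (fun i => if i == 0%N then (bil A u u)^-1 else 0) isT.
    by rewrite big_ord_recl big_ord1 /= expr0 mulr1 mul0r addr0 => h; exists c.
  exists 1%N, (c *: u); have Q1 : bil A (c *: u) (c *: u) = 1.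
    by rewrite bilZl bilZr mulrA -expr2 hc mulVf.
  split=> //; last by rewrite -!scalemxAl uE scaler0.
  split=> [|p0|p0 p1]; last by rewrite !ord1.
    rewrite [_ *m _]mx11E -/(bil S _ _) bilS Q1 -mulr2n.
    by rewrite unitmxE det_scalar1 unitfE.
  by rewrite !ord1 -/(bil A _ _) Q1 c2.
have two0 (x : k) : x + x = 0 by rewrite -mulr2n -mulr_natr (pcharf0 c2) mulr0.
have [b' [ab' bP]] : exists b', bil S a b' = 1 /\ b' *m S *m P^T = 0.
  exists ((bil S a b)^-1 *: b); rewrite bilZr mulVf ?ab //; split=> //.
  by rewrite bE -!scalemxAl rowP' scaler0.
have bSb u : bil S u u = 0 by rewrite bilS two0.
pose al := bil A a a; pose be := bil A b' b'.
(* [t] is chosen so that [v1 = a + t b'] has value 0. Subtracting [be] times [v1] from [b'] then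
   cancels the value of [b'] and leaves its pairing with [v1] equal to 1. *)
have [t ht] : exists t : k, al + t + be * t ^+ 2 = 0.
  have [be0|be0] := eqVneq be 0.
    by exists (- al); rewrite be0 mul0r addr0 subrr.
  have [t] := @solve_monicpoly k 2 (fun i => if i == 0%N then - al / be else - be^-1) isT.
  rewrite big_ord_recl big_ord1 /= expr0 mulr1 expr1 => h; exists t.
  by rewrite h; field.
pose v1 := a + t *: b'; pose v2 := b' - be *: v1.
have Q1 : bil A v1 v1 = 0.
  rewrite /v1 !bilDl !bilDr !bilZl !bilZr -/al -/be.
  have -> : 0 = al + t * (bil A a b' + bil A b' a) + be * t ^+ 2.
    by rewrite -bilS ab' mulr1 ht.
  by ring.
have B12 : bil S v1 v2 = 1.
  rewrite /v2 -scaleNr bilDr bilZr bSb mulr0 addr0 /v1 bilDl bilZl bSb mulr0 addr0 ab' //.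
have Q2 : bil A v2 v2 = 0.
  have B1b : bil A v1 b' + bil A b' v1 = 1.
    by rewrite -bilS /v1 bilDl bilZl bSb mulr0 addr0.
  rewrite /v2 -scaleNr !bilDl !bilDr !bilZl !bilZr Q1 -/be.
  have -> : be + - be * bil A b' v1 + (- be * bil A v1 b' + - be * (- be * 0)) =
            be * (1 - (bil A v1 b' + bil A b' v1)) by ring.
  by rewrite B1b subrr mulr0.
have aP : a *m S *m P^T = 0 by rewrite aE rowP'.
have v1P : v1 *m S *m P^T = 0 by rewrite /v1 !mulmxDl -!scalemxAl aP bP scaler0 addr0.
have v2P : v2 *m S *m P^T = 0 by rewrite /v2 !mulmxBl -!scalemxAl v1P bP scaler0 subr0.
exists (1 + 1)%N, (col_mx v1 v2).
have E' X : col_mx v1 v2 *m X *m (col_mx v1 v2)^T =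
    block_mx (bil X v1 v1)%:M (bil X v1 v2)%:M (bil X v2 v1)%:M (bil X v2 v2)%:M.
  by rewrite tr_col_mx mul_col_mx mul_col_row; congr block_mx; rewrite [LHS]mx11E.
split=> //; last by rewrite !mul_col_mx v1P v2P col_mx0.
split=> [|i0|i0 l0].
- rewrite E' !bSb B12 bilSC B12 raddf0.
  suff /mulmx1_unit[] : block_mx 0 1%:M 1%:M 0 *m block_mx 0 1%:M 1%:M 0 = 1%:M :> 'M[k]_(1 + 1) by [].
  by rewrite mulmx_block !mul0mx !mulmx0 mulmx1 !add0r !addr0 -scalar_mx_block.
- rewrite E' Q1 Q2 c2; case: (split_ordP i0) => c ->; rewrite ?block_mxEul ?block_mxEdr !mxE;
    by rewrite !ord1 mul0rn.
rewrite E' B12 c2; case: (split_ordP i0) => c ->; case: (split_ordP l0) => d ->;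
  by rewrite !ord1 //= ?block_mxEur ?mxE.
Qed.

(** The empty family is extended until it has as many rows as the rank. In characteristic 2 each
    extension adds an even number of rows, which is the source of the parity assertion. *)
Theorem quad_normal_exists : exists P : 'M[k]_(\rank S, r),
  quad_normal P /\ (char2 -> ~~ odd (\rank S)).
Proof.
suff H : forall m, m = \rank S -> forall d p (P : 'M[k]_(p, r)),
    quad_normal P -> (char2 -> ~~ odd p) -> (m - p <= d)%N ->
    exists P : 'M[k]_(m, r), quad_normal P /\ (char2 -> ~~ odd m).
  apply: (H _ erefl (\rank S) 0%N 0) => //; last by rewrite subn0.
  split=> [|[]|[]] //.
  by rewrite unitmxE det_mx00 unitr1.
move=> m mE; elim=> [|d IH] p P nP ep mp.
all: have pm : (p <= m)%N.
all: try by have [uP _ _] := nP; rewrite mE -(mxrank_unit uP); apply: leq_trans (mxrankM_maxl _ _) (mxrankM_maxr _ _).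
all: have [pm'|pm'] := eqVneq p m; first by (exists (castmx (pm', erefl) P); subst p; rewrite castmx_id).
  by have := pm'; rewrite eqn_leq pm /=; lia.
have [q [V [q0 eq nV VP]]] : exists q (V : 'M[k]_(q, r)),
    [/\ (0 < q)%N, char2 -> ~~ odd q, quad_normal V & V *m S *m P^T = 0].
  by apply: extend => //; rewrite -mE ltn_neqAle pm'.
apply: (IH _ (col_mx P V)); first exact: col_normal.
  by move=> c2; rewrite oddD (negPf (ep c2)) (negPf (eq c2)).
lia.
Qed.

End QuadraticForms.

(** * Completion *)

Section IdealTheory.
Variable A : comPzRingType.
Implicit Types (S I J : set A) (a b : A).

Lemma ideal_gen_is_ideal S : is_ideal (ideal_gen S).
Proof.
split.
- exists 0%N, (fun=> 0), (fun=> 0); split; first by case.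
  by rewrite big_ord0.
- move=> a b [p [u [g [gS ->]]]] [q [v [h [hS ->]]]].
  exists (p + q)%N, (fun i => match split i with inl i => u i | inr i => v i end),
    (fun i => match split i with inl i => g i | inr i => h i end).
  split; first by move=> i; case: (split i).
  rewrite big_split_ord; congr (_ + _); apply: eq_bigr => i _.
    by case: splitP => l /= il; [congr (_ * _); congr (_ _); apply: val_inj | have := ltn_ord i; rewrite il; lia].
  by case: splitP => l /= il; [have := ltn_ord l; lia | congr (_ * _); congr (_ _); apply: val_inj => /=; lia].
- move=> a b [p [u [g [gS ->]]]]; exists p, (fun i => a * u i), g; split=> //.
  by rewrite mulr_sumr; apply: eq_bigr => i _; rewrite mulrA.
Qed.

Lemma ideal_gen_mem S a : S a -> ideal_gen S a.
Proof.
by exists 1%N, (fun=> 1), (fun=> a); split=> //; rewrite big_ord1 mul1r.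
Qed.

Lemma ideal_sum I (T : Type) (r : seq T) (P : pred T) (F : T -> A) : is_ideal I ->
  (forall i, P i -> I (F i)) -> I (\sum_(i <- r | P i) F i).
Proof. by case=> I0 ID _ h; elim/big_ind: _. Qed.

Lemma ideal_gen_sub S I : is_ideal I -> S `<=` I -> ideal_gen S `<=` I.
Proof.
move=> II SI a [p [u [g [gS ->]]]]; apply: ideal_sum => // i _.
by case: II => _ _; apply; apply: SI.
Qed.

Lemma idealN I a : is_ideal I -> I a -> I (- a).
Proof. by case=> _ _ h ?; rewrite -mulN1r; apply: h. Qed.

Lemma ideal_powS I d a b : I a -> ideal_pow I d b -> ideal_pow I d.+1 (a * b).
Proof.
move=> Ia [p [u [g [gS ->]]]]; exists p, u, (fun i => a * g i); split.
  move=> i; have [f [fI ->]] := gS i.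
  exists (fun l : 'I_d.+1 => if unlift ord0 l is Some l' then f l' else a); split.
    by move=> l; case: unliftP => [l' _|_].
  rewrite big_ord_recl unlift_none; congr (_ * _); apply: eq_bigr => l _.
  by rewrite liftK.
by rewrite mulr_sumr; apply: eq_bigr => i _; rewrite mulrCA.
Qed.

Lemma ideal_pow_sub I J d : is_ideal J ->
  (forall a b, I a -> ideal_pow I d b -> J (a * b)) -> ideal_pow I d.+1 `<=` J.
Proof.
move=> JJ h; apply: ideal_gen_sub => // _ [f [fI ->]].
rewrite big_ord_recl; apply: h => //; apply: ideal_gen_mem.
by exists (fun i => f (lift ord0 i)).
Qed.

Lemma ideal_pow0 I a : ideal_pow I 0 a.
Proof.
rewrite -[a]mulr1; have [_ _] := ideal_gen_is_ideal [set a | exists f : 'I_0 -> A, (forall i, I (f i)) /\ a = \prod_i f i].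
apply; apply: ideal_gen_mem; exists (fun=> 0); split; [by case|by rewrite big_ord0].
Qed.

Lemma ideal_powW I d : is_ideal I -> ideal_pow I d.+1 `<=` ideal_pow I d.
Proof.
move=> II; have PI d' := ideal_gen_is_ideal [set a | exists f : 'I_d' -> A, (forall i, I (f i)) /\ a = \prod_i f i].
apply: ideal_pow_sub; first exact: PI.
by move=> a b _ hb; have [_ _] := PI d; apply.
Qed.

End IdealTheory.

Lemma ideal_pow_is_ideal (A : comPzRingType) (I : set A) d : is_ideal (ideal_pow I d).
Proof. exact: ideal_gen_is_ideal. Qed.

(* [T] need not be the localization itself: it suffices that the denominators
   become units there. *)
Lemma localization_lift (A S T : comPzRingType) (rho : {rmorphism A -> S})
    (theta : {rmorphism A -> T}) :
  (forall z, exists p q, rho q * z = rho p /\ is_unit (theta q)) ->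
  (forall p, rho p = 0 -> theta p = 0) ->
  exists c : {rmorphism S -> T}, forall p, c (rho p) = theta p.
Proof.
move=> den ker.
have eqv p q : rho p = rho q -> theta p = theta q.
  move=> e; apply/eqP; rewrite -subr_eq0 -rmorphB; apply/eqP; apply: ker.
  by rewrite rmorphB e subrr.
have ex z : exists t, forall p q, rho q * z = rho p -> theta q * t = theta p.
  have [p [q [e [u qu]]]] := den z; exists (u * theta p) => p' q' e'.
  have : theta (p * q') = theta (p' * q) by apply: eqv; rewrite !rmorphM -e -e'; ring.
  rewrite !rmorphM => h.
  have -> : theta q' * (u * theta p) = u * (theta p * theta q') by ring.
  by rewrite h mulrCA [u * _]mulrC qu mulr1.
have [c cE] := choice ex.
have inj q t t' : is_unit (theta q) -> theta q * t = theta q * t' -> t = t'.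
  by move=> [u qu] /(congr1 (fun x => u * x)); rewrite !mulrA [u * _]mulrC qu !mul1r.
have unitM (a b : T) : is_unit a -> is_unit b -> is_unit (a * b).
  by move=> [u au] [v bv]; exists (u * v); rewrite mulrACA au bv mulr1.
have cB : zmod_morphism c.
  move=> z z'; have [p [q [e uq]]] := den z; have [p' [q' [e' uq']]] := den z'.
  apply: (inj (q * q')); first by rewrite rmorphM; apply: unitM.
  rewrite (cE _ (p * q' - p' * q)); last by rewrite !rmorphB !rmorphM -e -e'; ring.
  by rewrite rmorphB !rmorphM -(cE _ _ _ e) -(cE _ _ _ e'); ring.
have cM : monoid_morphism c.
  split=> [|z z'].
    by have := cE 1 1 1; rewrite !rmorph1 !mul1r; apply.
  have [p [q [e uq]]] := den z; have [p' [q' [e' uq']]] := den z'.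
  apply: (inj (q * q')); first by rewrite rmorphM; apply: unitM.
  rewrite (cE _ (p * p')); last by rewrite !rmorphM -e -e'; ring.
  by rewrite !rmorphM -(cE _ _ _ e) -(cE _ _ _ e'); ring.
pose C : {rmorphism S -> T} :=
  HB.pack c (GRing.isZmodMorphism.Build _ _ c cB) (GRing.isMonoidMorphism.Build _ _ c cM).
exists C.
by move=> p; have := cE (rho p) p 1; rewrite !rmorph1 !mul1r; apply.
Qed.

(* First-order Taylor expansion around [xi], with remainder in an ideal [K]
   containing [I * J]. *)
Lemma mpoly_taylor (k : fieldType) N (S : comPzRingType) (xi : 'I_N -> k)
    (kap : {rmorphism k -> S}) (rho rho' : {rmorphism mpoly N k -> S}) (I J K : set S) :
  is_ideal I -> is_ideal J -> is_ideal K -> (forall a b, I a -> J b -> K (a * b)) ->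
  (forall c, rho (mpolyC N c) = kap c) -> (forall c, rho' (mpolyC N c) = kap c) ->
  (forall i, I (rho (mpolyX k (mnm1 i)) - kap (xi i))) ->
  (forall i, I (rho' (mpolyX k (mnm1 i)) - kap (xi i))) ->
  (forall i, J (rho (mpolyX k (mnm1 i)) - rho' (mpolyX k (mnm1 i)))) ->
  forall p, K (rho p - rho' p - \sum_i kap (meval xi (mderiv i p)) *
                 (rho (mpolyX k (mnm1 i)) - rho' (mpolyX k (mnm1 i)))).
Proof.
move=> II JJ KK IJK rC rC' rI rI' rJ.
pose D i := rho (mpolyX k (mnm1 i)) - rho' (mpolyX k (mnm1 i)).
pose L p := \sum_i kap (meval xi (mderiv i p)) * D i.
(* The remainder estimate alone is not multiplicative. In a product, the leftover terms pair a
   difference in [I] with a linear part in [J], so the congruences modulo [I] are carried along. *)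
pose C p := [/\ I (rho p - kap (meval xi p)), I (rho' p - kap (meval xi p)),
                J (rho p - rho' p) & K (rho p - rho' p - L p)].
suff CC : forall p, C p by move=> p; case: (CC p).
have I0 : I 0 by case: II. have J0 : J 0 by case: JJ. have K0 : K 0 by case: KK.
have IM a b : I b -> I (a * b) by case: II => _ _; apply.
have JM a b : J b -> J (a * b) by case: JJ => _ _; apply.
have KM a b : K b -> K (a * b) by case: KK => _ _; apply.
have ID a b : I a -> I b -> I (a + b) by case: II => _ + _; apply.
have JD a b : J a -> J b -> J (a + b) by case: JJ => _ + _; apply.
have KD a b : K a -> K b -> K (a + b) by case: KK => _ + _; apply.
have C_C c : C (mpolyC N c).
  rewrite /C rC rC' mevalC subrr; split=> //; rewrite sub0r; apply: idealN => //.
  by rewrite /L big1 // => i _; rewrite mderivC meval0 rmorph0 mul0r.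
have LD p q : L (p + q) = L p + L q.
  rewrite /L -big_split; apply: eq_bigr => i _ /=.
  by rewrite mderivD mevalD rmorphD mulrDl.
have LM p q : L (p * q) = kap (meval xi q) * L p + kap (meval xi p) * L q.
  rewrite /L !mulr_sumr -big_split; apply: eq_bigr => i _ /=.
  by rewrite mderivM mevalD !mevalM rmorphD !rmorphM /=; ring.
have LJ p : J (L p) by apply: ideal_sum => // i _; apply: JM; apply: rJ.
have CD p q : C p -> C q -> C (p + q).
  move=> [a b c d] [a' b' c' d']; split.
  - rewrite mevalD !rmorphD /= (_ : _ - _ = (rho p - kap (meval xi p)) + (rho q - kap (meval xi q))); [exact: ID | ring].
  - rewrite mevalD !rmorphD /= (_ : _ - _ = (rho' p - kap (meval xi p)) + (rho' q - kap (meval xi q))); [exact: ID | ring].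
  - rewrite !rmorphD (_ : _ - _ = (rho p - rho' p) + (rho q - rho' q)); [exact: JD | ring].
  rewrite LD !rmorphD (_ : _ - _ - _ = (rho p - rho' p - L p) + (rho q - rho' q - L q)); [exact: KD | ring].
have CM p q : C p -> C q -> C (p * q).
  move=> [a b c d] [a' b' c' d']; split.
  - rewrite mevalM !rmorphM /= (_ : _ - _ = rho q * (rho p - kap (meval xi p)) +
      kap (meval xi p) * (rho q - kap (meval xi q))); [by apply: ID; apply: (IM) | ring].
  - rewrite mevalM !rmorphM /= (_ : _ - _ = rho' q * (rho' p - kap (meval xi p)) +
      kap (meval xi p) * (rho' q - kap (meval xi q))); [by apply: ID; apply: (IM) | ring].
  - rewrite !rmorphM (_ : _ - _ = rho q * (rho p - rho' p) + rho' p * (rho q - rho' q)); [by apply: JD; apply: (JM) | ring].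
  rewrite LM !rmorphM.
  have -> : rho p * rho q - rho' p * rho' q - (kap (meval xi q) * L p + kap (meval xi p) * L q) =
    (rho q * (rho p - rho' p - L p) + (rho q - kap (meval xi q)) * L p) +
    (rho' p * (rho q - rho' q - L q) + (rho' p - kap (meval xi p)) * L q) by ring.
  apply: (KD); apply: (KD).
  - exact: KM.
  - exact: IJK.
  - exact: KM.
  - exact: IJK.
have C_X i : C (mpolyX k (mnm1 i)).
  rewrite /C mevalXU; split=> //.
  rewrite /L (bigD1 i) //= big1 => [|l li]; last first.
    by rewrite mderivX mnm1E eq_sym (negPf li) scale0r meval0 rmorph0 mul0r.
  rewrite mderivX mnm1E eqxx scale1r (_ : mnm_sub _ _ = mnm0).
    by rewrite mpolyX0 meval1 rmorph1 mul1r addr0 subrr.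
  by apply/mnmP => l; rewrite mnmBE subnn mnm0E.
move=> p; elim/mpolyind: p => [|c m p _ _ Cp]; first by rewrite -mpolyC0.
apply: CD Cp; rewrite -mul_mpolyC; apply: (CM) => //.
rewrite (mpolyXE_id k m); elim/big_ind: _ => [||i _]; [by rewrite -mpolyC1 | exact: (CM) |].
by elim: (m i) => [|d IH]; [rewrite expr0 -mpolyC1 | rewrite exprS; apply: (CM)].
Qed.

Lemma ord_ge_is_ideal n (R : comNzRingType) w d : is_ideal (@ord_ge n R w d).
Proof. by split; [exact: ord_ge0 | exact: ord_geD | move=> *; exact: ord_geMl]. Qed.

Lemma ideal_powM (A : comPzRingType) (I : set A) d e a b :
  ideal_pow I d a -> ideal_pow I e b -> ideal_pow I (d + e) (a * b).
Proof.
elim: d a b => [|d IH] a b ha hb.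
  by have [_ _] := ideal_pow_is_ideal I e; apply.
move: a ha; apply: (ideal_pow_sub (J := [set a | ideal_pow I (d.+1 + e) (a * b)])).
  have [P0 PD PM] := ideal_pow_is_ideal I (d.+1 + e); split=> /=.
  - by rewrite mul0r.
  - by move=> x y hx hy; rewrite mulrDl; apply: PD.
  - by move=> x y hy; rewrite -mulrA; apply: PM.
by move=> x y Ix Iy /=; rewrite -mulrA addSn; apply: ideal_powS => //; apply: IH.
Qed.

Section Completion.
Variables (A : comNzRingType) (k : fieldType) (n : nat).
Variables (kap : {rmorphism k -> A}) (c : {rmorphism A -> fps n k}) (xs : 'I_n -> A).
Local Notation w1 := (@unit_weight n).
Local Notation I := (nonunits A).

Hypothesis c_kap : forall a, c (kap a) = fps_const n a.
Hypothesis c_xs : forall i, c (xs i) = fps_var k i.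
Hypothesis c_local : forall a, I a <-> fps0 (c a) = 0.
Hypothesis c_cotangent : forall a, ord_ge w1 2 (c a) -> ideal_pow I 2 a.

Let J d := ideal_gen (c @` ideal_pow I d).

Let I_ideal : is_ideal I.
Proof.
split=> [|a b|a b].
- by apply/c_local; rewrite rmorph0.
- by move=> /c_local ca /c_local cb; apply/c_local; rewrite rmorphD fps0D ca cb addr0.
- by move=> /c_local cb; apply/c_local; rewrite rmorphM fps0M cb mulr0.
Qed.

Let xs_I i : I (xs i). Proof. by apply/c_local; rewrite c_xs fps0_var. Qed.

Let c_pow d a : ideal_pow I d a -> ord_ge w1 d (c a).
Proof.
elim: d a => [//|d IH] a.
apply: (ideal_pow_sub (J := [set a | ord_ge w1 d.+1 (c a)])).
  have [P0 PD PM] := @ord_ge_is_ideal n k w1 d.+1; split=> /= [|x y|x y].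
  - by rewrite rmorph0.
  - by rewrite rmorphD; apply: PD.
  - by rewrite rmorphM; apply: PM.
move=> x y Ix Iy /=; rewrite rmorphM -add1n; apply: ord_geM; last exact: IH.
by apply/ord_ge1 => //; apply/c_local.
Qed.

Let J_var d i b : J d b -> J d.+1 (fps_var k i * b).
Proof.
have [P0 PD PM] := ideal_gen_is_ideal (c @` ideal_pow I d.+1).
move: b; apply: (ideal_gen_sub (I := [set b | J d.+1 (fps_var k i * b)])).
  split=> /= [|x y hx hy|x y hy].
  - by rewrite mulr0.
  - by rewrite mulrDr; apply: PD.
  - by rewrite mulrCA; apply: PM.
move=> _ [a Ia <-] /=; rewrite -c_xs -rmorphM; apply: ideal_gen_mem.
by exists (xs i * a) => //; apply: ideal_powS.
Qed.

(** The variables are images of elements of [I], so dividing a series of order [d] successively by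
    variables writes it in terms of the image of [I ^ d]. *)
Let JE d b : J d b <-> ord_ge w1 d b.
Proof.
split.
  apply: ideal_gen_sub; first exact: ord_ge_is_ideal.
  by move=> _ [a Ia <-]; apply: c_pow.
elim: d b => [|d IH] b hb.
  have [P0 PD PM] := ideal_gen_is_ideal (c @` ideal_pow I 0).
  rewrite -[b]mulr1; apply: PM; apply: ideal_gen_mem; exists 1; last exact: rmorph1.
  exact: ideal_pow0.
have J_ideal := ideal_gen_is_ideal (c @` ideal_pow I d.+1).
rewrite (fps_quo_rem predT b); case: (J_ideal) => _ PD _; apply: PD.
  have -> : fps_rem predT b = 0; last by case: J_ideal.
  apply: fpsP => m; rewrite fcoef_rem; case: ifP => // /forallP m0.
  apply: hb; rewrite (_ : m = mnm0) ?wdeg0 //.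
  by apply/mnmP => i; rewrite mnm0E; apply/eqP/m0.
apply: ideal_sum => // i _; apply: J_var; apply: IH.
by apply: fps_quo_ord; rewrite addn1.
Qed.

Let ev : {rmorphism mpoly n k -> A} := mmap kap xs.

Let c_ev Q : c (ev Q) = fps_poly Q.
Proof.
pose F : {rmorphism mpoly n k -> fps n k} := c \o ev.
apply: (@mpoly_rmorph_ext _ _ _ F (@fps_poly n k)) => [a|i] /=.
  by rewrite mmapC c_kap fps_polyC.
by rewrite mmapX mmap1U c_xs fps_polyX.
Qed.

Let Xs : set A := [set a | exists u : 'I_n -> A, a = \sum_i u i * xs i].

Let Xs_ideal : is_ideal Xs.
Proof.
split.
- by exists (fun=> 0); rewrite big1 // => i _; rewrite mul0r.
- move=> _ _ [u ->] [v ->]; exists (fun i => u i + v i).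
  by rewrite -big_split; apply: eq_bigr => i _; rewrite mulrDl.
- move=> a _ [u ->]; exists (fun i => a * u i).
  by rewrite mulr_sumr; apply: eq_bigr => i _; rewrite mulrA.
Qed.

Let pow1 a : ideal_pow I 1 a <-> I a.
Proof.
split=> [|Ia]; last by rewrite -[a]mulr1; apply: ideal_powS => //; apply: ideal_pow0.
by move=> /c_pow h; apply/c_local/(@ord_ge1 _ _ w1).
Qed.

Let pow_Xs d a : ideal_pow I d.+1 a -> exists2 x, Xs x & ideal_pow I d.+2 (a - x).
Proof.
elim: d a => [|d IH] a.
  move=> /pow1 /c_local ca; pose x := \sum_l kap (fcoef (c a) (mnm1 l)) * xs l.
  exists x; first by exists (fun l => kap (fcoef (c a) (mnm1 l))).
  apply: c_cotangent; rewrite rmorphB rmorph_sum.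
  under eq_bigr do rewrite rmorphM c_kap c_xs.
  exact: fps_lin_approx.
have PI := ideal_pow_is_ideal I d.+3; have [P0 PD PM] := PI.
have [X0 XD XM] := Xs_ideal.
apply: (ideal_pow_sub (J := [set a | exists2 x, Xs x & ideal_pow I d.+3 (a - x)])).
  split=> /=.
  - by exists 0; rewrite ?subrr.
  - move=> y z [u Xu hu] [v Xv hv]; exists (u + v); first exact: XD.
    by rewrite opprD addrACA; apply: PD.
  - move=> y z [v Xv hv]; exists (y * v); first exact: XM.
    by rewrite -mulrBr; apply: PM.
move=> y z Iy /IH[x Xx hx] /=; exists (y * x); first exact: XM.
by rewrite -mulrBr; apply: ideal_powS.
Qed.

(** Replaces the conclusion of Nakayama's lemma, that the [xs] generate [I], by a congruence modulo
    each power of [I]; no finiteness is involved. *)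
Let I_Xs d a : I a -> exists2 x, Xs x & ideal_pow I d.+1 (a - x).
Proof.
move=> Ia; have [X0 XD XM] := Xs_ideal.
elim: d => [|d [x Xx hx]]; first by exists 0 => //; rewrite subr0; apply/pow1.
have [y Xy hy] := pow_Xs hx; exists (x + y); first exact: XD.
by rewrite opprD addrA.
Qed.

Let approx d a : exists Q, ideal_pow I d (a - ev Q).
Proof.
elim: d a => [|d IH] a; first by exists 0; apply: ideal_pow0.
have Ia : I (a - kap (fps0 (c a))).
  by apply/c_local; rewrite rmorphB c_kap fps0B fps0_const subrr.
have [_ [u ->] hu] := I_Xs d Ia.
have [Q hQ] := choice (fun i => IH (u i)).
exists (mpolyC n (fps0 (c a)) + \sum_i Q i * mpolyX k (mnm1 i)).
rewrite rmorphD rmorph_sum /= mmapC.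
under eq_bigr do rewrite rmorphM /= mmapX mmap1U.
have -> : a - (kap (fps0 (c a)) + \sum_i mmap kap xs (Q i) * xs i) =
   (a - kap (fps0 (c a)) - \sum_i u i * xs i) + \sum_i xs i * (u i - ev (Q i)).
  have -> : \sum_i xs i * (u i - ev (Q i)) = \sum_i u i * xs i - \sum_i ev (Q i) * xs i.
    by rewrite -sumrB; apply: eq_bigr => i _; ring.
  by rewrite /=; ring.
have PI := ideal_pow_is_ideal I d.+1; have [P0 PD PM] := PI.
by apply: PD => //; apply: ideal_sum => // i _; apply: ideal_powS.
Qed.

Let mmap1_pow m : ideal_pow I (mdeg m) (mmap1 xs m).
Proof.
rewrite mdegE /mmap1; elim/big_ind2: _ => [|*|i _]; [exact: ideal_pow0|exact: ideal_powM|].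
elim: (m i) => [|d IH]; first exact: ideal_pow0.
by rewrite exprS; apply: ideal_powS.
Qed.

Let pow_le d e a : (d <= e)%N -> ideal_pow I e a -> ideal_pow I d a.
Proof.
move=> de; rewrite -(subnKC de); elim: (e - d)%N a => [|f IH] a; first by rewrite addn0.
by rewrite addnS => /(ideal_powW I_ideal) /IH.
Qed.

(** The point is that [c a] of order [d] forces [a] into [I ^ d]. Modulo [I ^ d], [a] is a
    polynomial in the [xs], and [c] carries this polynomial to itself as a series, so its terms of
    degree below [d] vanish. *)
Theorem fps_is_completion : is_adic_completion I c.
Proof.
split.
- move=> d b; exists (ev (fps_trunc d b)); apply/JE; rewrite c_ev.
  exact: fps_trunc_ord.
- move=> d a /JE ca; have [Q hQ] := approx d a.
  have Qd m : (mdeg m < d)%N -> mcoeff m Q = 0.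
    move=> md; have := c_pow hQ; rewrite rmorphB c_ev => h.
    have := h m; rewrite wdeg_unit fcoefB fcoef_poly ca ?wdeg_unit // sub0r.
    by move=> /(_ md)/eqP; rewrite oppr_eq0 => /eqP.
  have PI := ideal_pow_is_ideal I d; have [P0 PD PM] := PI.
  rewrite -(subrK (ev Q) a); apply: PD => //; rewrite /= /mmap.
  apply: ideal_sum => // m _; have [/Qd ->|dm] := ltnP (mdeg m) d.
    by rewrite rmorph0 mul0r.
  by apply: PM; apply: pow_le dm _; apply: mmap1_pow.
- move=> b hb; have step d : ord_ge w1 d (b d.+1 - b d) by apply/JE; apply: hb.
  have cauchy d e : ord_ge w1 d (b (d + e)%N - b d).
    elim: e => [|e IH]; first by rewrite addn0 subrr; apply: ord_ge0.
    rewrite addnS -(subrK (b (d + e)%N) (b (d + e).+1)) -addrA.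
    by apply: ord_geD IH; apply: (ord_geW _ (step _)); rewrite leq_addr.
  pose l : fps n k := Fps (fun m => fcoef (b (mdeg m).+1) m).
  have lim d : ord_ge w1 d (l - b d).
    move=> m md; rewrite fcoefB /=; apply/eqP; rewrite subr_eq0 eq_sym -subr_eq0 -fcoefB.
    apply/eqP; rewrite wdeg_unit in md; rewrite -(subnKC md).
    by apply: cauchy; rewrite wdeg_unit.
  exists l; split=> [d|l' hl']; first exact/JE.
  apply: (@ord_ge_eq _ _ w1) => d.
  have -> : l - l' = (l - b d) - (l' - b d) by ring.
  by apply: ord_geB => //; apply/JE; apply: hl'.
Qed.

End Completion.

(** A stalk is not known in advance to be a nonzero ring; the morphism to a ring of power series
    forces [1 != 0]. *)
Lemma fps_is_completion_pz (A : comPzRingType) (k : fieldType) n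
    (kap : {rmorphism k -> A}) (c : {rmorphism A -> fps n k}) (xs : 'I_n -> A) :
  (forall a, c (kap a) = fps_const n a) -> (forall i, c (xs i) = fps_var k i) ->
  (forall a, nonunits A a <-> fps0 (c a) = 0) ->
  (forall a, ord_ge (@unit_weight n) 2 (c a) -> ideal_pow (nonunits A) 2 a) ->
  is_adic_completion (nonunits A) c.
Proof.
have A1 : (1 : A) != 0.
  by apply/eqP => /(congr1 c) /eqP; rewrite rmorph1 rmorph0 oner_eq0.
pose A' : comNzRingType := HB.pack (A : Type) (GRing.PzSemiRing_isNonZero.Build A A1) (GRing.ComPzRing.class A).
exact: (@fps_is_completion A' k n kap c xs).
Qed.

(** * Skyscraper sheaves *)

Lemma germ_resE (k : fieldType) (X : ringed_space k) (x : X) (U V : opens X)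
    (Ux : U x) (Vx : V x) (h : V `<=` U) (f : sec U) :
  germ Vx (res h f) = germ Ux f.
Proof. exact: germ_res. Qed.

Section Skyscraper.
Variables (k : fieldType) (X : ringed_space k) (x : X) (B : comPzRingType).
Variable c : {rmorphism stalk x -> B}.

(* The skyscraper sheaf at [x] with stalk [B]: a section over [V] is an element
   of [B] if [x] lies in [V], and there is just one otherwise. *)
Definition sky_sec of {rmorphism stalk x -> B} := fun V : opens X => V x -> B.
Local Notation sky := (sky_sec c).

HB.instance Definition _ V := gen_eqMixin (sky V).
HB.instance Definition _ V := gen_choiceMixin (sky V).

Section SkyModule.
Variable V : opens X.
Implicit Types s t : sky V.

Definition sky_zero : sky V := fun=> 0.
Definition sky_opp s : sky V := fun Vx => - s Vx.
Definition sky_add s t : sky V := fun Vx => s Vx + t Vx.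
Definition sky_scale (f : sec V) s : sky V := fun Vx => c (germ Vx f) * s Vx.

Fact sky_addA : associative sky_add.
Proof. by move=> s t u; apply/funext => Vx; rewrite /sky_add addrA. Qed.
Fact sky_addC : commutative sky_add.
Proof. by move=> s t; apply/funext => Vx; rewrite /sky_add addrC. Qed.
Fact sky_add0 : left_id sky_zero sky_add.
Proof. by move=> s; apply/funext => Vx; rewrite /sky_add add0r. Qed.
Fact sky_addN : left_inverse sky_zero sky_opp sky_add.
Proof. by move=> s; apply/funext => Vx; rewrite /sky_add addNr. Qed.
HB.instance Definition _ :=
  GRing.isZmodule.Build (sky V) sky_addA sky_addC sky_add0 sky_addN.

Fact sky_scaleA f g s : sky_scale f (sky_scale g s) = sky_scale (f * g) s.
Proof. by apply/funext => Vx; rewrite /sky_scale !rmorphM mulrA. Qed.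
Fact sky_scale1 : left_id 1 sky_scale.
Proof. by move=> s; apply/funext => Vx; rewrite /sky_scale !rmorph1 mul1r. Qed.
Fact sky_scaleDr : right_distributive sky_scale +%R.
Proof. by move=> f s t; apply/funext => Vx; apply: mulrDr. Qed.
Fact sky_scaleDl s : {morph sky_scale^~ s : f g / f + g}.
Proof. by move=> f g; apply/funext => Vx; rewrite /sky_scale !rmorphD mulrDl. Qed.
HB.instance Definition _ := GRing.Zmodule_isLmodule.Build (sec V) (sky V)
  sky_scaleA sky_scale1 sky_scaleDr sky_scaleDl.
End SkyModule.

Definition sky_lmod (V : opens X) : lmodType (sec V) := sky V.

Definition sky_res (U V : opens X) (h : V `<=` U) (s : sky_lmod U) : sky_lmod V :=
  fun Vx => s (h x Vx).

Fact sky_resD (U V : opens X) (h : V `<=` U) (s t : sky_lmod U) :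
  sky_res h (s + t) = sky_res h s + sky_res h t.
Proof. by []. Qed.

Fact sky_resZ (U V : opens X) (h : V `<=` U) (f : sec U) (s : sky_lmod U) :
  sky_res h (f *: s) = res h f *: sky_res h s.
Proof.
apply/funext => Vx; rewrite /sky_res.
rewrite -[LHS]/(c (germ (h x Vx) f) * s (h x Vx)) -[RHS]/(c (germ Vx (res h f)) * s (h x Vx)).
by rewrite (germ_resE (h x Vx)).
Qed.

Fact sky_sheaf : @is_sheaf X sky_lmod sky_res.
Proof.
split=> [U h s|U V W hUV hVW hUW s|U J V hV cov t tt].
- by apply/funext => Ux; congr s; apply: Prop_irrelevance.
- by apply/funext => Wx; rewrite /sky_res; congr s; apply: Prop_irrelevance.
have ex (Ux : U x) : exists j, V j x by have [j _ Vj] := cov x Ux; exists j.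
pose s : sky_lmod U := fun Ux => t _ (projT2 (cid (ex Ux))).
have sE j : sky_res (hV j) s = t j.
  apply/funext => Vx; rewrite /sky_res /s; case: cid => l Vl /=.
  pose W := opensI (V l) (V j).
  have hl : W `<=` V l by move=> y [].
  have hj : W `<=` V j by move=> y [].
  have Wx : W x by split.
  have := congr1 (fun u => u Wx) (tt l j W hl hj); rewrite /sky_res.
  rewrite (Prop_irrelevance (hl x Wx) Vl) (Prop_irrelevance (hj x Wx) Vx) => <-; congr (t l _); apply: Prop_irrelevance.
exists s; split=> // s' s'E; apply/funext => Ux.
have [j Vj] := ex Ux.
have := congr1 (fun u => u Vj) (etrans (sE j) (esym (s'E j))); rewrite /sky_res.
by rewrite (Prop_irrelevance (hV j x Vj) Ux).
Qed.

Definition skyscraper : modsheaf X := Modsheaf sky_resD sky_resZ sky_sheaf.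

(** A morphism from [M] to the skyscraper sheaf, unbundled: a map from the stalk of [M] at [x] to
    [B], semilinear over [c], described on sections so that stalks of modules need not be formed. *)
Definition is_fiber_map (M : modsheaf X)
    (phi : forall V : opens X, V x -> msec M V -> B) : Prop :=
  [/\ forall (V : opens X) (Vx : V x) s t, phi V Vx (s + t) = phi V Vx s + phi V Vx t,
      forall (V : opens X) (Vx : V x) f s, phi V Vx (f *: s) = c (germ Vx f) * phi V Vx s
    & forall (U V : opens X) (i : V `<=` U) (Ux : U x) (Vx : V x) s,
        phi V Vx (mres i s) = phi U Ux s].

Lemma fiber_map_sum (M : modsheaf X) (phi : forall V : opens X, V x -> msec M V -> B)
    (V : opens X) (Vx : V x) (I : Type) (r : seq I) (P : pred I) (F : I -> msec M V) :
  is_fiber_map phi -> phi V Vx (\sum_(i <- r | P i) F i) = \sum_(i <- r | P i) phi V Vx (F i).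
Proof.
case=> pD _ _; elim/big_rec2: _ => [|i y1 y2 _ <-]; last exact: pD.
have := pD V Vx 0 0; rewrite addr0 => /eqP.
by rewrite -subr_eq0 opprD addrA subrr sub0r oppr_eq0 => /eqP.
Qed.

Lemma hom_fiber_map (M : modsheaf X) (h : forall U : opens X, msec M U -> msec skyscraper U) :
  is_mod_hom h -> is_fiber_map (fun V Vx s => h V s Vx).
Proof.
case=> hD hZ hr; split=> [V Vx s t|V Vx f s|U V i Ux Vx s].
- by rewrite hD.
- by rewrite hZ.
- by rewrite hr -[LHS]/(h U s (i x Vx)) (Prop_irrelevance (i x Vx) Ux).
Qed.

(** The universal property of [Omega] only tests against sheaves of modules. Composed with germs and
    [c], [delta] becomes a derivation into the skyscraper sheaf and so factors through [diff]. *)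
Lemma deriv_fiber_map (Om : differentials X) (delta : B -> B) :
  (forall a b, delta (a + b) = delta a + delta b) ->
  (forall a b, delta (a * b) = a * delta b + b * delta a) ->
  (forall (U : opens X) (Ux : U x) a, delta (c (germ Ux (const U a))) = 0) ->
  exists phi, @is_fiber_map Om phi /\
    forall (V : opens X) (Vx : V x) f, phi V Vx (diff Om f) = delta (c (germ Vx f)).
Proof.
move=> dD dM dC.
pose D (U : opens X) (f : sec U) : msec skyscraper U := fun Ux : U x => delta (c (germ Ux f)).
have hD : is_derivation D.
  split=> [U f g|U f g|U a|U V i f]; apply/funext => Ux.
  - by rewrite /D !rmorphD dD.
  - by rewrite /D !rmorphM dM.
  - by rewrite /D dC.
  - by rewrite /D (germ_resE (i x Ux)).
have [h [hh hd _]] := diff_universal Om hD.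
exists (fun V Vx s => h V s Vx); split; first exact: hom_fiber_map.
by move=> V Vx f; rewrite hd.
Qed.

Lemma tensor_fiber_map (M N : modsheaf X) (T : tensor_product M N) phi psi :
  @is_fiber_map M phi -> @is_fiber_map N psi ->
  exists chi, @is_fiber_map T chi /\
    forall (V : opens X) (Vx : V x) s t, chi V Vx (tens T s t) = phi V Vx s * psi V Vx t.
Proof.
case=> pD pZ pr [qD qZ qr].
pose b (U : opens X) (s : msec M U) (t : msec N U) : msec skyscraper U :=
  fun Ux : U x => phi U Ux s * psi U Ux t.
have hb : is_bilinear b.
  split=> [U s s' t|U s t t'|U f s t|U f s t|U V i s t]; apply/funext => Ux; rewrite /b.
  - by rewrite pD mulrDl.
  - by rewrite qD mulrDr.
  - by rewrite pZ -mulrA.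
  - by rewrite qZ mulrCA.
  - by rewrite (pr U V i (i x Ux)) (qr U V i (i x Ux)).
have [h [hh ht _]] := tens_universal T hb.
exists (fun V Vx s => h V s Vx); split; first exact: hom_fiber_map.
by move=> V Vx s t; rewrite ht.
Qed.

(** The [l]-th coordinate in the basis [v], computed on [V] cut down to [U], since [v] lives on [U]
    and [phi] has to be given on every neighborhood of [x]. *)
Lemma basis_fiber_map (M : modsheaf X) (U : opens X) (Ux : U x) r (v : 'I_r -> msec M U) (l : 'I_r) :
  is_basis v -> exists phi, @is_fiber_map M phi /\ forall i, phi U Ux (v i) = (i == l)%:R.
Proof.
move=> hv.
pose W (V : opens X) := opensI V U.
have W1 V : W V `<=` V by move=> y [].
have W2 V : W V `<=` U by move=> y [].
have ex V (s : msec M V) := hv (W V) (@W2 V) (mres (@W1 V) s).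
pose cc V s := projT1 (cid (ex V s)).
have ccE V s : mres (@W1 V) s = \sum_i cc V s i *: mres (@W2 V) (v i).
  by rewrite /cc; case: cid => u [].
have Wx (V : opens X) : V x -> W V x by move=> Vx; split.
pose phi (V : opens X) (Vx : V x) (s : msec M V) : B := c (germ (Wx V Vx) (cc V s l)).
have mres_sum (V V' : opens X) (h : V' `<=` V) (u : 'I_r -> sec V) (h1 : V `<=` U) (h2 : V' `<=` U) :
    mres h (\sum_i u i *: mres h1 (v i)) = \sum_i res h (u i) *: mres h2 (v i).
  have mres0 : mres h 0 = 0 :> msec M V'.
    by apply: (addrI (mres h 0)); rewrite -mresD !addr0.
  rewrite (big_morph (mres h) (@mresD _ _ M _ _ h) mres0); apply: eq_bigr => i _.
  rewrite mresZ; congr (_ *: _).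
  by have [_ mr _] := mres_sheaf M; apply: mr.
(* By uniqueness of coordinates, the value may be computed on any smaller neighborhood. Additivity,
   linearity and compatibility with restriction all follow from this. *)
have phiE (V V' : opens X) (Vx : V x) (V'x : V' x) (h1 : V' `<=` V) (h2 : V' `<=` U) s u :
    mres h1 s = \sum_i u i *: mres h2 (v i) -> phi V Vx s = c (germ V'x (u l)).
  move=> e; pose Y := opensI V' (W V).
  have Y1 : Y `<=` V' by move=> y [].
  have Y2 : Y `<=` W V by move=> y [].
  have Y3 : Y `<=` U by move=> y [/h2].
  have Y4 : Y `<=` V by move=> y [/h1].
  have Yx : Y x by split=> //; apply: Wx.
  have [_ mr _] := mres_sheaf M.
  have [z [_ uz]] := hv Y Y3 (mres Y4 s).
  have z1 : z = fun i => res Y1 (u i).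
    by apply: uz; rewrite -(mres_sum _ _ _ _ h2) -e mr.
  have z2 : z = fun i => res Y2 (cc V s i).
    by apply: uz; rewrite -(mres_sum _ _ _ _ (@W2 V)) -ccE mr.
  rewrite /phi -(germ_resE (Wx V Vx) Yx Y2) -(germ_resE V'x Yx Y1).
  by have := congr1 (fun f => f l) (etrans (esym z2) z1) => /= ->.
have [mid mr _] := mres_sheaf M.
exists phi; split; first split.
- move=> V Vx s t; rewrite (phiE _ _ Vx (Wx _ Vx) (@W1 V) (@W2 V) _ (fun i => cc V s i + cc V t i)).
    by rewrite !rmorphD.
  by rewrite mresD !ccE -big_split; apply: eq_bigr => i _; rewrite scalerDl.
- move=> V Vx f s; rewrite (phiE _ _ Vx (Wx _ Vx) (@W1 V) (@W2 V) _ (fun i => res (@W1 V) f * cc V s i)).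
    by rewrite !rmorphM; congr (c _ * _); exact: germ_resE.
  by rewrite mresZ ccE scaler_sumr; apply: eq_bigr => i _; rewrite scalerA.
- move=> V V' i Vx V'x s; symmetry.
  apply: (phiE _ _ Vx (Wx _ V'x) (subset_trans (@W1 V') i) (@W2 V') _ (cc V' (mres i s))).
  by rewrite -ccE; symmetry; apply: mr.
move=> i; rewrite (phiE U U Ux Ux (fun _ => id) (fun _ => id) _ (fun l' => (i == l')%:R)).
  by case: eqP => _; rewrite ?rmorph1 ?rmorph0.
rewrite (bigD1 i) //= eqxx scale1r big1 ?addr0 // => l' li.
by rewrite eq_sym (negPf li) scale0r.
Qed.

End Skyscraper.

(** * Formal charts *)

Lemma fps0_mmap n N (R : comNzRingType) (Y : 'I_N -> fps n R) (xi : 'I_N -> R) p :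
  (forall i, fps0 (Y i) = xi i) -> fps0 (mmap (@fps_const n R) Y p) = meval xi p.
Proof.
move=> Yxi; pose F : {rmorphism mpoly N R -> R} := @fps0 n R \o mmap (@fps_const n R) Y.
apply: (@mpoly_rmorph_ext _ _ _ F (meval xi)) => [a|i] /=.
  by rewrite mmapC fps0_const mevalC.
by rewrite mmapX mmap1U Yxi mevalXU.
Qed.

Lemma fps_mxK n r (R : comNzRingType) (M M' : 'M[R]_r) (v : 'I_r -> fps n R) :
  M *m M' = 1%:M ->
  forall l, \sum_i fps_const n (M l i) * (\sum_p fps_const n (M' i p) * v p) = v l.
Proof.
move=> MM' l; transitivity (\sum_p fps_const n ((M *m M') l p) * v p).
  under eq_bigr do rewrite mulr_sumr.
  rewrite exchange_big; apply: eq_bigr => p _.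
  rewrite mxE rmorph_sum mulr_suml; apply: eq_bigr => i _.
  by rewrite rmorphM mulrA.
rewrite MM' (bigD1 l) // big1 => [|p pl]; rewrite mxE.
  by rewrite eqxx rmorph1 mul1r [LHS]addr0.
by rewrite eq_sym (negPf pl) rmorph0 mul0r.
Qed.

(** Newton iteration with the Jacobian frozen at [xi]: [t] is replaced by [t - G^-1 g(Y t)]. *)
Lemma implicit_function (k : fieldType) n r (g : 'I_r -> mpoly (n + r) k)
    (xi : 'I_(n + r) -> k) :
  (forall i, meval xi (g i) = 0) ->
  \matrix_(i < r, l < r) meval xi (mderiv (rshift n l) (g i)) \in unitmx ->
  exists Y : 'I_(n + r) -> fps n k,
    [/\ forall i, Y (lshift r i) = fps_const n (xi (lshift r i)) + fps_var k i,
        forall i, fps0 (Y i) = xi i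
      & forall i, mmap (@fps_const n k) Y (g i) = 0].
Proof.
set G := \matrix_(_, _) _ => g0 uG; pose w1 := @unit_weight n.
pose Y (t : 'I_r -> fps n k) (j : 'I_(n + r)) : fps n k :=
  fps_const n (xi j) + match split j with inl i => fps_var k i | inr l => t l end.
pose th t : {rmorphism mpoly (n + r) k -> fps n k} := mmap (@fps_const n k) (Y t).
have Y0 t : (forall l, ord_ge w1 1 (t l)) -> forall j, fps0 (Y t j) = xi j.
  move=> ht j; rewrite fps0D fps0_const; case: (split j) => i; first by rewrite fps0_var addr0.
  by rewrite (_ : fps0 (t i) = 0) ?addr0 //; apply/(@ord_ge1 _ _ w1).
pose Phi t l := t l - \sum_i fps_const n (invmx G l i) * th t (g i).
have thC t a : th t (mpolyC (n + r) a) = fps_const n a by rewrite /= mmapC.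
have thX t j : th t (mpolyX k (mnm1 j)) = Y t j by rewrite /= mmapX mmap1U.
have [|d t t' ht ht' hd l|t [ht ft]] := @contraction_fixpoint n k w1 'I_r 1 Phi.
- move=> t ht l; apply: ord_geB => //; apply: ord_ge_sum => i _; apply: ord_geMl.
  by apply/ord_ge1 => //; rewrite (fps0_mmap _ (Y0 t ht)).
- have YI t0 : (forall l, ord_ge w1 1 (t0 l)) -> forall i,
      ord_ge w1 1 (th t0 (mpolyX k (mnm1 i)) - fps_const n (xi i)).
    by move=> h i; apply/(@ord_ge1 _ _ w1) => //; rewrite thX fps0B (Y0 _ h) fps0_const subrr.
  have YYl i : Y t (lshift r i) - Y t' (lshift r i) = 0.
    by rewrite /Y; case: splitP => [l' _|l' /= e]; [rewrite subrr | have := ltn_ord i; lia].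
  have YYr i : Y t (rshift n i) - Y t' (rshift n i) = t i - t' i.
    rewrite /Y; case: splitP => [l' /= e|l' /= e]; first by have := ltn_ord l'; lia.
    have -> : l' = i by apply: val_inj => /=; lia.
    by ring.
  have YJ i : ord_ge w1 d (th t (mpolyX k (mnm1 i)) - th t' (mpolyX k (mnm1 i))).
    rewrite !thX; case: (split_ordP i) => l' ->; last by rewrite YYr.
    by rewrite YYl; apply: ord_ge0.
  have tay i : ord_ge w1 d.+1 (th t (g i) - th t' (g i) -
      \sum_l fps_const n (G i l) * (t l - t' l)).
    have := @mpoly_taylor k (n + r) (fps n k) xi (@fps_const n k) (th t) (th t')
      (ord_ge w1 1) (ord_ge w1 d) (ord_ge w1 d.+1) (@ord_ge_is_ideal _ _ _ _)
      (@ord_ge_is_ideal _ _ _ _) (@ord_ge_is_ideal _ _ _ _)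
      (fun a b ha hb => ord_geM ha hb) (thC t) (thC t') (YI t ht) (YI t' ht') YJ (g i).
    rewrite big_split_ord /= big1 => [|l' _]; last by rewrite -!/(th _ _) !thX YYl mulr0.
    rewrite add0r; congr (ord_ge _ _ (_ - _)); apply: eq_bigr => l' _.
    by rewrite -!/(th _ _) !thX YYr mxE.
  have -> : Phi t l - Phi t' l = - \sum_i fps_const n (invmx G l i) *
     (th t (g i) - th t' (g i) - \sum_l fps_const n (G i l) * (t l - t' l)).
    have e : \sum_i fps_const n (invmx G l i) * (\sum_l fps_const n (G i l) * (t l - t' l)) = t l - t' l.
      by rewrite (fps_mxK (fun p => t p - t' p) (mulVmx uG)).
    under [X in _ = - X]eq_bigr do rewrite mulrBr mulrBr.
    rewrite !sumrB e /Phi; ring.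
  by apply: ord_geN; apply: ord_ge_sum => i _; apply: ord_geMl.
exists (Y t); split; last first.
- move=> i; have z l : \sum_i fps_const n (invmx G l i) * th t (g i) = 0.
    by have := ft l; rewrite /Phi => /eqP; rewrite -subr_eq0 addrAC subrr sub0r oppr_eq0 => /eqP.
  rewrite -[LHS](fps_mxK (fun i => th t (g i)) (mulmxV uG)).
  by rewrite big1 // => l _; rewrite z mulr0.
- exact: Y0.
move=> i; rewrite /Y; case: splitP => [l' /= e|l' /= e]; last by have := ltn_ord i; lia.
by congr (_ + fps_var k _); apply: val_inj.
Qed.

Lemma principal_open_open (k : fieldType) (X : ringed_space k) (U : opens X) (f : sec U) :
  open (principal_open f).
Proof.
rewrite openE => y [Uy [b fb]]; rewrite /interior /= nbhsE.
have [V [Vy [t bE]]] := germ_surj b.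
have i1 : opensI U V `<=` U by move=> z [].
have i2 : opensI U V `<=` V by move=> z [].
have UVy : opensI U V y by split.
have : germ UVy (res i1 f * res i2 t) = germ UVy 1.
  by rewrite rmorphM /= (germ_resE Uy) (germ_resE Vy) rmorph1 -fb bE.
move=> /germP[W [h1 [h2 [Wy e]]]].
exists W; first by split=> //; exact: oopen.
move=> z Wz; have Uz : U z by apply/i1/h1.
exists Uz, (germ Wz (res h1 (res i2 t))).
by rewrite -(germ_resE Uz Wz (subset_trans h1 i1)) -(res_res i1 h1) -rmorphM -rmorphM e !rmorph1.
Qed.

Section LocalStructure.
Variables (k : closedFieldType) (X : ringed_space k) (x : X).

Definition stalk_const : {rmorphism k -> stalk x} :=
  germ (I : opensT X x) \o base X.

Lemma germ_const (U : opens X) (Ux : U x) a : germ Ux (const U a) = stalk_const a.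
Proof. exact: germ_resE. Qed.

Lemma nonunits_principal (U : opens X) (Ux : U x) (f : sec U) :
  principal_open f x <-> ~ nonunits _ (germ Ux f).
Proof.
split=> [[Ux' uf]|nf]; first by rewrite (Prop_irrelevance Ux Ux').
by exists Ux; apply: contrapT.
Qed.

Variable W : opens X.
Hypothesis Wx : W x.
Hypothesis W_affine : is_affine_open W.

(** Together with [germ_eq0], this presents the stalk as the localization of [sec W] at [x]. *)
Lemma germ_fraction z : exists a f : sec W,
  germ Wx f * z = germ Wx a /\ ~ nonunits _ (germ Wx f).
Proof.
have [_ _ nb loc] := W_affine.
have [V [Vx [t ->]]] := germ_surj z.
have i1 : opensI V W `<=` V by move=> y [].
have i2 : opensI V W `<=` W by move=> y [].
have VWx : opensI V W x by split.
have [f [fx fV]] := nb (opensI V W) x i2 VWx.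
pose D := Opens (principal_open_open f).
have hD : D `<=` W by move=> y [].
have [_ frac _] := loc f D hD erefl.
have iV : D `<=` V by move=> y /fV[].
have [N [a e]] := frac (res iV t).
have Dx : D x by [].
exists a, (f ^+ N); split.
  have := congr1 (germ Dx) e; rewrite rmorphM /= (germ_resE Wx) (germ_resE Vx) => h.
  by rewrite h (germ_resE Wx).
have [Wx' [b fb]] := fx; rewrite (Prop_irrelevance Wx Wx') => h; apply: h.
by exists (b ^+ N); rewrite rmorphXn -exprMn fb expr1n.
Qed.

Lemma germ_eq0 a : germ Wx a = 0 ->
  exists f : sec W, f * a = 0 /\ ~ nonunits _ (germ Wx f).
Proof.
have [_ _ nb loc] := W_affine.
rewrite -(rmorph0 (germ Wx)) => /germP[V [h1 [h2 [Vx e]]]].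
have [f [fx fV]] := nb V x h1 Vx.
pose D := Opens (principal_open_open f).
have hD : D `<=` W by move=> y [].
have [_ _ ker] := loc f D hD erefl.
have [N fN] : exists N, f ^+ N * a = 0.
  apply: ker; rewrite -(res_res h1 (fV : D `<=` V)) e.
  by rewrite !rmorph0.
exists (f ^+ N); split=> //.
have [Wx' [b fb]] := fx; rewrite (Prop_irrelevance Wx Wx') => h; apply: h.
by exists (b ^+ N); rewrite rmorphXn -exprMn fb expr1n.
Qed.

Variables (N : nat) (ev : {rmorphism mpoly N k -> sec W}).
Hypothesis ev_surj : forall f, exists p, ev p = f.
Hypothesis x_closed : closed [set x].

(* A prime ideal of [sec W] vanishing at a [k]-point [xi] and contained in the
   ideal of [x] corresponds to a point in the closure of [x]. *)
Lemma closed_point : exists xi : 'I_N -> k,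
  forall p, nonunits _ (germ Wx (ev p)) <-> meval xi p = 0.
Proof.
have [Pprime Pex nb loc] := W_affine.
pose P : set (mpoly N k) := [set p | nonunits _ (germ Wx (ev p))].
have [[P0 PD PM] P1 Pm] := Pprime x Wx.
have P_prime : is_prime_ideal P.
  split; first split.
  - by rewrite /P /= rmorph0; apply: P0.
  - by move=> a b ha hb; rewrite /P /= rmorphD; apply: PD.
  - by move=> a b hb; rewrite /P /= rmorphM; apply: PM.
  - by rewrite /P /= rmorph1; apply: P1.
  - by move=> a b; rewrite /P /= rmorphM; apply: Pm.
have [xi [xi0 _]] := prime_zero P_prime (prime1 P_prime).
exists xi => p; split; first exact: xi0.
have ev_xi q q' : ev q = ev q' -> meval xi q = meval xi q'.
  move=> e; apply/eqP; rewrite -subr_eq0 -mevalB; apply/eqP; apply: xi0.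
  by rewrite /P /= rmorphB e subrr.
pose Q : set (sec W) := [set f | exists2 q, ev q = f & meval xi q = 0].
have QE q : Q (ev q) <-> meval xi q = 0.
  by split=> [[q' /ev_xi <-]|]; last by exists q.
have Q_prime : is_prime_ideal Q.
  split; first split.
  - by rewrite -(rmorph0 ev); apply/QE; rewrite meval0.
  - move=> _ _ [q <- q0] [q' <- q'0]; rewrite -rmorphD; apply/QE.
    by rewrite mevalD q0 q'0 addr0.
  - move=> a _ [q <- q0]; have [q' <-] := ev_surj a; rewrite -rmorphM; apply/QE.
    by rewrite mevalM q0 mulr0.
  - by rewrite -(rmorph1 ev) => /QE /eqP; rewrite meval1 oner_eq0.
  - move=> a b; have [q <-] := ev_surj a; have [q' <-] := ev_surj b.
    rewrite -rmorphM => /QE /eqP; rewrite mevalM mulf_eq0.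
    by move=> /orP[] /eqP ?; [left | right]; apply/QE.
have [y [[Wy yQ] _]] := Pex Q Q_prime.
suff yx : y = x.
  move=> /QE; rewrite -yQ; subst y.
  by rewrite (Prop_irrelevance Wx Wy).
(* Otherwise [y] has a principal neighborhood missing [x]. Its equation does not vanish at [xi],
   hence is invertible at [x], which puts [x] in that neighborhood. *)
apply: contrapT => yx.
pose V := opensI W (Opens (closed_openC x_closed)).
have VW : V `<=` W by move=> z [].
have Vy : V y by split.
have [f [fy fV]] := nb V y VW Vy.
have [q qf] := ev_surj f; subst f.
have fx : principal_open (ev q) x.
  apply/(nonunits_principal Wx) => /xi0 q0.
  have [Wy' uy] := fy.
  have : Q (ev q) by apply/QE.
  by rewrite -yQ (Prop_irrelevance Wy Wy') /= => h; apply: h.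
by have [_ /=] := fV x fx; apply.
Qed.

End LocalStructure.

Section CompleteLocalRing.
Variables (k : closedFieldType) (X : ringed_space k) (n : nat) (x : X).

(** What makes [c] a completion, apart from the coordinates: these are kept out because they are
    changed afterwards by an automorphism of the power series. [chart_cotangent] is injectivity on
    the cotangent space. *)
Record formal_chart (c : {rmorphism stalk x -> fps n k}) : Prop := FormalChart {
  chart_const : forall a, c (stalk_const x a) = fps_const n a;
  chart_local : forall a, nonunits (stalk x) a <-> fps0 (c a) = 0;
  chart_cotangent : forall a,
    ord_ge (@unit_weight n) 2 (c a) -> ideal_pow (nonunits (stalk x)) 2 a }.

Theorem smooth_formal_chart : is_smooth X n -> closed [set x] ->
  exists c : {rmorphism stalk x -> fps n k}, formal_chart c /\
    exists (W : opens X) (Wx : W x) (ys : 'I_n -> sec W),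
      forall i, c (germ Wx (ys i)) = fps_var k i.
Proof.
move=> X_smooth x_closed.
have [W [Wx W_affine [r [g [ev [evC ev_surj ker det_unit]]]]]] := X_smooth x.
have [xi xiE] := closed_point Wx W_affine ev_surj x_closed.
pose w1 := @unit_weight n.
pose G := \matrix_(i < r, l < r) meval xi (mderiv (rshift n l) (g i)).
have ev_g i : ev (g i) = 0 by apply/ker; apply: ideal_gen_mem; exists i.
have germ0 : nonunits (stalk x) 0.
  have [Pp _ _ _] := W_affine; have [[P0 _ _] _ _] := Pp x Wx.
  by rewrite -(rmorph0 (germ Wx)).
have xi_ev p : ev p = 0 -> meval xi p = 0 by move=> e; apply/xiE; rewrite e rmorph0.
have uG : G \in unitmx.
  rewrite unitmxE unitfE.
  have [b hb] := det_unit; apply/eqP => d0.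
  have : nonunits (stalk x) (germ Wx (ev (\det (\matrix_(i, l) mderiv (rshift n l) (g i))))).
    apply/xiE; rewrite -det_map_mx -d0; congr (\det _); apply/matrixP => i l.
    by rewrite !mxE.
  by apply; exists (germ Wx b); rewrite -rmorphM hb rmorph1.
have [Y [Yl Y0 Yg]] := implicit_function (fun i => xi_ev _ (ev_g i)) uG.
pose rho : {rmorphism mpoly (n + r) k -> stalk x} := germ Wx \o ev.
pose th : {rmorphism mpoly (n + r) k -> fps n k} := mmap (@fps_const n k) Y.
have th0 p : fps0 (th p) = meval xi p by apply: fps0_mmap.
have rho_unit p : is_unit (rho p) <-> meval xi p != 0.
  split=> [u|/eqP p0]; first by apply/eqP => /xiE h; apply: h.
  by apply: contrapT => h; apply: p0; apply/xiE.
have th_unit p : ~ nonunits _ (rho p) -> is_unit (th p).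
  by move=> h; apply: fps_unit; rewrite th0; apply/eqP => /xiE.
have th_ker p : ev p = 0 -> th p = 0.
  move=> /ker[m [b [q [qg ->]]]]; rewrite rmorph_sum big1 // => i _.
  by have [l _ <-] := qg i; rewrite rmorphM [X in _ * X](Yg l) mulr0.
have [c cE] : exists c : {rmorphism stalk x -> fps n k}, forall p, c (rho p) = th p.
  apply: localization_lift => [z|p rp].
    have [a [f [e nf]]] := germ_fraction Wx W_affine z.
    have [p pa] := ev_surj a; have [q qf] := ev_surj f.
    exists p, q; split; first by rewrite /rho /= pa qf.
    by apply: th_unit; rewrite /rho /= qf.
  have [f [fa nf]] := germ_eq0 W_affine rp.
  have [q qf] := ev_surj f; subst f.
  have := th_ker (q * p); rewrite !rmorphM => /(_ fa) qp0.
  have [u qu] := th_unit q nf.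
  by rewrite -[th p]mul1r -qu mulrAC qp0 mul0r.
have rhoC a : rho (mpolyC (n + r) a) = stalk_const x a.
  by rewrite /rho /= evC germ_const.
have frac z : exists p q, rho q * z = rho p /\ meval xi q != 0.
  have [a [f [e nf]]] := germ_fraction Wx W_affine z.
  have [p pa] := ev_surj a; have [q qf] := ev_surj f; subst a f.
  by exists p, q; split=> //; apply/eqP => /xiE.
have c_const a : c (stalk_const x a) = fps_const n a.
  by rewrite -rhoC cE /th /= mmapC.
have c_local a : nonunits (stalk x) a <-> fps0 (c a) = 0.
  have [p [q [e q0]]] := frac a; have /rho_unit[u qu] := q0.
  have cq : fps0 (c (rho q)) != 0 by rewrite cE th0.
  have -> : fps0 (c a) = 0 <-> meval xi p = 0.
    rewrite -th0 -cE -e rmorphM fps0M; split=> [->|/eqP]; first by rewrite mulr0.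
    by rewrite mulf_eq0 (negPf cq) => /eqP.
  rewrite -xiE -[germ _ _]/(rho p) -e; split=> h [b hb]; apply: h.
    by exists (rho q * b); rewrite mulrA [a * _]mulrC.
  by exists (u * b); rewrite mulrACA qu mul1r.
exists c; split; last first.
  exists W, Wx, (fun i => ev (mpolyX k (mnm1 (lshift r i)) - mpolyC (n + r) (xi (lshift r i)))) => i.
  rewrite -[germ _ _]/(rho _) cE rmorphB /th /= mmapX mmap1U mmapC Yl.
  by rewrite addrC addKr.
split=> // a ca; set I := nonunits (stalk x).
have I_ideal : is_ideal I.
  split=> [|u v /c_local cu /c_local cv|u v /c_local cv] //; apply/c_local.
    by rewrite rmorphD fps0D cu cv addr0.
  by rewrite rmorphM fps0M cv mulr0.
have I2 := ideal_pow_is_ideal I 2; have [I20 I2D I2M] := I2.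
have [p [q [e q0]]] := frac a; have /rho_unit[u qu] := q0.
have cI2 b : ideal_pow I 2 b -> ord_ge w1 2 (c b).
  move: b; apply: ideal_gen_sub.
    have [P0 PD PM] := @ord_ge_is_ideal n k w1 2.
    by split=> /= [|y z hy hz|y z hz]; rewrite ?rmorph0 ?rmorphD ?rmorphM; [|apply: PD|apply: PM].
  move=> _ [f [fI ->]] /=; rewrite !big_ord_recl big_ord0 mulr1 rmorphM.
  have f1 i : ord_ge w1 1 (c (f i)) by apply/(@ord_ge1 _ _ w1) => //; apply/c_local; apply: fI.
  exact: (@ord_geM _ _ w1 1 1).
(* [p'] is [p] minus a combination of the equations, with coefficients chosen through the invertible
   [G] so that the derivatives of [p'] in the last [r] variables vanish at [xi]. *)
pose mu := (\row_l meval xi (mderiv (rshift n l) p)) *m invmx G.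
pose p' := p - \sum_i mpolyC (n + r) (mu 0 i) * g i.
have rp' : rho p' = rho p.
  rewrite /p' rmorphB rmorph_sum big1 ?subr0 // => i _.
  by rewrite rmorphM /rho /= ev_g rmorph0 mulr0.
have p'0 : meval xi p' = 0.
  rewrite -th0 -cE rp' -e rmorphM fps0M (_ : fps0 (c a) = 0) ?mulr0 //.
  by apply: ca; rewrite wdeg0.
have dp' l : meval xi (mderiv (rshift n l) p') = 0.
  rewrite /p' mderivB mevalB.
  have -> : meval xi (mderiv (rshift n l) (\sum_i mpolyC (n + r) (mu 0 i) * g i)) = (mu *m G) 0 l.
    rewrite (raddf_sum (mderiv (rshift n l))) (raddf_sum (meval xi)) [RHS]mxE; apply: eq_bigr => i _.
    rewrite -[LHS]/(meval xi (mderiv (rshift n l) (mpolyC (n + r) (mu 0 i) * g i))).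
    by rewrite mderiv_mulC mevalM mevalC [G i l]mxE.
  by rewrite /mu mulmxKV // mxE subrr.
(* With evaluation at [xi] as second morphism, [mpoly_taylor] becomes the expansion at that
   point. *)
have [rho' rho'E] : exists rho' : {rmorphism mpoly (n + r) k -> stalk x},
    forall p, rho' p = stalk_const x (meval xi p) by exists (stalk_const x \o meval xi).
pose Uv i := rho (mpolyX k (mnm1 i)) - stalk_const x (xi i).
have UvI i : I (Uv i).
  by apply/c_local; rewrite rmorphB cE fps0B th0 mevalXU c_const fps0_const subrr.
have rho'C b : rho' (mpolyC (n + r) b) = stalk_const x b by rewrite rho'E mevalC.
have rho'X i : rho' (mpolyX k (mnm1 i)) = stalk_const x (xi i) by rewrite rho'E mevalXU.
have rho'I i : I (rho' (mpolyX k (mnm1 i)) - stalk_const x (xi i)).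
  by rewrite rho'X subrr; case: I_ideal.
have rho_rho' i : I (rho (mpolyX k (mnm1 i)) - rho' (mpolyX k (mnm1 i))).
  by rewrite rho'X; apply: UvI.
have pow1 b : ideal_pow I 1 b <-> I b.
  split=> [|hb]; last by rewrite -[b]mulr1; apply: ideal_powS => //; apply: ideal_pow0.
  by move: b; apply: ideal_pow_sub => // y z hy _; rewrite mulrC; case: I_ideal => _ _ IM; apply: IM.
have tay : ideal_pow I 2 (rho p' - \sum_i stalk_const x (meval xi (mderiv (lshift r i) p')) * Uv (lshift r i)).
  have := @mpoly_taylor k (n + r) (stalk x) xi (stalk_const x) rho rho' I I (ideal_pow I 2)
    I_ideal I_ideal I2 (fun a b ha hb => ideal_powS ha ((pow1 b).2 hb)) rhoC rho'C UvI rho'I rho_rho' p'.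
  rewrite big_split_ord [X in _ - (_ + X)]big1 => [|l _]; last by rewrite dp' rmorph0 mul0r.
  rewrite [in X in ideal_pow _ _ (_ - X)]addr0 rho'E p'0 rmorph0 subr0.
  congr (ideal_pow _ _ (_ - _)); apply: eq_bigr => i _.
  by rewrite rho'X.
(* Modulo order 2, the series of [rho p'] is the linear form with coefficients [al]. It also has
   order 2, being a multiple of [c a], so every [al i] vanishes. *)
pose al i := meval xi (mderiv (lshift r i) p').
have lin : ord_ge w1 2 (\sum_i fps_const n (al i) * fps_var k i).
  have -> : \sum_i fps_const n (al i) * fps_var k i = c (rho p') -
      c (rho p' - \sum_i stalk_const x (al i) * Uv (lshift r i)).
    rewrite (rmorphB c) opprB addrC subrK rmorph_sum; apply: eq_bigr => i _.
    rewrite rmorphM c_const (rmorphB c) cE c_const /th /= mmapX mmap1U Yl.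
    by congr (_ * _); rewrite [X in X - _]addrC addrK.
  apply: ord_geB; last exact: cI2.
  by rewrite rp' -e rmorphM; apply: ord_geMl.
have lin0 i : al i = 0.
  have := @fcoef_lin n k (\matrix_(_, l) al l) i i; rewrite mxE /fps_lin => <-.
  under eq_bigr do rewrite mxE.
  by apply: lin; rewrite wdeg_unit mdeg1.
have : ideal_pow I 2 (rho p).
  rewrite -rp'; move: tay; rewrite big1 ?subr0 // => i _.
  by rewrite -/(al i) lin0 rmorph0 mul0r.
rewrite -e => h; rewrite -[a]mul1r -qu mulrAC mulrC.
exact: I2M.
Qed.

End CompleteLocalRing.

Section EtaleCoordinates.
Variables (k : closedFieldType) (X : ringed_space k) (n : nat) (x : X).
Variables (Om : differentials X) (U : opens X) (Ux : U x) (xs : 'I_n -> sec U).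
Hypothesis xs_basis : is_basis (fun a => diff Om (xs a)).
Hypothesis xs_x : forall a, nonunits _ (germ Ux (xs a)).

(** The [d x_i] generate, so each [d y_m] is a combination of them near [x]. Applying the
    derivations of the series ring to this relation and taking constant terms gives a left inverse
    of the Jacobian. *)
Lemma etale_jacobian_unit (c : {rmorphism stalk x -> fps n k})
    (W : opens X) (Wx : W x) (ys : 'I_n -> sec W) :
  formal_chart c -> (forall i, c (germ Wx (ys i)) = fps_var k i) ->
  fps_jacobian (fun i => c (germ Ux (xs i))) \in unitmx.
Proof.
move=> ch cys.
have i1 : opensI U W `<=` U by move=> z [].
have i2 : opensI U W `<=` W by move=> z [].
have Vx : opensI U W x by split.
have ex m := xs_basis i1 (diff Om (res i2 (ys m))).
have /choice[a aE] m : exists a : 'I_n -> sec (opensI U W),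
    diff Om (res i2 (ys m)) = \sum_i a i *: mres i1 (diff Om (xs i)).
  by have [a [aE _]] := ex m; exists a.
pose A := \matrix_(m < n, i < n) fps0 (c (germ Vx (a m i))).
suff /mulmx1_unit[] : A *m fps_jacobian (fun i => c (germ Ux (xs i))) = 1%:M by [].
apply/matrixP => m l; rewrite [LHS]mxE [RHS]mxE.
have [phi [phi_fib phiE]] := @deriv_fiber_map k X x _ c Om (fps_deriv l)
  (@fps_derivD _ _ l) (@fps_derivM _ _ l)
  (fun V (Vx : V x) b => etrans (congr1 (fun z => fps_deriv l (c z)) (germ_const Vx b))
     (etrans (congr1 (fps_deriv l) (chart_const ch b)) (fps_derivC _ _))).
have := congr1 (fun z => fps0 (phi _ Vx z)) (aE m).
rewrite phiE (germ_resE Wx) cys fps_derivX (fiber_map_sum _ _ _ _ phi_fib) fps0_sum.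
have -> : fps0 ((m == l)%:R : fps n k) = (m == l)%:R by case: eqP; rewrite ?fps01 // /fps0.
move=> ->; apply: eq_bigr => i _; have [_ pZ pr] := phi_fib.
by rewrite pZ (pr _ _ _ Ux) phiE fps0M fps0_deriv !mxE.
Qed.

Theorem etale_formal_chart : is_smooth X n -> closed [set x] ->
  exists c : {rmorphism stalk x -> fps n k}, formal_chart c /\
    forall i, c (germ Ux (xs i)) = fps_var k i.
Proof.
move=> X_smooth x_closed.
have [c [ch [W [Wx [ys cys]]]]] := smooth_formal_chart X_smooth x_closed.
have uJ := etale_jacobian_unit ch cys; set Psi := (fun i => _) in uJ.
have Psi0 i : fps0 (Psi i) = 0 by apply/(chart_local ch).
pose s := subst_rmorphism Psi0.
have [t st ts] : bijective s by apply: fps_subst_bij.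
have tB : zmod_morphism t by move=> a b; apply: (can_inj st); rewrite rmorphB !ts.
have tM : monoid_morphism t.
  by split=> [|a b]; apply: (can_inj st); rewrite ?rmorph1 ?rmorphM ?ts.
pose tau : {rmorphism fps n k -> fps n k} := HB.pack t
  (GRing.isZmodMorphism.Build _ _ t tB) (GRing.isMonoidMorphism.Build _ _ t tM).
have tauP b b' : s b = b' -> tau b' = b by move=> <-; apply: st.
exists (tau \o c); split; last first.
  by move=> i /=; apply: tauP; rewrite [LHS]fps_substX.
have sc a : s (tau (c a)) = c a by apply: ts.
split=> [a|a|a ha] /=.
- by rewrite (chart_const ch); apply: tauP; apply: fps_substC.
- have e : fps0 (c a) = fps0 (t (c a)) by rewrite -{1}(sc a); apply: fps0_subst.
  by rewrite -e; apply: chart_local.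
- by apply: (chart_cotangent ch); rewrite -(sc a); apply: fps_subst_ord1.
Qed.

End EtaleCoordinates.

(** * Second-order loci *)

Lemma mulmx1_square (k : fieldType) p q (A : 'M[k]_(p, q)) (B : 'M[k]_(q, p)) :
  A *m B = 1%:M -> B *m A = 1%:M -> p = q.
Proof.
move=> AB BA; apply/eqP; rewrite eqn_leq; apply/andP; split.
  by rewrite -[X in (X <= _)%N](mxrank1 k) -AB; apply: leq_trans (mxrankM_maxl _ _) (rank_leq_col _).
by rewrite -[X in (X <= _)%N](mxrank1 k) -BA; apply: leq_trans (mxrankM_maxl _ _) (rank_leq_col _).
Qed.

(* Matrices witnessing that the columns of [kap] form a basis of the kernel of
   [M] and that those of [gam] induce a basis of its cokernel. These identities
   are preserved by ring homomorphisms. *)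
Definition splits (R : comPzRingType) a b r t (M : 'M[R]_(b, a)) (kap : 'M[R]_(a, r))
    (gam : 'M[R]_(b, t)) (om : 'M[R]_(t, b)) (sig : 'M[R]_(a, b)) (tau : 'M[R]_(r, a)) : Prop :=
  [/\ gam *m om + M *m sig = 1%:M, kap *m tau + sig *m M = 1%:M, M *m kap = 0
    & [/\ om *m M = 0, om *m gam = 1%:M & tau *m kap = 1%:M]].

Section ShiftOrd.
Variables (n d : nat) (le_dn : (d < n)%N).

Lemma shift_subproof (i : 'I_(n - d)) : (d + i < n)%N.
Proof. by have := ltn_ord i; lia. Qed.
Definition shift_ord (i : 'I_(n - d)) : 'I_n := Ordinal (shift_subproof i).

Lemma shift_ordP (c : 'I_n) : (d <= c)%N -> exists a, c = shift_ord a.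
Proof.
move=> dc; have cd : (c - d < n - d)%N by have := ltn_ord c; lia.
by exists (Ordinal cd); apply: val_inj; rewrite /= subnKC.
Qed.

Lemma shift_ord_inj : injective shift_ord.
Proof. by move=> a b /(congr1 val) /= /addnI ab; apply: val_inj. Qed.

Lemma big_shift_ord (V : nmodType) (G : 'I_n -> V) :
  (forall c : 'I_n, (c < d)%N -> G c = 0) -> \sum_c G c = \sum_a G (shift_ord a).
Proof.
move=> G0; rewrite (bigID (fun c : 'I_n => c \in codom shift_ord)) /=.
rewrite [X in _ + X]big1 => [|c cN]; last first.
  apply: G0; rewrite ltnNge; apply: contraNN cN => /shift_ordP[a ->].
  exact: codom_f.
rewrite addr0 -big_uniq; last exact/injectiveP/shift_ord_inj.
by rewrite big_map big_enum.
Qed.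

End ShiftOrd.

(** * The second intrinsic differential over the residue field *)

Section HessianRank.
Variables (k : fieldType) (n d : nat) (le_dn : (d < n)%N).
Local Notation e := d.+1.
Let cidx (m : 'I_d) : 'I_n := widen_ord (ltnW le_dn) m.
Let ridx (m : 'I_d) : 'I_e := widen_ord (leqnSn d) m.

Local Notation sh := (shift_ord le_dn).

Variables (F : 'M[k]_(e, n)) (HH : 'I_n -> 'M[k]_(e, n)).
Hypothesis F_top : forall (m : 'I_d) c, F (ridx m) c = (cidx m == c)%:R.
Hypothesis HH_top : forall p (m : 'I_d) c, HH p (ridx m) c = 0.
Hypothesis F_rank : (\rank F < e)%N.

Variables (r t : nat) (kap : 'M[k]_(n, r)) (gam : 'M[k]_(e, t)) (om : 'M[k]_(t, e))
  (sig : 'M[k]_(n, e)) (tau : 'M[k]_(r, n)).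
Hypothesis F_splits : splits F kap gam om sig tau.
Variables (Dm : 'I_r * 'I_t -> 'I_r -> k) (j : nat).
Hypothesis DmE : forall p q l, Dm (q, l) p = \sum_c kap c p * (om *m HH c *m kap) l q.
Let sz := degeneracy_size ('I_r * 'I_t)%type 'I_r.
Hypothesis minors_j : forall x, minors Dm (sz j) x -> x = 0.
Hypothesis minors_j1 : ~ ((j.+1 <= (minn #|{: 'I_r * 'I_t}| #|'I_r|).+1)%N /\
  forall x, minors Dm (sz j.+1) x -> x = 0).

Let H : 'M[k]_(n - d) := \matrix_(a, b) HH (sh a) ord_max (sh b).

Let ord_split (m : 'I_e) : (exists m', m = ridx m') \/ m = ord_max.
Proof.
have [md|dm] := ltnP m d; first by left; exists (Ordinal md); apply: val_inj.
by right; apply: val_inj => /=; have := ltn_ord m; lia.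
Qed.

Let big_split_e (G : 'I_e -> k) : \sum_m G m = \sum_(m < d) G (ridx m) + G ord_max.
Proof. by rewrite big_ord_recr. Qed.

Let om_F l c : \sum_(m < d) om l (ridx m) * (cidx m == c)%:R + om l ord_max * F ord_max c = 0.
Proof.
have [_ _ _ [omF _ _]] := F_splits.
have := congr1 (fun A : 'M_(t, n) => A l c) omF; rewrite [RHS]mxE [LHS]mxE big_split_e => E.
by rewrite -[RHS]E; congr (_ + _); apply: eq_bigr => m _; rewrite F_top.
Qed.

Let om_top l m : om l (ridx m) = - (om l ord_max * F ord_max (cidx m)).
Proof.
have := om_F l (cidx m); rewrite (bigD1 m) //= eqxx mulr1 big1 => [|m' mm'].
  by rewrite addr0 => /eqP; rewrite addr_eq0 => /eqP.
case: eqP => [/(congr1 val) /= e|]; last by rewrite mulr0.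
by case/eqP: mm'; apply: val_inj.
Qed.

Let om_last l : om l ord_max != 0.
Proof.
apply/eqP => o0; have [_ _ _ [_ omg _]] := F_splits.
have := congr1 (fun A : 'M_t => A l l) omg; rewrite !mxE eqxx big1 => [/eqP|m _].
  by rewrite eq_sym oner_eq0.
by have [[m' ->]|->] := ord_split m; rewrite ?om_top o0 !mul0r ?oppr0 ?mul0r.
Qed.

(** With [t = 0] the matrix [F] would be surjective, against its rank. With [t >= 2] two rows of
    [om] would be proportional, since [om_top] determines a row by its last entry, and this
    contradicts [om *m gam = 1]. *)
Let t1 : t = 1%N.
Proof.
have [FF _ _ [_ omg _]] := F_splits.
have t0 : t != 0%N.
  apply/eqP => t0; move: F_rank; rewrite ltnNge => /negP; apply.
  have e1 : F *m sig = 1%:M.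
    rewrite -FF [X in _ = X + _](_ : _ = 0) ?add0r //.
    apply/matrixP => a b; rewrite !mxE big1 // => l _.
    by have := ltn_ord l; rewrite {2}t0.
  by rewrite -[X in (X <= _)%N](mxrank1 k) -e1 mxrankM_maxl.
apply/eqP; rewrite eqn_leq lt0n t0 andbT leqNgt; apply/negP => t2.
pose l0 := Ordinal (ltnW t2); pose l1 := Ordinal t2.
have := om_last l1; apply/negP; rewrite negbK; apply/eqP.
have E m : om l1 ord_max * om l0 m - om l0 ord_max * om l1 m = 0.
  by have [[m' ->]|->] := ord_split m; rewrite ?om_top; ring.
have : \sum_m (om l1 ord_max * om l0 m - om l0 ord_max * om l1 m) * gam m l0 = 0.
  by rewrite big1 // => m _; rewrite E mul0r.
under eq_bigr do rewrite mulrBl -!mulrA.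
rewrite sumrB -!mulr_sumr.
have := congr1 (fun A : 'M_t => A l0 l0) omg; rewrite !mxE => ->.
have := congr1 (fun A : 'M_t => A l1 l0) omg; rewrite !mxE => ->.
by rewrite eqxx /= mulr0 subr0 mulr1.
Qed.

Let l0 : 'I_t := cast_ord (esym t1) ord0.

Let F_last (c : 'I_n) : (d <= c)%N -> F ord_max c = 0.
Proof.
move=> dc; have /eqP := om_F l0 c; rewrite big1 => [|m _].
  by rewrite add0r mulf_eq0 (negPf (om_last l0)) => /eqP.
case: eqP => [/(congr1 val) /= e|]; last by rewrite mulr0.
by have := ltn_ord m; lia.
Qed.

Let kap_top m q : kap (cidx m) q = 0.
Proof.
have [_ _ Fk _] := F_splits.
have := congr1 (fun A : 'M_(e, r) => A (ridx m) q) Fk; rewrite [RHS]mxE [LHS]mxE => E.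
rewrite -[RHS]E (bigD1 (cidx m)) //= F_top eqxx mul1r big1 ?addr0 // => c cm.
by rewrite F_top eq_sym (negPf cm) mul0r.
Qed.

Let big_shift (G : 'I_n -> k) : (forall m, G (cidx m) = 0) -> \sum_c G c = \sum_a G (sh a).
Proof.
move=> G0; apply: big_shift_ord => c cd.
by rewrite (_ : c = cidx (Ordinal cd)) //; apply: val_inj.
Qed.

Let u := rowsub sh kap.
Let tau' := colsub sh tau.

Let tau_u : tau' *m u = 1%:M.
Proof.
have [_ _ _ [_ _ <-]] := F_splits; apply/matrixP => p q; rewrite !mxE.
rewrite [RHS]big_shift => [|m]; last by rewrite kap_top mulr0.
by apply: eq_bigr => a _; rewrite !mxE.
Qed.

Let u_tau : u *m tau' = 1%:M.
Proof.
have [_ kt _ _] := F_splits; apply/matrixP => a b.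
have := congr1 (fun A : 'M_n => A (sh a) (sh b)) kt; rewrite !mxE.
rewrite [X in _ + X]big1 ?addr0 => [|m _].
  have -> : (sh a == sh b) = (a == b) by rewrite -!val_eqE /= eqn_add2l.
  by move=> <-; apply: eq_bigr => q _; rewrite !mxE.
have [[m' ->]|->] := ord_split m; last by rewrite F_last ?mulr0 //= leq_addr.
rewrite F_top; case: eqP => [/(congr1 val) /= e|]; last by rewrite mulr0.
by have := ltn_ord m'; lia.
Qed.

Let rE : r = (n - d)%N.
Proof. exact: mulmx1_square tau_u u_tau. Qed.

Let D := \matrix_(q < r, p < r) Dm (q, l0) p.

Let DE : D = om l0 ord_max *: (u^T *m H^T *m u).
Proof.
have inner a q : (om *m HH (sh a) *m kap) l0 q = om l0 ord_max * (u^T *m H^T) q a.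
  rewrite [LHS]mxE [in RHS]mxE mulr_sumr big_shift => [|m]; last by rewrite kap_top mulr0.
  apply: eq_bigr => b _; rewrite [_ l0 _]mxE big_split_e big1 => [|m _].
    by rewrite add0r !mxE; ring.
  by rewrite HH_top mulr0.
apply/matrixP => q p; rewrite [LHS]mxE [RHS]mxE [in RHS]mxE DmE.
rewrite big_shift => [|m]; last by rewrite kap_top mul0r.
rewrite mulr_sumr; apply: eq_bigr => a _; rewrite inner [u a p]mxE; ring.
Qed.

Let rank_D : \rank D = \rank H.
Proof.
rewrite DE (mxrank_scale_nz _ (om_last l0)).
apply/eqP; rewrite eqn_leq; apply/andP; split.
  apply: leq_trans (mxrankM_maxl _ _) _; apply: leq_trans (mxrankM_maxr _ _) _.
  by rewrite mxrank_tr.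
have -> : \rank H = \rank (tau'^T *m (u^T *m H^T *m u) *m tau').
  have -> : tau'^T *m (u^T *m H^T *m u) *m tau' = (u *m tau')^T *m H^T *m (u *m tau').
    by rewrite trmx_mul !mulmxA.
  by rewrite u_tau trmx1 mul1mx mulmx1 mxrank_tr.
by apply: leq_trans (mxrankM_maxl _ _) (mxrankM_maxr _ _).
Qed.

Let minE : minn #|{: 'I_r * 'I_t}| #|'I_r| = r.
Proof. by rewrite card_prod !card_ord t1 muln1 minnn. Qed.

(** The first [d] rows of [F] are coordinate forms and the cokernel is a line, so the last row
    vanishes on the remaining columns and the kernel is spanned by the last [n - d] coordinates.
    Only the last rows of the [HH p] are nonzero; hence [Dm] is the Hessian up to transposition, a
    change of basis of the kernel and the scalar [om l0 ord_max]. *)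
Theorem hessian_rank :
  [/\ forall c : 'I_n, (d <= c)%N -> F ord_max c = 0,
      (j <= n - d)%N & \rank H = (n - d - j)%N].
Proof.
have szE i : sz i = (r.+1 - i)%N by rewrite /sz /degeneracy_size minE.
have low : (\rank D < r.+1 - j)%N.
  rewrite ltnNge -szE; apply/negP => /rank_minor[g [h /eqP]]; apply.
  apply: minors_j; exists (fun i => (g i, l0)), h.
  by congr (\det _); apply/matrixP => a b; rewrite !mxE.
(* For [j > r] the size [r.+1 - j] is truncated to 0, and [low] would bound a rank strictly below
   0. *)
have jr : (j <= r)%N by lia.
split; [exact: F_last | by rewrite -rE | ].
rewrite -rank_D -rE; apply/eqP; rewrite eqn_leq; apply/andP; split; first by lia.
have [x [[g [h xE]] x0]] : exists x, minors Dm (sz j.+1) x /\ x != 0.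
  apply: contrapT => nex; apply: minors_j1; split; first by rewrite minE ltnS.
  by move=> x mx; apply/eqP; apply: contrapT => /negP x0; apply: nex; exists x.
have -> : (r - j)%N = sz j.+1 by rewrite szE subSS.
apply: (@minor_rank _ _ _ _ D (fun i => (g i).1) h); move: x0; rewrite xE.
congr (\det _ != 0); apply/matrixP => a b; rewrite !mxE; case: (g a) => q l /=.
by congr (Dm (_, _) _); apply: val_inj => /=; have := ltn_ord l; rewrite {2}t1; case: (val l).
Qed.

End HessianRank.

(** [om] and [sig] decompose the basis vectors of the target. The relations on [om] follow from
    uniqueness of classes in the cokernel; [1 - sig M] then maps into the kernel, and [tau] gives
    its coordinates there. *)
Lemma splits_exists (B : comPzRingType) a b r t (M : 'M[B]_(b, a))
    (kap : 'M[B]_(a, r)) (gam : 'M[B]_(b, t)) :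
  (forall u : 'cV[B]_a, M *m u = 0 <-> exists w : 'cV[B]_r, u = kap *m w) ->
  (forall w : 'cV[B]_r, kap *m w = 0 -> w = 0) ->
  (forall y : 'cV[B]_b, exists! w : 'cV[B]_t, exists u : 'cV[B]_a, y = gam *m w + M *m u) ->
  exists om sig tau, splits M kap gam om sig tau.
Proof.
move=> kerM kap_inj cok.
have colP p q (Y Z : 'M[B]_(p, q)) : (forall i, col i Y = col i Z) -> Y = Z.
  move=> h; apply/matrixP => c i; have := congr1 (fun A : 'cV_p => A c 0) (h i).
  by rewrite !mxE.
have col_mulmx p q s (Y : 'M[B]_(p, q)) (Z : 'M[B]_(q, s)) i : col i (Y *m Z) = Y *m col i Z.
  by apply/matrixP => c l; rewrite !mxE; apply: eq_bigr => m _; rewrite !mxE.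
have col_add p q (Y Z : 'M[B]_(p, q)) i : col i (Y + Z) = col i Y + col i Z.
  by apply/matrixP => c l; rewrite !mxE.
have gam_uniq q (W : 'M[B]_(t, q)) (V : 'M[B]_(a, q)) : gam *m W + M *m V = 0 -> W = 0.
  move=> e; apply: colP => i; have [z [_ uz]] := cok 0.
  rewrite -(uz (col i W)); last first.
    by exists (col i V); rewrite -!col_mulmx -col_add e; apply/matrixP => c l; rewrite !mxE.
  rewrite (_ : col i 0 = 0); last by apply/matrixP => c l; rewrite !mxE.
  by apply: uz; exists 0; rewrite !mulmx0 addr0.
have kap_uniq q (W : 'M[B]_(r, q)) : kap *m W = 0 -> W = 0.
  move=> e; apply: colP => i; rewrite (_ : col i 0 = 0); last by apply/matrixP => c l; rewrite !mxE.
  by apply: kap_inj; rewrite -col_mulmx e; apply/matrixP => c l; rewrite !mxE.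
have /choice[w /choice[u wuE]] i : exists w : 'cV[B]_t, exists u : 'cV[B]_a,
    col i 1%:M = gam *m w + M *m u.
  by have [w [wE _]] := cok (col i 1%:M); exists w.
pose om : 'M[B]_(t, b) := \matrix_(l, i) w i l 0.
pose sig : 'M[B]_(a, b) := \matrix_(l, i) u i l 0.
have e1 : gam *m om + M *m sig = 1%:M.
  apply: colP => i; rewrite wuE col_add !col_mulmx.
  by congr (gam *m _ + M *m _); apply/matrixP => c l; rewrite !mxE ord1.
have omM : om *m M = 0.
  apply: (gam_uniq _ _ (sig *m M - 1%:M)).
  by rewrite mulmxBr mulmx1 addrA !mulmxA -mulmxDl e1 mul1mx subrr.
have omg : om *m gam = 1%:M.
  apply/eqP; rewrite -subr_eq0; apply/eqP; apply: (gam_uniq _ _ (sig *m gam)).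
  by rewrite mulmxBr mulmx1 addrAC !mulmxA -mulmxDl e1 mul1mx subrr.
have Mk : M *m kap = 0.
  apply: colP => i; rewrite col_mulmx (_ : col i 0 = 0); last by apply/matrixP => c l; rewrite !mxE.
  apply/kerM; exists (col i 1%:M); rewrite -col_mulmx mulmx1 //.
have Ms : M *m (1%:M - sig *m M) = 0.
  by rewrite mulmxBr mulmx1 mulmxA -[X in X - _]mul1mx -mulmxBl -e1 addrK -mulmxA omM mulmx0.
have /choice[v vE] i : exists v : 'cV[B]_r, col i (1%:M - sig *m M) = kap *m v.
  apply/kerM; rewrite -col_mulmx Ms; by apply/matrixP => c l; rewrite !mxE.
pose tau : 'M[B]_(r, a) := \matrix_(l, i) v i l 0.
have kt : kap *m tau = 1%:M - sig *m M.
  apply: colP => i; rewrite vE col_mulmx; congr (_ *m _).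
  by apply/matrixP => c l; rewrite !mxE ord1.
have tk : tau *m kap = 1%:M.
  apply/eqP; rewrite -subr_eq0; apply/eqP; apply: kap_uniq.
  by rewrite mulmxBr mulmx1 mulmxA kt mulmxBl mul1mx -mulmxA Mk mulmx0 subr0 subrr.
by exists om, sig, tau; split=> //; rewrite kt subrK.
Qed.

Lemma splits_map (R S : comPzRingType) (phi : {rmorphism R -> S}) a b r t
    (M : 'M[R]_(b, a)) (kap : 'M[R]_(a, r)) (gam : 'M[R]_(b, t)) om sig tau :
  splits M kap gam om sig tau ->
  splits (map_mx phi M) (map_mx phi kap) (map_mx phi gam)
    (map_mx phi om) (map_mx phi sig) (map_mx phi tau).
Proof.
have mapM p q s (Y : 'M[R]_(p, q)) (Z : 'M[R]_(q, s)) :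
    map_mx phi Y *m map_mx phi Z = map_mx phi (Y *m Z).
  by apply/matrixP => i l; rewrite !mxE rmorph_sum; apply: eq_bigr => c _; rewrite !mxE rmorphM.
have mapD p q (Y Z : 'M[R]_(p, q)) : map_mx phi Y + map_mx phi Z = map_mx phi (Y + Z).
  by apply/matrixP => i l; rewrite !mxE rmorphD.
have map1 p : map_mx phi 1%:M = 1%:M :> 'M[S]_p.
  by apply/matrixP => i l; rewrite !mxE; case: eqP => _; rewrite ?rmorph1 ?rmorph0.
have map0 p q : map_mx phi 0 = 0 :> 'M[S]_(p, q).
  by apply/matrixP => i l; rewrite !mxE rmorph0.
by case=> e1 e2 e3 [e4 e5 e6]; split; last split; rewrite !mapM ?mapD ?e1 ?e2 ?e3 ?e4 ?e5 ?e6 ?map1 ?map0.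
Qed.

Section BasisChange.
Variables (k : fieldType) (X : ringed_space k) (x : X) (B : comPzRingType).
Variables (c : {rmorphism stalk x -> B}) (M : modsheaf X) (U U' : opens X) (Ux : U x) (Ux' : U' x).
Variables (p q : nat) (w : 'I_p -> msec M U) (w' : 'I_q -> msec M U').
Variable psi : 'I_p -> forall V : opens X, V x -> msec M V -> B.
Hypotheses (w_basis : is_basis w) (w'_basis : is_basis w').
Hypothesis psi_fiber : forall i, is_fiber_map c (psi i).
Hypothesis psi_w : forall i l, psi i Ux (w l) = (l == i)%:R.

(** The two frames may a priori have different lengths, so both products are required; equality of
    the lengths is deduced later from these identities. *)
Lemma basis_change (Q := \matrix_(j < q, i < p) psi i Ux' (w' j)) :
  exists S : 'M[B]_(p, q), S *m Q = 1%:M /\ Q *m S = 1%:M.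
Proof.
pose V := opensI U U'.
have i1 : V `<=` U by move=> y [].
have i2 : V `<=` U' by move=> y [].
have Vx : V x by split.
have /choice[R RE] j : exists R : 'I_p -> sec V, mres i2 (w' j) = \sum_i R i *: mres i1 (w i).
  by have [R [RE _]] := w_basis i1 (mres i2 (w' j)); exists R.
have /choice[S SE] i : exists S : 'I_q -> sec V, mres i1 (w i) = \sum_j S j *: mres i2 (w' j).
  by have [S [SE _]] := w'_basis i2 (mres i1 (w i)); exists S.
have QE j i : Q j i = c (germ Vx (R j i)).
  have [_ pZ pr] := psi_fiber i; rewrite mxE -(pr _ _ i2 Ux' Vx) RE.
  rewrite (fiber_map_sum _ _ _ _ (psi_fiber i)) (bigD1 i) //= big1 => [|l li].
    by rewrite addr0 pZ (pr _ _ i1 Ux) psi_w eqxx mulr1.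
  by rewrite pZ (pr _ _ i1 Ux) psi_w (negPf li) mulr0.
exists (\matrix_(i, j) c (germ Vx (S i j))); split; apply/matrixP.
  move=> i l; rewrite [LHS]mxE [RHS]mxE; have [_ pZ pr] := psi_fiber l.
  have := congr1 (psi l Vx) (SE i); rewrite (pr _ _ i1 Ux) psi_w => ->.
  rewrite (fiber_map_sum _ _ _ _ (psi_fiber l)); apply: eq_bigr => j _.
  by rewrite pZ (pr _ _ i2 Ux') !mxE.
move=> j l; rewrite [LHS]mxE [RHS]mxE.
(* The fibre maps are dual to [w] only, so this product is computed from uniqueness of coordinates
   in the frame [w']. *)
have [z [_ uz]] := w'_basis i2 (mres i2 (w' j)).
have z1 : z = fun l => \sum_i R j i * S i l.
  apply: uz; rewrite RE.
  under eq_bigr do rewrite SE scaler_sumr.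
  rewrite exchange_big; apply: eq_bigr => l' _; rewrite scaler_suml.
  by apply: eq_bigr => i _; rewrite scalerA.
have z2 : z = fun l => (j == l)%:R.
  apply: uz; rewrite (bigD1 j) //= eqxx scale1r big1 ?addr0 // => l' jl.
  by rewrite eq_sym (negPf jl) scale0r.
have := congr1 (fun f => c (germ Vx (f l))) (etrans (esym z1) z2).
have -> : c (germ Vx (j == l)%:R) = (j == l)%:R by case: eqP => _; rewrite ?rmorph1 ?rmorph0.
move=> <-; rewrite !rmorph_sum; apply: eq_bigr => i _.
by rewrite QE mxE !rmorphM.
Qed.

End BasisChange.

Lemma fps_deriv_sum n (R : comNzRingType) (i : 'I_n) (I : Type) (r : seq I) (P : pred I)
    (F : I -> fps n R) :
  fps_deriv i (\sum_(l <- r | P l) F l) = \sum_(l <- r | P l) fps_deriv i (F l).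
Proof.
elim/big_rec2: _ => [|l y1 y2 _ <-]; last exact: fps_derivD.
by apply: fpsP => m; rewrite fcoef_deriv !fcoef0 mul0rn.
Qed.

Lemma fps_deriv_mulmx n (R : comNzRingType) (i : 'I_n) p q r
    (A : 'M[fps n R]_(p, q)) (B : 'M[fps n R]_(q, r)) :
  map_mx (fps_deriv i) (A *m B) =
  map_mx (fps_deriv i) A *m B + A *m map_mx (fps_deriv i) B.
Proof.
apply/matrixP => l m; rewrite !mxE fps_deriv_sum -big_split.
by apply: eq_bigr => j _; rewrite !mxE fps_derivM /=; ring.
Qed.

Lemma mulmx_lincomb (R : comPzRingType) a b r t (I : finType) (u : I -> R) (Y : 'M[R]_(t, b))
    (Z : I -> 'M[R]_(b, a)) (W : 'M[R]_(a, r)) l q :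
  (Y *m (\sum_i u i *: Z i) *m W) l q = \sum_i u i * (Y *m Z i *m W) l q.
Proof.
rewrite mulmx_sumr mulmx_suml summxE; apply: eq_bigr => i _.
by rewrite -scalemxAr -scalemxAl mxE.
Qed.

Lemma splits_transport (k : fieldType) a b n e r t (M : 'M[k]_(b, a))
    (kap : 'M[k]_(a, r)) (gam : 'M[k]_(b, t)) om sig tau
    (Q : 'M[k]_(e, b)) (Q' : 'M[k]_(b, e)) (P : 'M[k]_(a, n)) (P' : 'M[k]_(n, a)) :
  Q *m Q' = 1%:M -> Q' *m Q = 1%:M -> P *m P' = 1%:M -> P' *m P = 1%:M ->
  splits M kap gam om sig tau ->
  splits (Q *m M *m P) (P' *m kap) (Q *m gam) (om *m Q') (P' *m sig *m Q') (tau *m P).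
Proof.
move=> QQ' Q'Q PP' P'P [e1 e2 e3 [e4 e5 e6]].
split; last split.
- have -> : Q *m M *m P *m (P' *m sig *m Q') = Q *m (M *m sig) *m Q'.
    by rewrite -!mulmxA [P *m (P' *m _)]mulmxA PP' mul1mx.
  by rewrite -[Q *m gam *m _]mulmxA [gam *m _]mulmxA [Q *m (gam *m om *m Q')]mulmxA
    -mulmxDl -mulmxDr e1 mulmx1.
- have -> : P' *m sig *m Q' *m (Q *m M *m P) = P' *m (sig *m M) *m P.
    by rewrite -!mulmxA [Q' *m (Q *m _)]mulmxA Q'Q mul1mx.
  by rewrite -[P' *m kap *m _]mulmxA [kap *m _]mulmxA [P' *m (kap *m tau *m P)]mulmxA
    -mulmxDl -mulmxDr e2 mulmx1.
- by rewrite -!mulmxA [P *m (P' *m _)]mulmxA PP' mul1mx e3 mulmx0.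
- by rewrite -!mulmxA [Q' *m (Q *m _)]mulmxA Q'Q mul1mx mulmxA e4 mul0mx.
- by rewrite -!mulmxA [Q' *m (Q *m _)]mulmxA Q'Q mul1mx.
- by rewrite -!mulmxA [P *m (P' *m _)]mulmxA PP' mul1mx.
Qed.

(** The Leibniz rule produces two more terms, in which [Q] or [P] is differentiated. One is killed
    by the kernel on the right, the other by the cokernel on the left: this is why the intrinsic
    differential does not depend on the bases. *)
Lemma basis_change_deriv (k : fieldType) n a b e r t (i : 'I_n)
    (Q : 'M[fps n k]_(e, b)) (M : 'M[fps n k]_(b, a)) (P : 'M[fps n k]_(a, n))
    (om : 'M[k]_(t, e)) (kap : 'M[k]_(n, r)) (z := fun p q (A : 'M[fps n k]_(p, q)) => map_mx (@fps0 n k) A) :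
  om *m z _ _ Q *m z _ _ M = 0 -> z _ _ M *m (z _ _ P *m kap) = 0 ->
  om *m z _ _ (map_mx (fps_deriv i) (Q *m M *m P)) *m kap =
  om *m z _ _ Q *m z _ _ (map_mx (fps_deriv i) M) *m (z _ _ P *m kap).
Proof.
move=> omM Mkap.
have zM p q s (Y : 'M[fps n k]_(p, q)) (Z : 'M[fps n k]_(q, s)) : z _ _ (Y *m Z) = z _ _ Y *m z _ _ Z.
  by apply/matrixP => l m; rewrite !mxE fps0_sum; apply: eq_bigr => j _; rewrite !mxE fps0M.
have zD p q (Y Z : 'M[fps n k]_(p, q)) : z _ _ (Y + Z) = z _ _ Y + z _ _ Z.
  by apply/matrixP => l m; rewrite !mxE fps0D.
rewrite !fps_deriv_mulmx mulmxDl !zD !zM !mulmxDr !mulmxDl !mulmxA omM !mul0mx addr0.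
by rewrite -!mulmxA Mkap !mulmx0 add0r !mulmxA.
Qed.

Section SecondLocus.
Variables (k : closedFieldType) (X : scheme k) (n d : nat) (le_dn : (d < n)%N).
Variables (Om : differentials X) (E : modsheaf X) (T : tensor_product Om E).
Variable nabla : forall U : opens X, msec E U -> msec T U.
Hypothesis nabla_connection : is_connection nabla.
Variables (s : msec E (opensT X)) (j : nat) (x : X).
Variables (c : {rmorphism stalk x -> fps n k}) (c_chart : formal_chart c).
Variables (U : opens X) (Ux : U x) (v : 'I_d.+1 -> msec E U) (f : 'I_d.+1 -> sec U).
Variable xs : 'I_n -> sec U.
Hypotheses (v_basis : is_basis v) (v_horizontal : forall l, nabla (v l) = 0).
Hypothesis s_f : restrict U s = \sum_l f l *: v l.
Hypothesis xs_basis : is_basis (fun a => diff Om (xs a)).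
Hypothesis c_xs : forall i, c (germ Ux (xs i)) = fps_var k i.
Hypothesis f_top : forall m : 'I_d, exists a,
  c (germ Ux (f (widen_ord (leqnSn d) m))) =
  fps_const n a + fps_var k (widen_ord (ltnW le_dn) m).

Let F m := c (germ Ux (f m)).

(** Compares the unknown frame of [second_locus] with the coordinates and the horizontal basis, in
    which the matrix of [nabla s] is the Jacobian of the [f_l]. The last identity writes each
    partial derivative as a combination of the derivations dual to [om]. *)
Lemma jacobian_frame (U' : opens X) (Ux' : U' x) (a b : nat)
    (om : 'I_a -> msec Om U') (v' : 'I_b -> msec E U')
    (M : 'M[sec U']_(b, a)) (dM : 'I_a -> 'M[sec U']_(b, a)) :
  is_basis om -> is_basis v' ->
  nabla (restrict U' s) = \sum_l \sum_i M l i *: tens T (om i) (v' l) ->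
  (forall l i, diff Om (M l i) = \sum_i' dM i' l i *: om i') ->
  let ch p q (A : 'M[sec U']_(p, q)) := map_mx (fun z => c (germ Ux' z)) A in
  exists (Q : 'M[fps n k]_(d.+1, b)) (Q' : 'M_(b, d.+1)) (P : 'M_(a, n)) (P' : 'M_(n, a)),
    [/\ Q *m Q' = 1%:M, Q' *m Q = 1%:M, P *m P' = 1%:M, P' *m P = 1%:M
      & \matrix_(m, i) fps_deriv i (F m) = Q *m ch _ _ M *m P /\
        forall p, map_mx (fps_deriv p) (ch _ _ M) = \sum_i P i p *: ch _ _ (dM i)].
Proof.
move=> om_basis v'_basis nM dME ch.
have [phi phiP] := choice (fun p => @deriv_fiber_map k X x _ c Om (fps_deriv p)
  (@fps_derivD _ _ p) (@fps_derivM _ _ p)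
  (fun V (Vx : V x) b => etrans (congr1 (fun z => fps_deriv p (c z)) (germ_const Vx b))
     (etrans (congr1 (fps_deriv p) (chart_const c_chart b)) (fps_derivC _ _)))).
have [psi psiP] := choice (fun m => @basis_fiber_map k X x _ c E U Ux _ v m v_basis).
have phi_fib p := (phiP p).1; have phiE p := (phiP p).2.
have psi_fib p := (psiP p).1; have psiE p := (psiP p).2.
have phi_xs p i : phi p U Ux (diff Om (xs i)) = (i == p)%:R.
  by rewrite phiE c_xs fps_derivX.
have [P' [P'P PP']] := basis_change Ux' xs_basis om_basis phi_fib phi_xs.
have [S [SQ QS]] := basis_change Ux' v_basis v'_basis psi_fib (fun i l => psiE i l).
set P := (\matrix_(_, _) _ : 'M_(a, n)) in P'P PP'.
set Q := (\matrix_(_, _) _ : 'M_(b, d.+1)) in SQ QS.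
exists Q^T, S^T, P, P'; split=> //; rewrite -?trmx_mul ?SQ ?QS ?trmx1 //; split; last first.
  move=> p; apply/matrixP => l i; rewrite summxE !mxE.
  have := congr1 (phi p U' Ux') (dME l i); rewrite phiE => ->.
  rewrite (fiber_map_sum _ _ _ _ (phi_fib p)); apply: eq_bigr => i' _.
  by have [_ pZ _] := phi_fib p; rewrite pZ !mxE mulrC.
have [nD _ nR nL] := nabla_connection.
have n0 : nabla (0 : msec E U) = 0.
  by apply: (addrI (nabla 0)); rewrite -nD !addr0.
(* Horizontality of the [v l] leaves only the terms [d f_l] tensor [v_l] of the Leibniz rule. *)
have nablaU : nabla (restrict U s) = \sum_l tens T (diff Om (f l)) (v l).
  rewrite s_f (big_morph _ (nD U) n0); apply: eq_bigr => l _.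
  by rewrite nL v_horizontal scaler0 addr0.
apply/matrixP => m i; rewrite [LHS]mxE.
have [chi [chi_fib chiE]] := tensor_fiber_map T (phi_fib i) (psi_fib m).
have [cD cZ cr] := chi_fib; have [pD pZ pr] := phi_fib i; have [qD qZ qr] := psi_fib m.
have chiU : chi U Ux (nabla (restrict U s)) = fps_deriv i (F m).
  rewrite nablaU (fiber_map_sum _ _ _ _ chi_fib) (bigD1 m) //= big1 => [|l lm].
    by rewrite chiE phiE psiE eqxx mulr1 addr0.
  by rewrite chiE psiE (negPf lm) mulr0.
have [_ mr _] := mres_sheaf E.
pose V := opensI U U'.
have i1 : V `<=` U by move=> y [].
have i2 : V `<=` U' by move=> y [].
have Vx : V x by split.
have -> : fps_deriv i (F m) = chi U' Ux' (nabla (restrict U' s)).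
  rewrite -chiU -(cr _ _ i1 Ux Vx) -(cr _ _ i2 Ux' Vx) -!nR; congr (chi V Vx (nabla _)).
  by rewrite /restrict !(mr (opensT X) _ V _ _ (@subsetT X V)).
rewrite nM (fiber_map_sum _ _ _ _ chi_fib).
rewrite -mulmxA [RHS]mxE; apply: eq_bigr => l _.
rewrite (fiber_map_sum _ _ _ _ chi_fib) [(_ *m P) _ _]mxE mulr_sumr; apply: eq_bigr => i' _.
by rewrite cZ chiE !mxE /=; ring.
Qed.

Theorem second_locus_hessian :
  second_locus nabla s 1 j x -> ~ second_locus nabla s 1 j.+1 x ->
  [/\ forall i : 'I_n, (d <= i)%N -> fps0 (fps_deriv i (F ord_max)) = 0,
      (j <= n - d)%N
    & \rank (\matrix_(a, b) fps0 (fps_deriv (shift_ord le_dn a)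
               (fps_deriv (shift_ord le_dn b) (F ord_max)))) = (n - d - j)%N].
Proof.
case=> U' [Ux' [a [b [om [v' [M [dM [[om_basis v'_basis nM dME] [Mx1 nMx2 [B [pi [pi_surj pi_ker sid]]]]]]]]]]]].
move=> x_notin.
(* Non-membership excludes every choice of frame and presentation, so it may be used with those
   provided by membership; both conditions then concern the same matrix [Dm]. *)
have nsid : ~ second_intrinsic_degeneracy pi (map_mx (germ Ux') M)
    (fun c => map_mx (germ Ux') (dM c)) j.+1.
  move=> h; apply: x_notin; exists U', Ux', a, b, om, v', M, dM.
  by split=> //; split=> //; exists B, pi.
have [Q [Q' [P [P' [QQ' Q'Q PP' P'P [FE dMP]]]]]] := jacobian_frame Ux' om_basis v'_basis nM dME.
pose ev0 : {rmorphism stalk x -> k} := @fps0 n k \o c.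
have ev0_unit z : nonunits (stalk x) z <-> ev0 z = 0 by apply: chart_local.
set Mx := map_mx (germ Ux') M in Mx1 nMx2 pi_ker sid nsid.
(* The minors cutting out [Sigma] vanish at [x], so evaluation at [x] factors through [B]. With
   denominators 1, [localization_lift] is the factorization through a quotient. *)
have [eb ebE] : exists eb : {rmorphism B -> k}, forall z, eb (pi z) = ev0 z.
  apply: localization_lift => [z|p].
    have [y <-] := pi_surj z; exists y, 1; rewrite !rmorph1 mul1r; split=> //.
    by exists 1; rewrite mulr1.
  move=> /pi_ker; apply: (ideal_gen_sub (I := [set p | ev0 p = 0])).
    split=> [|u w eu ew|u w ew]; first exact: (rmorph0 ev0).
      by change (ev0 (u + w) = 0); rewrite rmorphD (eu : ev0 u = 0) (ew : ev0 w = 0) addr0.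
    by change (ev0 (u * w) = 0); rewrite rmorphM (ew : ev0 w = 0) mulr0.
  move=> z mz; apply/ev0_unit; case: Mx1 => _; apply.
  exact: mz.
have eb_unit z : nonunits B z <-> eb z = 0.
  have [y <-] := pi_surj z; rewrite ebE -ev0_unit; split=> h [w hw]; apply: h.
    by exists (pi w); rewrite -rmorphM hw rmorph1.
  have [w' w'E] := pi_surj w; subst w.
  apply: contrapT => /ev0_unit y0.
  have := congr1 eb hw; rewrite -rmorphM ebE rmorphM y0 mul0r rmorph1 => /eqP.
  by rewrite eq_sym oner_eq0.
have [r [t [kap [gam [Dm [kerM kap_inj cok DmE Dj]]]]]] := sid.
have nDj : ~ in_degeneracy Dm j.+1.
  by move=> h; apply: nsid; exists r, t, kap, gam, Dm.
have [omB [sig [tau spB]]] := splits_exists kerM kap_inj cok.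
pose z p q (A : 'M[fps n k]_(p, q)) := map_mx (@fps0 n k) A.
pose zc p q (A : 'M[sec U']_(p, q)) := map_mx (fun y => fps0 (c (germ Ux' y))) A.
have zM p q s' (Y : 'M[fps n k]_(p, q)) (Z : 'M[fps n k]_(q, s')) : z _ _ (Y *m Z) = z _ _ Y *m z _ _ Z.
  by apply/matrixP => l m; rewrite !mxE fps0_sum; apply: eq_bigr => j' _; rewrite !mxE fps0M.
have z1 p : z p p 1%:M = 1%:M.
  by apply/matrixP => l m; rewrite !mxE; case: eqP => _; rewrite ?fps01 // /fps0.
have zch p q (A : 'M[sec U']_(p, q)) : z _ _ (map_mx (fun y => c (germ Ux' y)) A) = zc _ _ A.
  by apply/matrixP => l m; rewrite !mxE.
have spk := splits_map eb spB.
have MxE : map_mx eb (map_mx pi Mx) = zc _ _ M.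
  by apply/matrixP => l m; rewrite !mxE ebE.
rewrite MxE in spk.
set kapk := map_mx eb kap in spk; set gamk := map_mx eb gam in spk.
set omk := map_mx eb omB in spk; set sigk := map_mx eb sig in spk.
set tauk := map_mx eb tau in spk.
have zQQ' : z _ _ Q *m z _ _ Q' = 1%:M by rewrite -zM QQ' z1.
have zQ'Q : z _ _ Q' *m z _ _ Q = 1%:M by rewrite -zM Q'Q z1.
have zPP' : z _ _ P *m z _ _ P' = 1%:M by rewrite -zM PP' z1.
have zP'P : z _ _ P' *m z _ _ P = 1%:M by rewrite -zM P'P z1.
have sp := splits_transport zQQ' zQ'Q zPP' zP'P spk.
pose Fk := \matrix_(m < d.+1, i < n) fps0 (fps_deriv i (F m)).
have FkE : z _ _ Q *m zc _ _ M *m z _ _ P = Fk.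
  by rewrite -zch -!zM -FE; apply/matrixP => m i; rewrite !mxE.
rewrite FkE in sp.
pose HH p := \matrix_(m < d.+1, i < n) fps0 (fps_deriv p (fps_deriv i (F m))).
have HHE p : HH p = z _ _ (map_mx (fps_deriv p) (Q *m map_mx (fun y => c (germ Ux' y)) M *m P)).
  by rewrite -FE; apply/matrixP => m i; rewrite !mxE.
have [_ _ e3 [e4 _ _]] := spk.
have hessE p : omk *m z _ _ Q' *m HH p *m (z _ _ P' *m kapk) =
    omk *m (\sum_i fps0 (P i p) *: zc _ _ (dM i)) *m kapk.
  rewrite HHE basis_change_deriv.
  - rewrite -[omk *m _ *m z _ _ Q]mulmxA zQ'Q mulmx1 [z _ _ P *m _]mulmxA zPP' mul1mx.
    congr (_ *m _ *m _); rewrite dMP; apply/matrixP => l m; rewrite !mxE !summxE fps0_sum.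
    by apply: eq_bigr => i _; rewrite !mxE fps0M.
  - by rewrite -[omk *m _ *m _]mulmxA -/(z _ _ Q) zQ'Q mulmx1 -/(z _ _ _) zch.
  - by rewrite [_ *m (_ *m kapk)]mulmxA -/(z _ _ P) zPP' mul1mx -/(z _ _ _) zch.
pose Dk (ql : 'I_r * 'I_t) p := eb (Dm ql p).
have Dk_E p q l : Dk (q, l) p = \sum_i (z _ _ P' *m kapk) i p *
    (omk *m z _ _ Q' *m HH i *m (z _ _ P' *m kapk)) l q.
  have [u uE] := DmE p q.
  have [_ _ _ [o4 o5 _]] := spB.
  (* Multiplication by [omB] kills the image of [M] and isolates the coordinates of the class in the
     cokernel. *)
  have {}uE := congr1 (mulmx omB) uE.
  rewrite mulmxDr [X in _ + X]mulmxA o4 mul0mx addr0 [X in _ = X]mulmxA o5 mul1mx in uE.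
  have := congr1 (fun Y : 'cV_t => eb (Y l 0)) uE; rewrite [X in _ = eb X]mxE -/(Dk _ _) => <-.
  under [RHS]eq_bigr do rewrite hessE mulmx_lincomb mulr_sumr.
  rewrite exchange_big /= mulmxA mulmx_lincomb rmorph_sum; apply: eq_bigr => i' _.
  have -> : \sum_i (z _ _ P' *m kapk) i p * (fps0 (P i' i) * (omk *m zc _ _ (dM i') *m kapk) l q) =
      kapk i' p * (omk *m zc _ _ (dM i') *m kapk) l q.
    have -> : kapk i' p = \sum_i z _ _ P i' i * (z _ _ P' *m kapk) i p.
      by rewrite -[LHS](congr1 (fun Y : 'M_(a, r) => Y i' p) (mul1mx kapk)) -zPP' -mulmxA mxE.
    by rewrite mulr_suml; apply: eq_bigr => i _; rewrite [z _ _ P i' i]mxE; ring.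
  rewrite rmorphM !mxE; congr (_ * _).
  rewrite rmorph_sum; apply: eq_bigr => y _; rewrite rmorphM !mxE; congr (_ * _).
  by rewrite rmorph_sum; apply: eq_bigr => y' _; rewrite rmorphM !mxE ebE.
have an : a = n := mulmx1_square zPP' zP'P.
have be : b = d.+1 := mulmx1_square zQ'Q zQQ'.
have rkF : (\rank Fk < d.+1)%N.
  have sz : degeneracy_size 'I_b 'I_a 1 = d.+1.
    by rewrite /degeneracy_size !card_ord an be subn1 /=; apply/minn_idPl.
  rewrite ltnNge; apply/negP => rk.
  have : (degeneracy_size 'I_b 'I_a 1 <= \rank (zc _ _ M))%N.
    rewrite sz; apply: leq_trans rk _; rewrite -FkE.
    by apply: leq_trans (mxrankM_maxl _ _) (mxrankM_maxr _ _).
  move=> /rank_minor[g [h /eqP]]; apply.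
  have -> : mxsub g h (zc _ _ M) = map_mx ev0 (\matrix_(i, l) Mx (g i) (h l)).
    by apply/matrixP => i l; rewrite !mxE.
  by rewrite det_map_mx; apply/ev0_unit; case: Mx1 => _; apply; exists g, h.
have F_top (m : 'I_d) i : Fk (widen_ord (leqnSn d) m) i = (widen_ord (ltnW le_dn) m == i)%:R.
  have [a0 fa] := f_top m; rewrite mxE /F fa fps_derivD fps_derivC add0r fps_derivX.
  by case: eqP => _; rewrite ?fps01 // /fps0.
have HH_top p (m : 'I_d) i : HH p (widen_ord (leqnSn d) m) i = 0.
  have [a0 fa] := f_top m; rewrite mxE /F fa fps_derivD fps_derivC add0r fps_derivX.
  have -> : (widen_ord (ltnW le_dn) m == i)%:R = fps_const n (widen_ord (ltnW le_dn) m == i)%:R :> fps n k.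
    by rewrite rmorph_nat.
  by rewrite fps_derivC /fps0.
have minors_eb p y : minors Dk p y -> exists2 y', minors Dm p y' & eb y' = y.
  move=> [g [h ->]]; exists (\det (\matrix_(c, d) Dm (g c) (h d))); first by exists g, h.
  by rewrite -det_map_mx; congr (\det _); apply/matrixP => l m; rewrite !mxE.
have minors_eb' p y : minors Dm p y -> minors Dk p (eb y).
  move=> [g [h ->]]; exists g, h.
  by rewrite -det_map_mx; congr (\det _); apply/matrixP => l m; rewrite !mxE.
have hr := hessian_rank F_top HH_top rkF sp Dk_E.
have [F_last jd rk] : [/\ forall i : 'I_n, (d <= i)%N -> Fk ord_max i = 0, (j <= n - d)%N &
    \rank (\matrix_(a, b) HH (shift_ord le_dn a) ord_max (shift_ord le_dn b)) = (n - d - j)%N].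
  apply: hr.
    by move=> y /minors_eb[y' my' <-]; apply/eb_unit; case: Dj => _; apply.
  move=> [jle h]; apply: nDj; split=> // y /minors_eb' my.
  by apply/eb_unit; apply: h.
split=> //.
  by move=> i /F_last; rewrite mxE.
by rewrite -rk; congr (\rank _); apply/matrixP => l m; rewrite !mxE.
Qed.

End SecondLocus.

(** The rank normal form of [P] writes it as an invertible block followed by zeros, times an
    invertible matrix; an identity block completes the first factor. *)
Lemma complete_rows (k : fieldType) m N (P : 'M[k]_(m, N)) : row_free P ->
  exists2 R : 'M[k]_N, R \in unitmx &
    forall (i : 'I_m) (a b : 'I_N), i = a :> nat -> R a b = P i b.
Proof.
move=> fP; have mN : (m <= N)%N by rewrite -(eqP fP) rank_leq_col.
have [q NE] : exists q, N = (m + q)%N by exists (N - m)%N; rewrite subnKC.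
subst N; exists (block_mx (col_ebase P) 0 0 1%:M *m row_ebase P).
  by rewrite unitmx_mul row_ebase_unit andbT unitmxE det_ublock det1 mulr1 -unitmxE col_ebase_unit.
have PE : P = row_mx (col_ebase P) 0 *m row_ebase P.
  by rewrite -[LHS]mulmx_ebase (eqP fP) pid_mx_row mul_mx_row mulmx1 mulmx0.
move=> i a b ia; have -> : a = lshift q i by apply: val_inj.
rewrite [in RHS]PE -[block_mx _ _ _ _]/(col_mx (row_mx _ _) (row_mx _ _)) mul_col_mx.
by rewrite col_mxEu.
Qed.

Lemma castmx_unit (k : fieldType) N n (eN : N = n) (M : 'M[k]_N) :
  (castmx (eN, eN) M \in unitmx) = (M \in unitmx).
Proof. by case: n / eN; rewrite castmx_id. Qed.

(** * Taylor coefficients up to order two *)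

Section SecondOrder.
Variables (n : nat) (k : fieldType).
Implicit Types f g : fps n k.
Local Notation w1 := (@unit_weight n).

Lemma fps_expand1 f : f = fps_const n (fps0 f) + \sum_i fps_var k i * fps_quo predT i f.
Proof.
rewrite {1}(fps_quo_rem predT f); congr (_ + _).
apply: fpsP => m; rewrite fcoef_rem fps_constE.
have -> : [forall l, predT l ==> (m l == 0%N)] = (m == mnm0).
  apply/forallP/eqP => [h|-> l]; last by rewrite mnm0E.
  by apply/mnmP => l; rewrite mnm0E; apply/eqP; apply: h.
by case: eqP => [->|]; rewrite ?mulr1 ?mulr0.
Qed.

Lemma fps0_quo i f : fps0 (fps_quo predT i f) = fcoef f (mnm1 i).
Proof.
rewrite /fps0 fcoef_quo add0m; case: ifP => // /negP[]; apply/forallP => l.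
by rewrite mnm0E implybT.
Qed.

(** A triangular matrix of the quadratic part: the coefficient of [x_i x_l] stands at [(i, l)] for
    [i <= l], undivided, so that it makes sense in characteristic 2. *)
Definition quad_coef f i l := fps0 (fps_quo predT l (fps_quo predT i f)).

Lemma quad_coefE f (i l : 'I_n) :
  quad_coef f i l = if (l < i)%N then 0 else fcoef f (mnm_add (mnm1 i) (mnm1 l)).
Proof.
rewrite /quad_coef fps0_quo fcoef_quo addmC; case: ltnP => il; case: ifP => // /forallP h.
  by have := h l; rewrite /= il mnm1E eqxx.
case: h => l'; apply/implyP => /= l'i; rewrite mnm1E eqb0.
by apply: contraTneq l'i => <-; rewrite -leqNgt.
Qed.

Lemma quad_approx f :
  ord_ge w1 3 (f - (fps_const n (fps0 f) + \sum_i fps_const n (fcoef f (mnm1 i)) * fps_var k i +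
    \sum_i \sum_l fps_const n (quad_coef f i l) * (fps_var k i * fps_var k l))).
Proof.
have v1 i : ord_ge w1 1 (fps_var k i) by exact: (@ord_ge_var _ k w1 i).
have -> : f - (fps_const n (fps0 f) + \sum_i fps_const n (fcoef f (mnm1 i)) * fps_var k i +
    \sum_i \sum_l fps_const n (quad_coef f i l) * (fps_var k i * fps_var k l)) =
  \sum_i \sum_l fps_var k i * (fps_var k l *
     (fps_quo predT l (fps_quo predT i f) - fps_const n (quad_coef f i l))).
  rewrite {1}(fps_expand1 f) -addrA [_ + \sum_i _ * _]addrC.
  under eq_bigr do rewrite {1}(fps_expand1 (fps_quo predT _ f)) fps0_quo mulrDr mulr_sumr.
  rewrite big_split /=.
  under [RHS]eq_bigr do under eq_bigr do rewrite !mulrBr.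
  under [RHS]eq_bigr do rewrite sumrB.
  rewrite sumrB.
  have -> : \sum_i fps_var k i * fps_const n (fcoef f (mnm1 i)) =
            \sum_i fps_const n (fcoef f (mnm1 i)) * fps_var k i.
    by apply: eq_bigr => i _; rewrite mulrC.
  have -> : \sum_i \sum_l fps_var k i * (fps_var k l * fps_const n (quad_coef f i l)) =
            \sum_i \sum_l fps_const n (quad_coef f i l) * (fps_var k i * fps_var k l).
    by apply: eq_bigr => i _; apply: eq_bigr => l _; ring.
  by ring.
apply: ord_ge_sum => i _; apply: ord_ge_sum => l _.
have r1 : ord_ge w1 1 (fps_quo predT l (fps_quo predT i f) - fps_const n (quad_coef f i l)).
  by apply/(@ord_ge1 _ _ w1) => //; rewrite fps0B fps0_const subrr.
exact: (@ord_geM _ _ w1 1 2 _ _ (v1 i) (@ord_geM _ _ w1 1 1 _ _ (v1 l) r1)).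
Qed.

Lemma fcoefX2 a g p q : fcoef (fps_var k a * g) (mnm_add (mnm1 p) (mnm1 q)) =
  if a == p then fcoef g (mnm1 q) else if a == q then fcoef g (mnm1 p) else 0.
Proof.
case: eqP => [->|ap]; first by rewrite addmC fcoefXm.
case: eqP => [->|aq]; first by rewrite fcoefXm.
by apply: fcoefX0; rewrite mnmDE !mnm1E; do 2![case: eqP => [e|_]; first by [case: ap | case: aq]].
Qed.

Lemma fcoef_linM (L : 'M[k]_n) i g p q :
  fcoef (fps_lin L i * g) (mnm_add (mnm1 p) (mnm1 q)) =
  L i p * fcoef g (mnm1 q) + (p != q)%:R * (L i q * fcoef g (mnm1 p)).
Proof.
rewrite /fps_lin mulr_suml fcoef_sum.
under eq_bigr do rewrite -mulrA fcoefC fcoefX2.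
rewrite (bigD1 p) //= eqxx; congr (_ + _).
have [->|pq] := eqVneq p q.
  by rewrite mul0r big1 // => a aq; rewrite !(negPf aq) mulr0.
rewrite mul1r (bigD1 q) /=; last by rewrite eq_sym.
rewrite [q == p]eq_sym (negPf pq) eqxx big1 ?addr0 // => a /andP[ap aq].
by rewrite (negPf ap) (negPf aq) mulr0.
Qed.

Lemma fcoef_subst_lin1 (L : 'M[k]_n) f p :
  fcoef (fps_subst (fps_lin L) f) (mnm1 p) = \sum_i fcoef f (mnm1 i) * L i p.
Proof.
pose s := subst_rmorphism (@fps_lin0 _ _ L).
have L0 := @fps_lin0 _ _ L.
have h : ord_ge w1 2 (f - (fps_const n (fps0 f) + \sum_i fps_const n (fcoef f (mnm1 i)) * fps_var k i)).
  have := @fps_lin_approx _ _ (f - fps_const n (fps0 f)).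
  rewrite fps0B fps0_const subrr => /(_ erefl); rewrite opprD addrA.
  congr (ord_ge _ _ (_ - _)); apply: eq_bigr => i _.
  rewrite fcoefB fps_constE (_ : (mnm1 i == mnm0) = false) ?mulr0 ?subr0 //.
  by apply/eqP => /(congr1 (@mdeg n)); rewrite mdeg0 mdeg1.
have := fps_subst_ord1 L0 h (m := mnm1 p); rewrite wdeg_unit mdeg1 => /(_ isT).
rewrite -[fps_subst _ _]/(s _) rmorphB rmorphD rmorph_sum fcoefB => /eqP.
rewrite subr_eq0 => /eqP ->; rewrite [s (fps_const _ _)]fps_substC // fcoefD fps_constE.
rewrite (_ : (mnm1 p == mnm0) = false) ?mulr0 ?add0r; last first.
  by apply/eqP => /(congr1 (@mdeg n)); rewrite mdeg0 mdeg1.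
rewrite fcoef_sum; apply: eq_bigr => i _.
by rewrite rmorphM [s (fps_const _ _)]fps_substC // [s (fps_var _ _)]fps_substX // fcoefC fcoef_lin.
Qed.

(** The transformed matrix is no longer triangular: a mixed monomial collects both symmetric
    entries, a square only the diagonal one. *)
Lemma fcoef_subst_lin2 (L : 'M[k]_n) f p q (A := \matrix_(i, l) quad_coef f i l) :
  fcoef (fps_subst (fps_lin L) f) (mnm_add (mnm1 p) (mnm1 q)) =
  (L^T *m A *m L) p q + (p != q)%:R * (L^T *m A *m L) q p.
Proof.
pose s := subst_rmorphism (@fps_lin0 _ _ L).
have L0 := @fps_lin0 _ _ L; set m := mnm_add _ _.
have := fps_subst_ord1 L0 (@quad_approx f) (m := m).
rewrite wdeg_unit mdegD !mdeg1 => /(_ isT).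
rewrite -[fps_subst _ _]/(s _) rmorphB !rmorphD !rmorph_sum fcoefB => /eqP.
rewrite subr_eq0 => /eqP ->; rewrite !fcoefD [s (fps_const _ _)]fps_substC // fps_constE.
have m0 : (m == mnm0) = false.
  by apply/eqP => /(congr1 (@mdeg n)); rewrite mdegD mdeg0 !mdeg1.
rewrite m0 mulr0 add0r fcoef_sum big1 ?add0r => [|i _]; last first.
  rewrite rmorphM [s (fps_const _ _)]fps_substC // [s (fps_var _ _)]fps_substX // fcoefC.
  rewrite -[fps_lin L i]mulr1 fcoef_linM !fcoef1.
  by rewrite !(_ : forall l, (mnm1 l == mnm0) = false) ?mulr0 ?addr0 ?mulr0 // => l;
     apply/eqP => /(congr1 (@mdeg n)); rewrite mdeg0 mdeg1.
have E p' q' : (L^T *m A *m L) p' q' = \sum_i \sum_l quad_coef f i l * (L i p' * L l q').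
  rewrite -mulmxA [LHS]mxE; apply: eq_bigr => i _.
  rewrite [(A *m L) i q']mxE mulr_sumr; apply: eq_bigr => l _.
  by rewrite !mxE; ring.
rewrite !E mulr_sumr -big_split fcoef_sum; apply: eq_bigr => i _.
rewrite rmorph_sum fcoef_sum [in RHS]/= mulr_sumr -big_split; apply: eq_bigr => l _.
rewrite !rmorphM [s (fps_const _ _)]fps_substC //.
rewrite [s (fps_var _ i)]fps_substX // [s (fps_var _ l)]fps_substX // fcoefC fcoef_linM !fcoef_lin.
rewrite [RHS]/=; ring.
Qed.

End SecondOrder.

(** * Reduction to the normal form *)

Section NormalForm.
Variables (k : closedFieldType) (n d j : nat) (le_dn : (d < n)%N) (F : fps n k).
Local Notation sh := (shift_ord le_dn).
Let m := (n - d - j)%N.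
Let char2 := 2%N \in [pchar k].

Hypothesis F_lin : forall i : 'I_n, (d <= i)%N -> fps0 (fps_deriv i F) = 0.
Hypothesis le_j : (j <= n - d)%N.
Hypothesis F_hess :
  \rank (\matrix_(a, b) fps0 (fps_deriv (sh a) (fps_deriv (sh b) F))) = m.

Definition normal_gram p : 'M[k]_p :=
  \matrix_(i, l) if char2 then (~~ odd i && (l == i.+1 :> nat))%:R else (i == l)%:R.

Lemma le_m : (m <= n - d)%N. Proof. by rewrite /m leq_subr. Qed.
Definition mid (i : 'I_m) : 'I_n := sh (widen_ord le_m i).

Lemma mid_inj : injective mid.
Proof.
move=> i l /shift_ord_inj /(congr1 val) /= il; exact: val_inj.
Qed.

Lemma mem_mid (i : 'I_n) : (i \in codom mid) = middle d.+1 j i.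
Proof.
rewrite /middle /=; apply/codomP/andP => [[l ->]|[di ij]] /=.
  by have := ltn_ord l; rewrite /m; split; lia.
have im : (i - d < m)%N by have := ltn_ord i; rewrite /m; lia.
by exists (Ordinal im); apply: val_inj; rewrite /= subnKC.
Qed.

Lemma big_mid (Q : pred 'I_n) (V : nmodType) (f : 'I_n -> V) :
  \sum_(i < n | middle d.+1 j i && Q i) f i = \sum_(i < m | Q (mid i)) f (mid i).
Proof.
rewrite big_mkcondr [RHS]big_mkcond /=.
under eq_bigl do rewrite -mem_mid.
rewrite -big_uniq; last exact/injectiveP/mid_inj.
by rewrite big_map big_enum.
Qed.

Lemma normal_quadricE :
  fps_quad (normal_gram m) (fun i => fps_var k (mid i)) = normal_quadric k n d.+1 j.
Proof.
rewrite /normal_quadric -/char2 /fps_quad; case: ifP => c2.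
  rewrite [RHS](big_mid (fun i : 'I_n => ~~ odd (i - d))) [RHS]big_mkcond.
  apply: eq_bigr => i _; rewrite (_ : (mid i - d = i)%N); last by rewrite /= addKn.
  rewrite (big_mid (fun l : 'I_n => l == (mid i).+1 :> nat)).
  case: ifP => oi; last by rewrite big1 // => l _; rewrite mxE c2 oi rmorph0 mul0r.
  rewrite [RHS]big_mkcond; apply: eq_bigr => l _; rewrite mxE c2 oi /= -addnS eqn_add2l.
  by case: eqP; rewrite ?rmorph1 ?mul1r ?rmorph0 ?mul0r.
rewrite (eq_bigl (fun i : 'I_n => middle d.+1 j i && true)) => [|i]; last by rewrite andbT.
rewrite big_mid; apply: eq_bigr => i _.
rewrite (bigD1 i) //= big1 => [|l li]; rewrite mxE c2.
  by rewrite eqxx rmorph1 mul1r addr0 expr2.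
by rewrite eq_sym (negPf li) rmorph0 mul0r.
Qed.

Let A := \matrix_(a < n - d, b < n - d) quad_coef F (sh a) (sh b).

Let A_hess : \rank (A + A^T)%R = m.
Proof.
rewrite -F_hess; congr (\rank _); apply/matrixP => a b; rewrite /A !mxE. rewrite !quad_coefE.
rewrite fcoef_deriv2 (inj_eq (@shift_ord_inj _ _ le_dn)) /= !ltn_add2l.
have [ab|ba|/val_inj ->] := ltngtP a b.
- by rewrite addr0 -val_eqE (ltn_eqF ab).
- by rewrite add0r -val_eqE (gtn_eqF ba) addmC.
by rewrite eqxx mulr2n.
Qed.

(** [L] is the identity on the first [d] variables and [R^T] on the others, where [R] completes the
    normalizing rows [P]. The quadratic part in the last variables becomes [R A R^T], with leading
    block [P A P^T]. *)
Lemma linear_coordinates : exists (L : 'M[k]_n) (P : 'M[k]_(m, n - d)),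
  [/\ quad_normal A P /\ (char2 -> ~~ odd m), L \in unitmx,
      forall (i l : 'I_n), (i < d)%N -> L i l = (i == l)%:R
    & forall i l, (L^T *m (\matrix_(p, q) quad_coef F p q) *m L) (mid i) (mid l) =
        (P *m A *m P^T) i l].
Proof.
have [P [nP odd_m]] : exists P : 'M_(m, n - d), quad_normal A P /\ (char2 -> ~~ odd m).
  by rewrite -A_hess; apply: quad_normal_exists.
have fP : row_free P.
  have [uP _ _] := nP; rewrite /row_free eqn_leq rank_leq_row /=.
  rewrite -[X in (X <= _)%N](mxrank_unit uP) -mulmxA; exact: mxrankM_maxl.
have [R uR RP] := complete_rows fP.
have eN : (d + (n - d))%N = n by rewrite subnKC // ltnW.
pose L := castmx (eN, eN) (block_mx 1%:M 0 0 R^T).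
have cast_sh a : cast_ord (esym eN) (sh a) = rshift d a by apply: val_inj.
have cast_top (i : 'I_n) (id : (i < d)%N) : cast_ord (esym eN) i = lshift (n - d) (Ordinal id).
  exact: val_inj.
have L_top (i l : 'I_n) : (i < d)%N -> L i l = (i == l)%:R.
  move=> id; rewrite castmxE (cast_top _ id).
  have [ld|dl] := ltnP l d.
    by rewrite (cast_top _ ld) block_mxEul mxE -[in RHS]val_eqE -val_eqE.
  have [a ->] := shift_ordP le_dn dl.
  rewrite cast_sh block_mxEur mxE -val_eqE /=.
  by have -> : (i == d + a :> nat)%N = false by lia.
have L_sh a b : L (sh a) (sh b) = R b a.
  by rewrite castmxE !cast_sh block_mxEdr mxE.
exists L, P; split=> // [|i l].
  by rewrite castmx_unit unitmxE det_ublock det1 mul1r det_tr -unitmxE.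
have Lmid (c : 'I_n) i' : (c < d)%N -> L c (mid i') = 0.
  by move=> cd; rewrite L_top // -val_eqE /=; have -> : (c == d + i' :> nat)%N = false by lia.
have L_mid a i' : L (sh a) (mid i') = P i' a by rewrite L_sh; apply: RP.
rewrite -!mulmxA [LHS]mxE [RHS]mxE (@big_shift_ord _ _ le_dn) => [|c cd]; last by rewrite mxE Lmid // mul0r.
apply: eq_bigr => a _; rewrite [L^T _ _]mxE L_mid; congr (_ * _).
rewrite [LHS]mxE [RHS]mxE (@big_shift_ord _ _ le_dn) => [|c cd]; last by rewrite Lmid // mulr0.
by apply: eq_bigr => b _; rewrite L_mid /A !mxE.
Qed.

Lemma normal_gramE P : quad_normal A P ->
  normal_gram m + (normal_gram m)^T = P *m (A + A^T) *m P^T.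
Proof.
move=> [_ dP oP]; have PSP : P *m (A + A^T) *m P^T = P *m A *m P^T + (P *m A *m P^T)^T.
  by rewrite mulmxDr mulmxDl !trmx_mul trmxK mulmxA.
apply/matrixP => i l; have [il|li|/val_inj ->] := ltngtP i l.
- rewrite oP // !mxE -/char2; case: (char2) => /=.
    by rewrite [i == _ :> nat](_ : _ = false) ?andbF ?addr0 //; apply/eqP; lia.
  by rewrite -!val_eqE (ltn_eqF il) (gtn_eqF il) addr0.
- have -> : (P *m (A + A^T) *m P^T) i l = (P *m (A + A^T) *m P^T) l i.
    by rewrite PSP [LHS]mxE [RHS]mxE addrC ![_^T _ _]mxE.
  rewrite oP // !mxE -/char2; case: (char2) => /=.
    by rewrite [l == _ :> nat](_ : _ = false) ?andbF ?add0r //; apply/eqP; lia.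
  by rewrite -!val_eqE (ltn_eqF li) (gtn_eqF li) addr0.
rewrite PSP [RHS]mxE [(_^T) l l]mxE dP !mxE -/char2; case: (char2); last by rewrite eqxx.
by rewrite [l == _ :> nat](_ : _ = false) ?andbF //; apply/eqP; lia.
Qed.

Lemma fps_quo_indep (Q : pred 'I_n) i (g : fps n k) :
  fps_indep g Q -> fps_indep (fps_quo predT i g) Q.
Proof.
move=> gQ u l Ql ul; rewrite fcoef_quo; case: ifP => // _.
by apply: (gQ _ l Ql); rewrite mnmDE addn_eq0 negb_and ul.
Qed.

Lemma fps_quo_indep0 (Q : pred 'I_n) i (g : fps n k) :
  Q i -> fps_indep g Q -> fps_quo predT i g = 0.
Proof.
move=> Qi gQ; apply: fpsP => u; rewrite fcoef_quo; case: ifP => // _.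
by rewrite (gQ _ i Qi) // mnmDE mnm1E eqxx addn1.
Qed.

(** Terms divisible by one of the first [d] variables go to the first ideal, where linear terms are
    allowed. The rest involves only the last [j] variables and has no constant or linear term, so
    two variables can be divided out. *)
Lemma indep_middle_ideal (h : fps n k) :
  fps_indep h (middle d.+1 j) -> fps0 h = 0 ->
  (forall i : 'I_n, (n - j <= i)%N -> fcoef h (mnm1 i) = 0) ->
  ideal_add
    (ideal_gen [set fps_var k i | i in [set i : 'I_n | (i < d)%N]])
    (ideal_pow (ideal_gen [set fps_var k i | i in [set i : 'I_n | (n - j <= i)%N]]) 2) h.
Proof.
move=> hP h0 h1; pose P1 : pred 'I_n := fun i => (i < d)%N.
exists (\sum_(i | P1 i) fps_var k i * fps_quo P1 i h), (fps_rem P1 h); split.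
- have I_ideal := ideal_gen_is_ideal [set fps_var k i | i in [set i : 'I_n | (i < d)%N]].
  apply: ideal_sum => // i id; rewrite mulrC; have [_ _ IM] := I_ideal; apply: IM.
  by apply: ideal_gen_mem; exists i.
- set J := ideal_gen _; have J2 := ideal_pow_is_ideal J 2; have [J0 JD JM] := J2.
  set g := fps_rem P1 h; pose Q : pred 'I_n := fun i => (i < n - j)%N.
  have gP1 : fps_indep g P1 by apply: fps_rem_indep.
  have gQ : fps_indep g Q.
    move=> u i Qi ui; have [id|di] := ltnP i d; first exact: gP1 id ui.
    rewrite fcoef_rem; case: ifP => // _; apply: (hP u i _ ui).
    by rewrite /middle /= di.
  have g0 : fps0 g = 0.
    by rewrite /fps0 fcoef_rem; case: ifP => // _; exact: h0.
  have g1 i : fcoef g (mnm1 i) = 0.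
    have [iQ|Qi] := ltnP i (n - j); first by apply: (gQ _ i iQ); rewrite mnm1E eqxx.
    by rewrite fcoef_rem; case: ifP => // _; apply: h1.
  rewrite (fps_expand1 g) g0 rmorph0 add0r; apply: ideal_sum => // i _.
  have [iQ|Qi] := ltnP i (n - j); first by rewrite (fps_quo_indep0 iQ gQ) mulr0.
  rewrite (fps_expand1 (fps_quo predT i g)) fps0_quo g1 rmorph0 add0r mulr_sumr.
  apply: ideal_sum => // l _.
  have [lQ|Ql] := ltnP l (n - j).
    by rewrite (fps_quo_indep0 lQ (fps_quo_indep i gQ)) !mulr0.
  rewrite mulrA mulrC; apply: JM; have mem (i' : 'I_n) : (n - j <= i')%N -> J (fps_var k i').
    by move=> hi; apply: ideal_gen_mem; exists i'.
  apply: ideal_powS; first exact: mem.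
  by rewrite -[fps_var k l]mulr1; apply: ideal_powS; [exact: mem | exact: ideal_pow0].
by rewrite addrC -fps_quo_rem.
Qed.

Theorem formal_morse :
  (char2 -> ~~ odd m) /\
  exists (h : fps n k) (phi : {rmorphism fps n k -> fps n k}),
    [/\ ideal_add
          (ideal_gen [set fps_var k i | i in [set i : 'I_n | (i < d)%N]])
          (ideal_pow (ideal_gen [set fps_var k i | i in [set i : 'I_n | (n - j <= i)%N]]) 2) h,
        fps_indep h (middle d.+1 j),
        bijective phi,
        forall g, fps_indep g (fun i : 'I_n => (d <= i)%N) -> phi g = g
      & phi F = fps_const n (fps0 F) + normal_quadric k n d.+1 j + h].
Proof.
have [L [P [[nP odd_m] uL L_top LP]]] := linear_coordinates; split=> //.
pose lam := subst_rmorphism (@fps_lin0 _ _ L); pose N := normal_gram m.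
pose y i := fps_var k (mid i).
have NE := normal_gramE nP.
have uN : N + N^T \in unitmx by rewrite /N NE; case: nP.
have [_ dP _] := nP.
(* In characteristic 2 the polar form does not determine the diagonal values, so they are matched
   separately. *)
have N_diag i : N i i = (P *m A *m P^T) i i.
  rewrite dP mxE -/char2; case: (char2) => /=; last by rewrite eqxx.
  by rewrite [i == _ :> nat](_ : _ = false) ?andbF //; apply/eqP; lia.
have quad1 p : fcoef (fps_quad N y) (mnm1 p) = 0.
  rewrite fcoef_sum big1 // => i _; rewrite fcoef_sum big1 // => l _.
  rewrite fcoefC (_ : fcoef _ _ = 0) ?mulr0 //.
  apply: (@ord_geM n k (@unit_weight n) 1 1); try exact: (@ord_ge_var _ k (@unit_weight n)).
  by rewrite wdeg_unit mdeg1.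
have quad0 : fps0 (fps_quad N y) = 0.
  rewrite fps0_sum big1 // => i _; rewrite fps0_sum big1 // => l _.
  by rewrite !fps0M fps0_var mul0r mulr0.
have quad2 p q : fcoef (fps_quad N y) (mnm_add (mnm1 (mid p)) (mnm1 (mid q))) =
    N p q + (p != q)%:R * N q p.
  rewrite fcoef_sum.
  have E i : fcoef (\sum_l fps_const n (N i l) * (y i * y l))
      (mnm_add (mnm1 (mid p)) (mnm1 (mid q))) =
      if i == p then N i q else if i == q then N i p else 0.
    have row a : fcoef (\sum_l fps_const n (N i l) * y l) (mnm1 (mid a)) = N i a.
      rewrite fcoef_sum (bigD1 a) // big1 => [|l la]; rewrite fcoefC fcoef_var eq_mnm1 (inj_eq mid_inj).
        by rewrite eqxx mulr1 [LHS]addr0.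
      by rewrite eq_sym (negPf la) mulr0.
    have -> : \sum_l fps_const n (N i l) * (y i * y l) = y i * \sum_l fps_const n (N i l) * y l.
      by rewrite mulr_sumr; apply: eq_bigr => l _; ring.
    by rewrite fcoefX2 !(inj_eq mid_inj) !row.
  under eq_bigr do rewrite E.
  rewrite (bigD1 p) //= eqxx; congr (_ + _).
  have [->|pq] := eqVneq p q.
    by rewrite mul0r big1 // => a aq; rewrite !(negPf aq).
  rewrite mul1r (bigD1 q) /=; last by rewrite eq_sym.
  rewrite [q == p]eq_sym (negPf pq) eqxx big1 ?addr0 // => a /andP[ap aq].
  by rewrite (negPf ap) (negPf aq).
have F1 (p : 'I_n) : (d <= p)%N -> fcoef F (mnm1 p) = 0 by move=> /F_lin; rewrite fps0_deriv.
have lam1 (p : 'I_n) : (d <= p)%N -> fcoef (lam F) (mnm1 p) = 0.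
  move=> dp; rewrite [LHS]fcoef_subst_lin1 big1 // => i _.
  have [id|di] := ltnP i d; last by rewrite F1 // mul0r.
  by rewrite L_top // -val_eqE /= (_ : (i == p :> nat) = false) ?mulr0 //; apply/eqP; lia.
pose G := lam F - fps_quad N y.
have G1 i : fcoef G (mnm1 (mid i)) = 0.
  by rewrite fcoefB lam1 ?quad1 ?subr0 //= leq_addr.
have G2 i l : fcoef G (mnm_add (mnm1 (mid i)) (mnm1 (mid l))) = 0.
  rewrite fcoefB quad2 [X in X - _]fcoef_subst_lin2 !LP (inj_eq mid_inj).
  have [->|il] := eqVneq i l; first by rewrite !mul0r !addr0 N_diag subrr.
  have := congr1 (fun Y : 'M_m => Y i l) NE; rewrite !mul1r [LHS]mxE [(_^T) i l]mxE => ->.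
  have PT : P *m A^T *m P^T = (P *m A *m P^T)^T by rewrite !trmx_mul trmxK mulmxA.
  by rewrite mulmxDr mulmxDl PT [X in _ - X]mxE [(_^T) i l]mxE subrr.
have [phi [h0 [bphi phiP h0P h0w phiF]]] := morse_splitting mid_inj uN G1 G2.
have lam_bij : bijective lam by apply: fps_subst_lin_bij.
have memE i : [pred i | i \in codom mid] i = middle d.+1 j i by rewrite -mem_mid.
(* Constant and linear monomials have weight at most 2, below the bound 4 of the splitting lemma.
   These are the coefficients that decide membership in the ideal. *)
have h_coef u : (wdeg (fun i => if [pred i | i \in codom mid] i then 1%N else 2%N) u < 4)%N ->
    (forall i, middle d.+1 j i -> u i = 0%N) -> fcoef h0 u = fcoef G u.
  move=> u4 u0; apply/eqP; rewrite -subr_eq0; have := h0w u u4.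
  rewrite fcoefB fcoef_rem ifT => [->//|]; apply/forallP => i; apply/implyP.
  by rewrite memE => /u0 ->.
(* The splitting leaves the constant term of [F] inside [h0]; the conclusion displays it
   separately. *)
pose h := h0 - fps_const n (fps0 F).
have hP : fps_indep h (middle d.+1 j).
  move=> u i Mi ui; rewrite fcoefB (h0P u i _ ui) ?memE // fps_constE sub0r.
  rewrite (_ : (u == mnm0) = false) ?mulr0 ?oppr0 //.
  by apply: contraNF ui => /eqP ->; rewrite mnm0E.
have lam0 : fps0 (lam F) = fps0 F by apply: fps0_subst; apply: fps_lin0.
exists h, (phi \o lam); split=> //.
- apply: indep_middle_ideal => // [|i ji].
    rewrite fps0B fps0_const {1}/fps0 h_coef ?wdeg0 // => [|i _]; last by rewrite mnm0E.
    by rewrite -/(fps0 _) fps0B lam0 quad0 subr0 subrr.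
  have Mi : middle d.+1 j i = false by rewrite /middle /= [(i < _)%N]ltnNge ji andbF.
  rewrite fcoefB fps_constE (_ : (mnm1 i == mnm0) = false); last first.
    by apply/eqP => /(congr1 (@mdeg n)); rewrite mdeg0 mdeg1.
  rewrite mulr0 subr0 h_coef.
  + by rewrite fcoefB quad1 subr0 lam1 //; lia.
  + by rewrite wdeg1; case: ifP.
  by move=> l Ml; rewrite mnm1E; apply/eqP; rewrite eqb0; apply: contraFneq Mi => ->.
- exact: bij_comp.
(* [lam] is the identity on the first [d] variables, and [phi] fixes every series free of the middle
   ones. *)
- move=> g gd; change (phi (lam g) = g); have -> : lam g = g.
    apply: (@fps_subst_indep _ _ _ _ g (fun i : 'I_n => (d <= i)%N)) => // [i|i].
      exact: fps_lin0.
    rewrite -ltnNge => id; rewrite -(fps_lin1 k i) /fps_lin; apply: eq_bigr => l _.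
    by rewrite L_top // mxE.
  apply: phiP => u i; rewrite memE => /andP[di _]; exact: gd.
change (phi (lam F) = fps_const n (fps0 F) + normal_quadric k n d.+1 j + h).
by rewrite phiF normal_quadricE /h; ring.
Qed.

End NormalForm.

(** The choice in [value] is unambiguous: subtracting a scalar gives a nonunit only when the scalar
    is the constant term of the chart. *)
Lemma value_chart (k : closedFieldType) (X : ringed_space k) n (x : X)
    (c : {rmorphism stalk x -> fps n k}) (U : opens X) (Ux : U x) (f : sec U) :
  formal_chart c -> value Ux f = fps0 (c (germ Ux f)).
Proof.
move=> ch; have E a : nonunits _ (germ Ux (f - const U a)) <-> a = fps0 (c (germ Ux f)).
  have e : fps0 (c (germ Ux (f - const U a))) = fps0 (c (germ Ux f)) - a.
    by rewrite !rmorphB /= germ_const (chart_const ch) fps0_const.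
  rewrite (chart_local ch) e; split=> [/eqP|->]; last by rewrite subrr.
  by rewrite subr_eq0 => /eqP.
rewrite /value; case: xgetP => [a _ /E //|h].
by case: (h (fps0 (c (germ Ux f)))); apply/E.
Qed.

Theorem proposition1p44 (k : closedFieldType) (X : scheme k) (n : nat)
  (X_smooth : is_smooth X n)
  (Om : differentials X) (E : modsheaf X) (e : nat) (le_en : (e <= n)%N)
  (E_free : is_locally_free E e)
  (T : tensor_product Om E)
  (nabla : forall U : opens X, msec E U -> msec T U)
  (nabla_connection : is_connection nabla)
  (E_generated : horizontally_generated nabla)
  (s : msec E (opensT X)) (j : nat) (x : X) (x_closed : closed [set x])
  (x_in : second_locus nabla s 1 j x)
  (x_notin : ~ second_locus nabla s 1 j.+1 x)
  (U : opens X) (Ux : U x)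
  (v : 'I_e -> msec E U) (v_basis : is_basis v)
  (v_horizontal : forall l, nabla U (v l) = 0)
  (f : 'I_e -> sec U) (s_f : restrict U s = \sum_l f l *: v l)
  (xs : 'I_n -> sec U) (xs_etale : is_basis (fun a => diff Om (xs a)))
  (xs_x : forall a, nonunits _ (germ Ux (xs a)))
  (f_xs : forall l : 'I_e, (l.+1 < e)%N ->
     f l = const U (value Ux (f l)) + xs (widen_ord le_en l))
  (last_e : 'I_e) (last_eE : last_e.+1 = e) :
  [/\ (j <= n - e + 1)%N,
      2%N \in [pchar k] -> ~~ odd (n - e + 1 - j)
    & exists c : {rmorphism stalk x -> fps n k},
      [/\ forall a : k, c (germ Ux (const U a)) = fps_const n a,
          forall i : 'I_n, c (germ Ux (xs i)) = fps_var k i,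
          is_adic_completion (nonunits (stalk x)) c
        & exists (h : fps n k) (phi : {rmorphism fps n k -> fps n k}),
          [/\ ideal_add
                (ideal_gen [set fps_var k i | i in [set i : 'I_n | (i < e.-1)%N]])
                (ideal_pow
                   (ideal_gen [set fps_var k i | i in [set i : 'I_n | (n - j <= i)%N]]) 2)
                h,
              fps_indep h (middle e j),
              bijective phi /\ (forall g, is_unit (phi g) -> is_unit g),
              forall g, fps_indep g (fun i : 'I_n => (e.-1 <= i)%N) -> phi g = g
            & phi (c (germ Ux (f last_e))) =
              fps_const n (value Ux (f last_e)) + normal_quadric k n e j + h]]].
Proof.
(* The index [last_e] excludes [e = 0]. With [e = d + 1], the truncated expression [n - e + 1]
   equals [n - d] because [e <= n]. *)
destruct e as [|d]; first by case: (last_e).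
have eq_last : last_e = ord_max by apply: val_inj => /=; case: last_eE.
rewrite {}eq_last {last_e last_eE}.
have [c [ch c_xs]] := etale_formal_chart xs_etale xs_x X_smooth x_closed.
have val_c (g : sec U) : value Ux g = fps0 (c (germ Ux g)) by apply: value_chart.
have f_top (m : 'I_d) : exists a, c (germ Ux (f (widen_ord (leqnSn d) m))) =
    fps_const n a + fps_var k (widen_ord (ltnW le_en) m).
  exists (value Ux (f (widen_ord (leqnSn d) m))).
  rewrite {1}f_xs ?ltnS //= !rmorphD /= germ_const (chart_const ch) c_xs.
  by congr (_ + fps_var k _); apply: val_inj.
have [F_lin le_j F_hess] := second_locus_hessian nabla_connection ch v_basis
  v_horizontal s_f xs_etale c_xs f_top x_in x_notin.
have [odd_m [h [phi [h_ideal h_mid phi_bij phi_fix phiF]]]] := formal_morse F_lin le_j F_hess.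
have ned : (n - d.+1 + 1 = n - d)%N by rewrite addn1 subnSK.
split; rewrite ?ned //; exists c; split=> //.
- by move=> a; rewrite germ_const (chart_const ch).
- apply: (fps_is_completion_pz (chart_const ch) c_xs); first exact: chart_local ch.
  exact: chart_cotangent ch.
exists h, phi; split=> //; last by rewrite val_c.
split=> // g [b gb]; have [psi psiK phiK] := phi_bij.
exists (psi b); apply: (can_inj psiK); by rewrite rmorphM phiK rmorph1.
Qed.
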